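(* Let $K$ be an imaginary quadratic field and $\tau\in K\cap\mathbb{H}$. Then $J(\tau)$ and $1/I(\tau)$ are algebraic integers.
   Context: $q=e^{2\pi i\tau}$, $q^r=e^{2\pi i r\tau}$ for rational $r$, $(a;q)_\infty=\prod_{k\ge0}(1-aq^k)$. $I(\tau)=q^{3/4}\dfrac{(q;q^{10})_\infty(q^9;q^{10})_\infty}{(q^4;q^{10})_\infty(q^6;q^{10})_\infty}$ and $J(\tau)=q^{1/4}\dfrac{(q^2;q^{10})_\infty(q^8;q^{10})_\infty}{(q^3;q^{10})_\infty(q^7;q^{10})_\infty}$. *)

(* Defs.v *)
From Stdlib Require Import Reals ZArith.
From Coquelicot Require Import Coquelicot.
Open Scope R_scope.

Definition cexp (z : C) : C :=
  (exp (Re z) * cos (Im z), exp (Re z) * sin (Im z)).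

Definition qpow (r : R) (tau : C) : C :=
  cexp (RtoC (2 * PI * r) * Ci * tau)%C.

Fixpoint poch_partial (a b : C) (N : nat) : C :=
  match N with
  | O => 1%C
  | S n => (poch_partial a b n * (1 - a * Cpow b n))%C
  end.

Definition poch_inf (a b : C) : C :=
  (real (Lim_seq (fun N => Re (poch_partial a b N))),
   real (Lim_seq (fun N => Im (poch_partial a b N)))).

Definition Ifun (tau : C) : C :=
  (qpow (3/4) tau *
   (poch_inf (qpow 1 tau) (qpow 10 tau) * poch_inf (qpow 9 tau) (qpow 10 tau)) /
   (poch_inf (qpow 4 tau) (qpow 10 tau) * poch_inf (qpow 6 tau) (qpow 10 tau)))%C.

Definition Jfun (tau : C) : C :=
  (qpow (1/4) tau *
   (poch_inf (qpow 2 tau) (qpow 10 tau) * poch_inf (qpow 8 tau) (qpow 10 tau)) /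
   (poch_inf (qpow 3 tau) (qpow 10 tau) * poch_inf (qpow 7 tau) (qpow 10 tau)))%C.

Definition algebraic_integer (z : C) : Prop :=
  exists (n : nat) (c : nat -> Z),
    (Cpow z (S n) + sum_n (fun k => (RtoC (IZR (c k)) * Cpow z k)%C) n)%C = 0%C.

Definition in_imag_quad_field (D : nat) (z : C) : Prop :=
  exists (p1 q1 p2 q2 : Z), q1 <> 0%Z /\ q2 <> 0%Z /\
    z = (RtoC (IZR p1 / IZR q1) + RtoC (IZR p2 / IZR q2 * sqrt (INR D)) * Ci)%C.

(* Main.v *)
(* Let theta(z) = (e(z/2) - e(-z/2)) prod_(m >= 1) (1 - w q^m) (1 - q^m / w) with e(z) = exp(2 pi i z)
   and w = e(z), and consider the quotients kappa_b(tau) = prod_(s in ns) theta(s z) / prod_(s in ds) theta(s z)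
   at the torsion points z = (b1 tau + b2) / N.  If ns and ds have the same length and the same sum of
   squares, then kappa_b is up to a constant an absolutely convergent product over the lattice
   Z + Z tau, the factor at w being 1 + O(w^-4).  Multiplying by rows (Euler's sine product) or by
   columns gives the same value, hence the invariance under (z, tau) -> (z / tau, -1 / tau), and SL2(Z)
   permutes the kappa_b through its action on b mod N.  For N = 10, J(tau)^4 and I(tau)^-4 are
   values of such functions at 10 tau.

   An SL2(Z)-invariant function whose q-expansion has no polar and no constant term vanishes: a bound B
   for the function bounds all the coefficients, and q is so small on Im tau >= 1/2 that this improves
   B to B / 2.  So an invariant function whose q-expansion has algebraic integer coefficients is a
   polynomial with algebraic integer coefficients in h, any such function with a simple pole and
   invertible leading coefficient; one is built from N = 4.  If an integer matrix of non-square
   determinant m fixes tau, then the product of h - h o A over the classes SL2(Z) A of matrices of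
   determinant m vanishes at tau, while it is a polynomial in h with invertible leading coefficient:
   h(tau) is an algebraic integer, and so are the roots kappa_b(tau) of prod_b (X - kappa_b), whose
   coefficients are polynomials in h. *)

Require Import Defs.
From Stdlib Require Import Reals ZArith.
From Coquelicot Require Import Coquelicot.
From HB Require Import structures.
From mathcomp Require Import all_boot all_order all_algebra.
From mathcomp Require Import boolp reals Rstruct ring lra zify.

Set Implicit Arguments.
Unset Strict Implicit.
Unset Printing Implicit Defensive.

Import Order.TTheory GRing.Theory Num.Theory.
Local Open Scope nat_scope.
Local Open Scope ring_scope.

Bind Scope ring_scope with C.
Bind Scope ring_scope with Rdefinitions.R.
Arguments Cmod _%_ring_scope.
Arguments RtoC _%_ring_scope.
Arguments Coquelicot.Complex.Re _%_ring_scope.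
Arguments Coquelicot.Complex.Im _%_ring_scope.
Arguments cexp _%_ring_scope.
Arguments exp _%_ring_scope.
Arguments cos _%_ring_scope.
Arguments sin _%_ring_scope.
Notation R := Rdefinitions.R.
Notation Re := Coquelicot.Complex.Re.
Notation Im := Coquelicot.Complex.Im.

(** The analysis stays elementary. Functions are handled through uniform polynomial approximations
    on horizontal strips, averages over roots of unity replace Cauchy integrals, and the lattice
    product replaces the transformation laws of eta and theta functions. Theta alone is modular only
    up to exponential factors, which the two balancing conditions remove. This is why fourth powers
    occur: the multipliers 4 and 6, and likewise 1 and 9, give equal theta values up to units, and
    four of each can be mixed so that the squares balance. Integrality needs expansions at every
    cusp. As [SL2(Z)] permutes the [kappa_b], these are the expansions of all the [kappa_b] at
    infinity. Their constant factors are quotients of numbers [1 - x ^ s] with [x] a root of unity;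
    for this orientation of the quotient they are algebraic integers, but not always units. Hence
    [J] and [1/I], not their inverses. That [m] is not a square keeps scalar matrices, whose factor
    [h - h] is identically 0, out of the product over classes. *)

HB.instance Definition _ := Choice.copy C (R * R)%type.
HB.instance Definition _ :=
  GRing.isZmodule.Build C Cplus_assoc Cplus_comm Cplus_0_l
    (fun z => etrans (Cplus_comm _ _) (Cplus_opp_r z)).

Ltac rE := rewrite ?(RplusE,RmultE,RoppE,RminusE,RinvE,RdivE,R0E,R1E).

Lemma C_one_neq0 : RtoC (IZR 1) != 0 :> C.
Proof. by apply/eqP => -[]; exact: R1_neq_R0. Qed.

HB.instance Definition _ :=
  GRing.Zmodule_isComNzRing.Build C Cmult_assoc Cmult_comm Cmult_1_l
    Cmult_plus_distr_r C_one_neq0.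

Lemma C_mulVf (z : C) : z != 0 -> Cmult (Cinv z) z = 1.
Proof. by move/eqP => z0; exact: Cinv_l. Qed.

Lemma C_inv0 : Cinv 0 = 0.
Proof. by rewrite /Cinv /= /Rdiv !Rmult_0_l Ropp_0 !Rmult_0_l. Qed.

HB.instance Definition _ := GRing.ComNzRing_isField.Build C C_mulVf C_inv0.

Lemma CplusE (x y : C) : Cplus x y = x + y. Proof. by []. Qed.
Lemma CmultE (x y : C) : Cmult x y = x * y. Proof. by []. Qed.
Lemma CinvE (x : C) : Cinv x = x^-1. Proof. by []. Qed.
Lemma CdivE (x y : C) : Cdiv x y = x / y. Proof. by []. Qed.
Lemma CpowE (x : C) n : Cpow x n = x ^+ n.
Proof. by elim: n => [|n IH]; rewrite ?expr0 // exprS -IH. Qed.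

Lemma RtoC_is_zmod : zmod_morphism RtoC.
Proof. by move=> x y; exact: RtoC_minus. Qed.
Lemma RtoC_is_monoid : monoid_morphism RtoC.
Proof. by split=> // x y; exact: RtoC_mult. Qed.
HB.instance Definition _ := GRing.isZmodMorphism.Build R C RtoC RtoC_is_zmod.
HB.instance Definition _ := GRing.isMonoidMorphism.Build R C RtoC RtoC_is_monoid.

Lemma ImD (x y : C) : Im (x + y) = Im x + Im y. Proof. by []. Qed.
Lemma ImN (x : C) : Im (- x) = - Im x. Proof. by []. Qed.
Lemma ReD (x y : C) : Re (x + y) = Re x + Re y. Proof. by []. Qed.
Lemma ReN (x : C) : Re (- x) = - Re x. Proof. by []. Qed.
Lemma Im_RtoC (r : R) : Im (RtoC r) = 0. Proof. by []. Qed.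
Lemma Im_scale (r : R) (z : C) : Im (RtoC r * z) = r * Im z.
Proof. by rewrite /Im /=; rE; rewrite mul0r addr0. Qed.
Lemma Re_scale (r : R) (z : C) : Re (RtoC r * z) = r * Re z.
Proof. by rewrite /Re /=; rE; rewrite mul0r subr0. Qed.

Lemma C_eqP (x y : C) : Re x = Re y -> Im x = Im y -> x = y.
Proof. by case: x => a b; case: y => c d; rewrite /Re /Im /= => -> ->. Qed.

Lemma cnM (x y : C) : Cmod (x * y) = Cmod x * Cmod y.
Proof. exact: Cmod_mult. Qed.
Lemma cnD (x y : C) : Cmod (x + y) <= Cmod x + Cmod y.
Proof. by apply/RleP; exact: Cmod_triangle. Qed.
Lemma cn_ge0 (x : C) : 0 <= Cmod x.
Proof. by apply/RleP; exact: Cmod_ge_0. Qed.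
Lemma cn0 : Cmod (0 : C) = 0. Proof. exact: Cmod_0. Qed.
Lemma cn1 : Cmod (1 : C) = 1. Proof. exact: Cmod_1. Qed.
Lemma cnN (x : C) : Cmod (- x) = Cmod x. Proof. exact: Cmod_opp. Qed.
Lemma cn_distC (x y : C) : Cmod (x - y) = Cmod (y - x).
Proof. by rewrite -cnN opprB. Qed.
Lemma cn_eq0 (x : C) : (Cmod x == 0) = (x == 0).
Proof.
apply/eqP/eqP => [|->]; last exact: cn0.
by move/Cmod_eq_0.
Qed.
Lemma cn_gt0 (x : C) : (0 < Cmod x) = (x != 0).
Proof. by rewrite lt_def cn_ge0 cn_eq0 andbT. Qed.
Lemma cnX (x : C) n : Cmod (x ^+ n) = Cmod x ^+ n.
Proof. by elim: n => [|n IH]; rewrite ?expr0 ?cn1 // !exprS cnM IH. Qed.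
Lemma cnV (x : C) : Cmod (x^-1) = (Cmod x)^-1.
Proof.
have [->|x0] := eqVneq x 0; first by rewrite invr0 cn0 invr0.
have c0 : Cmod x != 0 by rewrite cn_eq0.
by apply: (mulfI c0); rewrite -cnM !divff // cn1.
Qed.
Lemma cnR (r : R) : Cmod (RtoC r) = `|r|.
Proof. by rewrite Cmod_R RabsE. Qed.
Lemma cn_nat n : Cmod (n%:R : C) = n%:R.
Proof. by rewrite -(rmorph_nat RtoC) cnR ger0_norm. Qed.
Lemma cn_sum (I : Type) (r : seq I) (P : pred I) (F : I -> C) :
  Cmod (\sum_(i <- r | P i) F i) <= \sum_(i <- r | P i) Cmod (F i).
Proof.
elim/big_rec2: _ => [|i y x _ h]; first by rewrite cn0.
by apply: le_trans (cnD _ _) _; rewrite lerD2l.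
Qed.
Lemma cnB_ge (x y : C) : Cmod x - Cmod y <= Cmod (x - y).
Proof. by rewrite lerBlDr -{1}(subrK y x); exact: cnD. Qed.
Lemma cnB_le (x y : C) : Cmod (x - y) <= Cmod x + Cmod y.
Proof. by rewrite -(cnN y); exact: cnD. Qed.
Lemma cn_Re (z : C) : `|Re z| <= Cmod z.
Proof. by rewrite -RabsE; apply/RleP; exact: Cmod_1_Re || apply: Rle_trans (Rmax_l _ _) (Rmax_Cmod z). Qed.
Lemma cn_Im (z : C) : `|Im z| <= Cmod z.
Proof. by rewrite -RabsE; apply/RleP; apply: Rle_trans (Rmax_r _ _) (Rmax_Cmod z). Qed.

Lemma cn_le_ReIm (z : C) : Cmod z <= `|Re z| + `|Im z|.
Proof.
case: z => a b; have {1}-> : (a, b) = RtoC a + Ci * RtoC b :> C.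
  by apply: C_eqP; rewrite /Complex.Re /Complex.Im /=; rE; rewrite ?(mul0r,mul1r,mulr0,mulr1,addr0,add0r,subr0).
rewrite (le_trans (cnD _ _)) // cnM !cnR.
have -> : Cmod Ci = 1.
  by rewrite /Cmod /= !Rmult_0_l Rplus_0_l !Rmult_1_l sqrt_1.
by rewrite mul1r lexx.
Qed.

(** * The exponential e(v) = exp(2 pi i v) *)

Lemma cexpD (x y : C) : cexp (x + y) = cexp x * cexp y.
Proof.
rewrite /cexp ReD ImD.
rewrite -expRD sinD cosD; apply: C_eqP; rewrite /Complex.Re /Complex.Im /=; rE; ring.
Qed.

Definition qe (v : C) : C := cexp (RtoC (2 * PI) * Ci * v).

Lemma qeD (x y : C) : qe (x + y) = qe x * qe y.
Proof. by rewrite /qe mulrDr cexpD. Qed.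

Lemma qe0 : qe 0 = 1.
Proof.
rewrite /qe mulr0 /cexp; apply: C_eqP; rewrite /Re /Im /= exp_0.
  by rewrite cos_0 Rmult_1_l.
by rewrite sin_0 Rmult_0_r.
Qed.

Lemma qeN (x : C) : qe (- x) = (qe x)^-1.
Proof.
have h : qe x * qe (- x) = 1 by rewrite -qeD subrr qe0.
have x0 : qe x != 0.
  by apply/eqP => e; move: h; rewrite e mul0r => /esym/eqP; rewrite oner_eq0.
by apply: (mulfI x0); rewrite h divff.
Qed.

Lemma qe_neq0 (x : C) : qe x != 0.
Proof.
have h : qe x * qe (- x) = 1 by rewrite -qeD subrr qe0.
by apply/eqP => e; move: h; rewrite e mul0r => /esym/eqP; rewrite oner_eq0.
Qed.

Lemma qeX (x : C) n : qe (n%:R * x) = qe x ^+ n.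
Proof.
by elim: n => [|n IH]; rewrite ?mul0r ?qe0 // exprS -IH -qeD mulrS mulrDl mul1r.
Qed.

Lemma qe_re (v : C) : RtoC (2 * PI) * Ci * v = (- (2 * PI * Im v), 2 * PI * Re v) :> C.
Proof.
apply: C_eqP; rewrite /Re /Im /= ?RmultE ?RplusE ?RoppE ?RminusE ?R0E ?R1E; ring.
Qed.

Lemma cn_qe (v : C) : Cmod (qe v) = exp (- (2 * PI * Im v)).
Proof.
rewrite /qe qe_re /cexp /Cmod /=; rE; rewrite !mulr1 RsqrtE.
set e := exp _; set c := cos _; set s := sin _.
have e0 : 0 <= e by apply/RleP/Rlt_le/exp_pos.
have -> : e * c * (e * c) + e * s * (e * s) = e ^+ 2.
  have h : s * s + c * c = 1 by exact: sin2_cos2.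
  by transitivity (e ^+ 2 * (s * s + c * c)); [ring|rewrite h mulr1].
by rewrite sqrtr_sqr ger0_norm.
Qed.

Lemma qe_real (r : R) : qe (RtoC r) = (cos (2 * PI * r), sin (2 * PI * r)) :> C.
Proof.
rewrite /qe qe_re /cexp Im_RtoC.
by apply: C_eqP; rewrite /Complex.Re /Complex.Im /= mulr0 oppr0 exp_0; rE; rewrite mul1r.
Qed.

Lemma qe1 : qe 1 = 1.
Proof.
rewrite -(rmorph1 RtoC) qe_real mulr1; apply: C_eqP; rewrite /Complex.Re /Complex.Im /=.
  exact: cos_2PI.
exact: sin_2PI.
Qed.

Lemma qe_half : qe (2%:R^-1) = -1.
Proof.
rewrite -(rmorph_nat RtoC) -fmorphV qe_real.
have -> : 2 * PI / 2%:R = PI :> R by field.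
by rewrite cos_PI sin_PI; apply: C_eqP; rewrite /Complex.Re /Complex.Im /= ?oppr0 // Ropp_0.
Qed.

Lemma qe_nat n : qe n%:R = 1.
Proof. by rewrite -[n%:R]mulr1 qeX qe1 expr1n. Qed.

Lemma qe_int (n : int) : qe n%:~R = 1.
Proof.
by case: n => n; rewrite ?NegzE ?mulrNz ?qeN -pmulrn qe_nat ?invr1.
Qed.

(** * Limits and infinite products *)

Definition cvC (u : nat -> C) (l : C) : Prop :=
  forall e : R, 0 < e -> exists N, forall n, (N <= n)%N -> Cmod (u n - l) <= e.

Lemma expD (x y : R) : exp (x + y) = exp x * exp y.
Proof. exact: exp_plus. Qed.

Lemma exp_ge1x (x : R) : 1 + x <= exp x.
Proof. by apply/RleP; rewrite -RplusE; exact: exp_ineq1_le. Qed.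

Lemma exp_gt0 (x : R) : 0 < exp x.
Proof. by apply/RltP; exact: exp_pos. Qed.

Lemma exp_le (x y : R) : x <= y -> exp x <= exp y.
Proof.
rewrite le_eqVlt => /orP[/eqP->//|/RltP h].
by apply/ltW/RltP; exact: exp_increasing.
Qed.

Lemma exp_le_1p2x (x : R) : 0 <= x -> x <= 1 / 2%:R -> exp x <= 1 + 2%:R * x.
Proof.
move=> x0 x1; have h := exp_ge1x (- x); have p := exp_gt0 x.
have e : exp x * exp (- x) = 1 by rewrite -expD subrr expR0.
have h1 : exp x * (1 - x) <= 1 by rewrite -[leRHS]e ler_pM2l.
have h2 : 1 <= (1 + 2%:R * x) * (1 - x).
  rewrite -subr_ge0.
  have -> : (1 + 2%:R * x) * (1 - x) - 1 = x * (1 - 2%:R * x) by ring.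
  by apply: mulr_ge0 => //; lra.
have h3 : 0 < 1 - x by lra.
rewrite -(ler_pM2r h3); apply: le_trans h1 h2.
Qed.

(** [exp B * (exp x - 1)] bounds the effect of a tail of sum [x] on a product of factors [1 + t i]
    whose bounds sum to at most [B], see [prod1p_tail]. *)
Lemma exp_small (B e : R) : 0 < e -> exists2 d, 0 < d &
  forall x, 0 <= x -> x <= d -> exp B * (exp x - 1) <= e.
Proof.
move=> e0; have p := exp_gt0 B.
exists (Num.min (1 / 2%:R) (e / (2%:R * exp B))).
  by rewrite lt_min divr_gt0 //= divr_gt0 // mulr_gt0.
move=> x x0; rewrite le_min => /andP[x1 x2].
have h := exp_le_1p2x x0 x1.
have : exp B * (exp x - 1) <= exp B * (2%:R * x) by rewrite ler_pM2l //; lra.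
move=> /le_trans; apply.
have -> : exp B * (2%:R * x) = x * (2%:R * exp B) by ring.
by rewrite -ler_pdivlMr // mulr_gt0.
Qed.

Lemma prod1p_le (I : Type) (r : seq I) (a : I -> C) (b : I -> R) :
  (forall i, Cmod (a i) <= b i) ->
  Cmod (\prod_(i <- r) (1 + a i) - 1) <= exp (\sum_(i <- r) b i) - 1
  /\ Cmod (\prod_(i <- r) (1 + a i)) <= exp (\sum_(i <- r) b i).
Proof.
move=> h; elim: r => [|i r [IH1 IH2]].
  by rewrite !big_nil subrr cn0 cn1 expR0 subrr.
rewrite !big_cons expD.
set p := \prod_(j <- r) _ in IH1 IH2 *; set E := exp (\sum_(j <- r) _) in IH1 IH2 *.
have E1 : 1 <= E by have := cn_ge0 (p - 1); move: IH1; set c := Cmod _; lra.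
have hb := h i; have hc := cn_ge0 (a i); have he := exp_ge1x (b i).
have h1 : Cmod ((1 + a i) * p - 1) <= E - 1 + Cmod (a i) * E.
  have -> : (1 + a i) * p - 1 = (p - 1) + a i * p by ring.
  apply: le_trans (cnD _ _) _; apply: lerD => //.
  by rewrite cnM ler_wpM2l.
have h2 : E - 1 + Cmod (a i) * E <= exp (b i) * E - 1 by nra.
split; first exact: le_trans h1 h2.
have -> : (1 + a i) * p = ((1 + a i) * p - 1) + 1 by ring.
apply: le_trans (cnD _ _) _; rewrite cn1.
by have := le_trans h1 h2; lra.
Qed.

(** Summability of a nonnegative sequence, with an explicit bound because [B] enters the error terms
    through [exp B]. *)
Definition bounded_sums (b : nat -> R) (B : R) : Prop :=
  (forall n, 0 <= b n) /\ (forall n, \sum_(0 <= i < n) b i <= B).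

Lemma bounded_sums_tail (b : nat -> R) (B e : R) : bounded_sums b B -> 0 < e ->
  exists N, forall m n, (N <= m)%N -> \sum_(m <= i < n) b i <= e.
Proof.
move=> hs; have [b0 hB] := hs; move=> e0.
pose s n := \sum_(0 <= i < n) b i.
have gr : Un_growing s.
  by move=> n; apply/RleP; rewrite /s big_nat_recr //= lerDl.
have [l hl] : {l | Un_cv s l}.
  apply: growing_cv => //; exists B => x [n ->]; apply/RleP; exact: hB.
have [N hN] := CV_Cauchy s (exist _ l hl) e (elimT RltP e0).
exists N => m n Nm; have [mn|nm] := leqP m n; last by rewrite big_geq 1?ltnW // ltW.
have := hN n m; move/(_ (elimT ssrnat.leP (leq_trans Nm mn)))/(_ (elimT ssrnat.leP Nm)).
have es : s n - s m = \sum_(m <= i < n) b i.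
  by rewrite /s (big_cat_nat (n := m) (m := 0%N)) //= [X in X - _]addrC addrK.
move/RltP; rewrite RdistE es.
by move=> /ltW h; apply: le_trans h; exact: ler_norm.
Qed.

Lemma bounded_sums_ge0 b B : bounded_sums b B -> 0 <= B.
Proof. by move=> [_ h]; have := h 0%N; rewrite big_geq. Qed.

Lemma prod1p_tail (t : nat -> C) (b : nat -> R) (B : R) m n :
  bounded_sums b B -> (forall i, Cmod (t i) <= b i) -> (m <= n)%N ->
  Cmod (\prod_(0 <= i < n) (1 + t i) - \prod_(0 <= i < m) (1 + t i))
   <= exp B * (exp (\sum_(m <= i < n) b i) - 1).
Proof.
move=> hs ht mn; rewrite (big_cat_nat (n := m) (m := 0%N)) //=.
set p := \prod_(0 <= i < m) _; set q := \prod_(m <= i < n) _.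
have -> : p * q - p = p * (q - 1) by ring.
rewrite cnM; apply: ler_pM; rewrite ?cn_ge0 //.
  apply: le_trans (proj2 (prod1p_le _ ht)) _.
  by apply: exp_le; exact: (proj2 hs).
exact: (proj1 (prod1p_le _ ht)).
Qed.

Lemma cvC_eq u v l : (forall n, u n = v n) -> cvC u l -> cvC v l.
Proof.
by move=> e h x x0; have [N H] := h x x0; exists N => n Nn; rewrite -e; exact: H.
Qed.

Lemma cvC_cst l : cvC (fun=> l) l.
Proof. by move=> e e0; exists 0%N => n _; rewrite subrr cn0 ltW. Qed.

Lemma cvC_bound u l : cvC u l -> exists2 B, 0 < B & exists N, forall n, (N <= n)%N -> Cmod (u n) <= B.
Proof.
move=> h; exists (Cmod l + 1); first by rewrite ltr_wpDl ?cn_ge0.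
have [N H] := h 1 ltr01; exists N => n Nn.
have -> : u n = l + (u n - l) by ring.
by apply: le_trans (cnD _ _) _; rewrite lerD2l H.
Qed.

Lemma cvC_mul u v a b : cvC u a -> cvC v b -> cvC (fun n => u n * v n) (a * b).
Proof.
move=> h1 h2 e e0.
have [B B0 [N0 H0]] := cvC_bound h1.
pose M := B + Cmod b + 1.
have M0 : 0 < M by have := cn_ge0 b; rewrite /M; lra.
have d0 : 0 < e / 2%:R / M by rewrite !divr_gt0.
have [N1 H1] := h1 _ d0; have [N2 H2] := h2 _ d0.
exists (maxn N0 (maxn N1 N2)) => n; rewrite !geq_max => /and3P[n0 n1 n2].
have -> : u n * v n - a * b = u n * (v n - b) + (u n - a) * b by ring.
apply: le_trans (cnD _ _) _; rewrite !cnM.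
have := H0 _ n0; have := H1 _ n1; have := H2 _ n2.
have := cn_ge0 b; have := cn_ge0 (v n - b); have := cn_ge0 (u n - a); have := cn_ge0 (u n).
have eM : e / 2%:R / M * M = e / 2%:R by rewrite mulfVK // gt_eqF.
set d := e / 2%:R / M in d0 eM *; rewrite /M in eM M0 *.
set x := Cmod (u n); set y := Cmod (v n - b); set z := Cmod (u n - a); set w := Cmod b in M0 eM *.
move=> *; have : x * y <= B * d by apply: ler_pM.
have : z * w <= d * w by rewrite ler_wpM2r.
by nra.
Qed.

Lemma cvC_inv u a : cvC u a -> a != 0 -> cvC (fun n => (u n)^-1) a^-1.
Proof.
move=> h a0 e e0; have c0 : 0 < Cmod a by rewrite cn_gt0.
have d0 : 0 < Num.min (Cmod a / 2%:R) (e * (Cmod a / 2%:R * Cmod a)).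
  by rewrite lt_min divr_gt0 //= !mulr_gt0 // invr_gt0.
have [N H] := h _ d0; exists N => n /H; rewrite le_min => /andP[H1 H2].
have u1 : Cmod a / 2%:R <= Cmod (u n).
  have := cnB_ge a (a - u n); rewrite cn_distC in H1.
  have -> : a - (a - u n) = u n by ring.
  by move: H1; set x := Cmod (a - u n); lra.
have u0 : u n != 0 by rewrite -cn_gt0; apply: lt_le_trans u1; rewrite divr_gt0.
have -> : (u n)^-1 - a^-1 = (a - u n) / (u n * a) by field; rewrite a0.
rewrite cnM cnV cnM cn_distC ler_pdivrMr ?mulr_gt0 ?cn_gt0 //.
apply: le_trans H2 _; apply: ler_wpM2l; first exact: ltW.
by rewrite ler_pM2r.
Qed.

Lemma cvC_prod (I : Type) (r : seq I) (F : I -> nat -> C) (G : I -> C) :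
  (forall i, cvC (F i) (G i)) ->
  cvC (fun n => \prod_(i <- r) F i n) (\prod_(i <- r) G i).
Proof.
move=> h; elim: r => [|i r IH].
  by rewrite big_nil; apply: cvC_eq (cvC_cst 1) => n; rewrite big_nil.
rewrite big_cons; apply: cvC_eq (cvC_mul (h i) IH) => n; by rewrite big_cons.
Qed.

Lemma cvC_le u l a (b : R) N : cvC u l ->
  (forall n, (N <= n)%N -> Cmod (u n - a) <= b) -> Cmod (l - a) <= b.
Proof.
move=> h H; apply/ler_addgt0Pl => e e0; have [M HM] := h _ e0.
have := HM _ (leq_maxl M N); have := H _ (leq_maxr M N).
set x := u _ => A1 A2; have -> : l - a = (x - a) - (x - l) by ring.
by apply: le_trans (cnB_le _ _) _; lra.
Qed.

Lemma cvC_cauchy u :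
  (forall e : R, 0 < e -> exists N, forall m n, (N <= m)%N -> (m <= n)%N -> Cmod (u n - u m) <= e) ->
  exists l, cvC u l.
Proof.
move=> h.
have aux (f : C -> R) : (forall x y, f (x - y) = f x - f y) -> (forall x, `|f x| <= Cmod x) ->
    {l | Un_cv (fun n => f (u n)) l}.
  move=> fB fn; refine (Rcomplete.R_complete (fun n => f (u n)) _) => e /RltP e0.
  have e2 : 0 < e / 2%:R by rewrite divr_gt0.
  have [N H] := h _ e2; exists N => n m /ssrnat.leP Nn /ssrnat.leP Nm; apply/RltP; rewrite RdistE -fB.
  apply: le_lt_trans (fn _) _; apply: (@le_lt_trans _ _ (e / 2%:R)); last by lra.
  have [mn|nm] := leqP m n; first exact: H.
  by rewrite cn_distC; apply: H => //; exact: ltnW.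
have [a ha] := aux Re (fun x y => erefl) cn_Re.
have [b hb] := aux Im (fun x y => erefl) cn_Im.
exists (a, b) => e e0.
have e2 : 0 < e / 2%:R by rewrite divr_gt0.
have [N1 H1] := ha _ (elimT RltP e2); have [N2 H2] := hb _ (elimT RltP e2).
exists (maxn N1 N2) => n; rewrite geq_max => /andP[n1 n2].
have := H1 n (elimT ssrnat.leP n1); have := H2 n (elimT ssrnat.leP n2).
move=> /RltP; rewrite RdistE => A2 /RltP; rewrite RdistE => A1.
apply: le_trans (cn_le_ReIm _) _.
have -> : Re (u n - (a, b) : C) = Re (u n) - a by [].
have -> : Im (u n - (a, b) : C) = Im (u n) - b by [].
by move: A1 A2; set x := `|_|; set y := `|_|; lra.
Qed.

Lemma prod1p_cv (t : nat -> C) (b : nat -> R) (B : R) :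
  bounded_sums b B -> (forall i, Cmod (t i) <= b i) ->
  exists l, cvC (fun n => \prod_(0 <= i < n) (1 + t i)) l
   /\ ((forall i, 1 + t i != 0) -> l != 0).
Proof.
move=> hs ht.
have [l hl] : exists l, cvC (fun n => \prod_(0 <= i < n) (1 + t i)) l.
  apply: cvC_cauchy => e e0; have [d d0 hd] := exp_small B e0.
  have [N hN] := bounded_sums_tail hs d0; exists N => m n Nm mn.
  apply: le_trans (prod1p_tail hs ht mn) _; apply: hd; last exact: hN.
  by apply: sumr_ge0 => i _; exact: (proj1 hs).
exists l; split=> // tn0.
(* Beyond [N] the remaining product stays within 1/2 of 1, so a zero limit would contradict the
   nonvanishing of the first [N] factors. *)
have [d d0 hd] := exp_small 0 (divr_gt0 ltr01 (ltr0Sn R 1)).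
have [N hN] := bounded_sums_tail hs d0.
set p := \prod_(0 <= i < N) (1 + t i).
have p0 : 0 < Cmod p.
  by rewrite cn_gt0 /p prodf_seq_neq0; apply/allP => i _; rewrite tn0.
apply/eqP => l0; rewrite l0 in hl.
have := cvC_le hl (a := p) (N := N) (b := Cmod p * (1 / 2%:R)) _.
rewrite sub0r cnN => h; suff : Cmod p <= Cmod p * (1 / 2%:R) by lra.
apply: h => n Nn; rewrite (big_cat_nat (n := N) (m := 0%N)) //= -/p.
set q := \prod_(N <= i < n) _; have -> : p * q - p = p * (q - 1) by ring.
rewrite cnM ler_pM2l //; apply: le_trans (proj1 (prod1p_le _ ht)) _.
have := hd (\sum_(N <= i < n) b i); rewrite expR0 mul1r; apply; last exact: hN.
by apply: sumr_ge0 => i _; exact: (proj1 hs).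
Qed.

Lemma geom_summ (a r : R) : 0 <= a -> 0 <= r -> r < 1 ->
  bounded_sums (fun n => a * r ^+ n) (a / (1 - r)).
Proof.
move=> a0 r0 r1; split=> [n|n]; first by rewrite mulr_ge0 ?exprn_ge0.
have d0 : 0 < 1 - r by lra.
rewrite -big_distrr /=; apply: ler_wpM2l => //.
rewrite -(ler_pM2l d0) divff; last by rewrite gt_eqF.
rewrite big_mkord -[X in X * _]opprB mulNr -subrX1 opprB lerBlDr lerDl.
exact: exprn_ge0.
Qed.

Lemma poch_partialE (a b : C) n :
  poch_partial a b n = \prod_(0 <= i < n) (1 + - (a * b ^+ i)).
Proof.
by elim: n => [|n IH]; [rewrite big_geq | rewrite big_nat_recr //= IH CpowE].
Qed.

Lemma cvC_poch_inf (a b l : C) : cvC (poch_partial a b) l -> poch_inf a b = l.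
Proof.
move=> h; rewrite /poch_inf.
have aux (f : C -> R) : (forall x y, f (x - y) = f x - f y) -> (forall x, `|f x| <= Cmod x) ->
    real (Lim_seq (fun n => f (poch_partial a b n))) = f l.
  move=> fB fn; rewrite (is_lim_seq_unique _ (f l)) //.
  apply/is_lim_seq_spec => e; have e1 : 0 < (e : R) by apply/RltP; case: e.
  have e2 : 0 < (e : R) / 2%:R by rewrite divr_gt0.
  have [N H] := h _ e2; exists N => n /ssrnat.leP /H A; apply/RltP.
  rewrite RabsE RminusE -fB; apply: le_lt_trans (fn _) _.
  apply: le_lt_trans A _.
  by rewrite ltr_pdivrMr // mulr_natr mulr2n ltrDl.
rewrite (aux Re) ?(aux Im) //; try exact: cn_Re; try exact: cn_Im.
by case: l {h aux}.
Qed.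

Lemma poch_cv (a b : C) : Cmod b < 1 -> cvC (poch_partial a b) (poch_inf a b)
  /\ ((forall i, a * b ^+ i != 1) -> poch_inf a b != 0).
Proof.
move=> b1.
have hs := geom_summ (cn_ge0 a) (cn_ge0 b) b1.
have ht i : Cmod (- (a * b ^+ i)) <= Cmod a * Cmod b ^+ i by rewrite cnN cnM cnX.
have [l [hl l0]] := prod1p_cv hs ht.
have hl' : cvC (poch_partial a b) l.
  by apply: cvC_eq hl => n; rewrite poch_partialE.
rewrite (cvC_poch_inf hl'); split=> // h; apply: l0 => i.
by rewrite subr_eq0 eq_sym h.
Qed.

(** Dominated convergence for products in which both the factors and their number depend on [n].
    After a common cut at [J] both tails are uniformly close to 1, and only finitely many factors
    have to converge. *)
Lemma tannery (t : nat -> nat -> C) (t' : nat -> C) (b : nat -> R) (B : R) (l : C) :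
  bounded_sums b B -> (forall n j, (j < n)%N -> Cmod (t n j) <= b j) ->
  (forall j, Cmod (t' j) <= b j) ->
  (forall j, cvC (fun n => t n j) (t' j)) ->
  cvC (fun n => \prod_(0 <= j < n) (1 + t n j)) l ->
  cvC (fun n => \prod_(0 <= j < n) (1 + t' j)) l.
Proof.
move=> hs ht ht' hc hl e e0.
have e4 : 0 < e / 4%:R by rewrite divr_gt0.
have [d d0 hd] := exp_small B e4.
have [J hJ] := bounded_sums_tail hs d0.
have b0 := proj1 hs.
have sm m n : 0 <= \sum_(m <= i < n) b i by apply: sumr_ge0.
have hJc : cvC (fun n => \prod_(j <- index_iota 0 J) (1 + t n j)) (\prod_(j <- index_iota 0 J) (1 + t' j)).
  apply: (@cvC_prod _ _ (fun j n => 1 + t n j)) => j x x0; have [N H] := hc j x x0; exists N => n /H.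
  by have -> : 1 + t n j - (1 + t' j) = t n j - t' j by ring.
have [N1 H1] := hJc _ e4; have [N2 H2] := hl _ e4.
exists (maxn J (maxn N1 N2)) => n; rewrite !geq_max => /and3P[Jn n1 n2].
pose tn j := if (j < n)%N then t n j else 0.
have htn j : Cmod (tn j) <= b j by rewrite /tn; case: ifP => [/ht//|_]; rewrite cn0.
have eqn m : (m <= n)%N -> \prod_(0 <= j < m) (1 + tn j) = \prod_(0 <= j < m) (1 + t n j).
  move=> mn; apply: eq_big_nat => j /andP[_ jm]; rewrite /tn ifT //.
  exact: leq_trans jm mn.
have A1 := le_trans (prod1p_tail hs htn Jn) (hd _ (sm _ _) (hJ _ _ (leqnn J))).
have A2 := le_trans (prod1p_tail hs ht' Jn) (hd _ (sm _ _) (hJ _ _ (leqnn J))).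
rewrite !eqn // in A1.
have A3 := H1 _ n1; have A4 := H2 _ n2.
move: A1 A2 A3 A4.
set x := \prod_(0 <= j < n) (1 + t n j); set y := \prod_(0 <= j < J) (1 + t n j).
set z := \prod_(0 <= j < n) (1 + t' j); set w := \prod_(0 <= j < J) (1 + t' j).
move=> A1 A2 A3 A4.
have -> : z - l = ((z - w) - (y - w)) + ((x - l) - (x - y)) by ring.
apply: le_trans (cnD _ _) _.
have := cnB_le (z - w) (y - w); have := cnB_le (x - l) (x - y).
by move: A1 A2 A3 A4; set c1 := Cmod _; set c2 := Cmod _; set c3 := Cmod _;
  set c4 := Cmod _; set c5 := Cmod _; set c6 := Cmod _; lra.
Qed.

(** Both iterated products are compared with the same square partial product, whose two orders of
    multiplication agree because it is finite. *)
Lemma double_prod (U : nat -> nat -> C) (b : nat -> R) (B : R) (Rw Cl : nat -> C) (l1 l2 : C) :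
  bounded_sums b B -> (forall m n, Cmod (U m n - 1) <= b m * b n) ->
  (forall m, cvC (fun N => \prod_(0 <= n < N) U m n) (Rw m)) ->
  (forall n, cvC (fun M => \prod_(0 <= m < M) U m n) (Cl n)) ->
  cvC (fun M => \prod_(0 <= m < M) Rw m) l1 ->
  cvC (fun N => \prod_(0 <= n < N) Cl n) l2 -> l1 = l2.
Proof.
move=> hs hU hR hC h1 h2.
have b0 := proj1 hs; have B0 := bounded_sums_ge0 hs.
(* Cutting [M] full rows at column [N] costs at most [e], uniformly in [M], so that [M = N] can be
   taken below, for the rows and for the columns. *)
have main (V : nat -> nat -> C) (S : nat -> C) M N e d :
    (forall m n, Cmod (V m n - 1) <= b m * b n) ->
    (forall m, cvC (fun N => \prod_(0 <= n < N) V m n) (S m)) ->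
    (forall x, 0 <= x -> x <= d -> exp (B * B) * (exp (B * x) - 1) <= e) ->
    (forall m n, (N <= m)%N -> \sum_(m <= i < n) b i <= d) ->
    Cmod (\prod_(0 <= m < M) S m - \prod_(0 <= m < M) \prod_(0 <= n < N) V m n) <= e.
  move=> hV hS hd hN.
  apply: (cvC_le (N := N) (cvC_prod (index_iota 0 M) hS)) => N' NN'.
  have -> : \prod_(m <- index_iota 0 M) \prod_(0 <= n < N') V m n =
     \prod_(0 <= m < M) \prod_(0 <= n < N) V m n * \prod_(0 <= m < M) \prod_(N <= n < N') V m n.
    rewrite -big_split; apply: eq_bigr => m _.
    by rewrite /= -(big_cat_nat (n := N)).
  set p := \prod_(0 <= m < M) _; set q := \prod_(0 <= m < M) _.
  have -> : p * q - p = p * (q - 1) by ring.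
  have est (r : seq nat) x : \sum_(n <- r) b n <= x -> 0 <= x ->
      Cmod (\prod_(0 <= m < M) \prod_(n <- r) V m n - 1) <= exp (B * x) - 1 /\
      Cmod (\prod_(0 <= m < M) \prod_(n <- r) V m n) <= exp (B * x).
    move=> hr x0.
    have -> : \prod_(0 <= m < M) \prod_(n <- r) V m n =
       \prod_(u <- [seq (m, n) | m <- index_iota 0 M, n <- r]) (1 + (V u.1 u.2 - 1)).
      rewrite big_allpairs_dep /=; apply: eq_bigr => m _; apply: eq_bigr => n _.
      by rewrite addrCA subrr addr0.
    have hsum : \sum_(u <- [seq (m, n) | m <- index_iota 0 M, n <- r]) b u.1 * b u.2 <= B * x.
      rewrite big_allpairs_dep /=.
      rewrite (eq_bigr (fun m => b m * \sum_(n <- r) b n)); last by move=> m _; rewrite big_distrr.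
      rewrite -big_distrl /=; apply: ler_pM => //; first by apply: sumr_ge0.
        by apply: sumr_ge0.
      exact: (proj2 hs).
    have [e1 e2] := @prod1p_le _ [seq (m, n) | m <- index_iota 0 M, n <- r]
       (fun u => V u.1 u.2 - 1) (fun u => b u.1 * b u.2) (fun u => hV u.1 u.2).
    have e3 := exp_le hsum.
    split; [apply: le_trans e1 _; by rewrite lerB | exact: le_trans e2 e3].
  have tl := hN N N' (leqnn N); have tl0 : 0 <= \sum_(N <= i < N') b i by apply: sumr_ge0.
  have [_ E1] := est (index_iota 0 N) B (proj2 hs N) B0.
  have [E2 _] := est (index_iota N N') _ (lexx _) tl0.
  rewrite cnM; apply: le_trans (hd _ tl0 tl).
  by apply: ler_pM; rewrite ?cn_ge0.
apply/eqP; rewrite -subr_eq0 -cn_eq0 eq_le cn_ge0 andbT.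
apply/ler_addgt0Pl => e e0; rewrite addr0.
have e4 : 0 < e / 4%:R by rewrite divr_gt0.
have [d d0 hd] := exp_small (B * B) e4.
have B1 : 0 < B + 1 by lra.
have d1 : 0 < d / (B + 1) by rewrite divr_gt0.
have hd' x : 0 <= x -> x <= d / (B + 1) -> exp (B * B) * (exp (B * x) - 1) <= e / 4%:R.
  move=> x0; rewrite ler_pdivlMr // => x1; apply: hd; first exact: mulr_ge0.
  by apply: le_trans x1; rewrite mulrC ler_wpM2l //; lra.
have [N0 hN0] := bounded_sums_tail hs d1.
have [N1 H1] := h1 _ e4; have [N2 H2] := h2 _ e4.
pose N := maxn N0 (maxn N1 N2).
have hN m n : (N <= m)%N -> \sum_(m <= i < n) b i <= d / (B + 1).
  by move=> Nm; apply: hN0; rewrite (leq_trans _ Nm) // leq_maxl.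
have A1 := main _ _ N N _ _ hU hR hd' hN.
have hU' m n : Cmod (U n m - 1) <= b m * b n by rewrite mulrC.
have A2 := main (fun n m => U m n) _ N N _ _ hU' hC hd' hN.
rewrite [X in _ - X]exchange_big /= in A2.
have n1 : (N1 <= N)%N by rewrite /N; lia.
have n2 : (N2 <= N)%N by rewrite /N; lia.
have A3 := H1 N n1; have A4 := H2 N n2.
move: A1 A2 A3 A4.
set x := \prod_(0 <= m < N) Rw m; set y := \prod_(0 <= m < N) Cl m.
set z := \prod_(0 <= m < N) _.
move=> A1 A2 A3 A4.
have -> : l1 - l2 = ((x - z) - (x - l1)) + ((y - l2) - (y - z)) by ring.
apply: le_trans (cnD _ _) _.
have := cnB_le (x - z) (x - l1); have := cnB_le (y - l2) (y - z).
by move: A1 A2 A3 A4; set c1 := Cmod _; set c2 := Cmod _; set c3 := Cmod _;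
  set c4 := Cmod _; set c5 := Cmod _; set c6 := Cmod _; lra.
Qed.

(** * The sine product *)

Definition c2pi : C := RtoC (2 * PI) * Ci.

(* [sinq v] is 2 i sin(pi v). *)
Definition sinq (v : C) : C := qe (v / 2%:R) - qe (- (v / 2%:R)).

Lemma sinqN v : sinq (- v) = - sinq v.
Proof. by rewrite /sinq mulNr opprK opprB. Qed.

Lemma sinq0 : sinq 0 = 0.
Proof. by rewrite /sinq mul0r oppr0 subrr. Qed.

Lemma Ctwo_neq0 : (2%:R : C) != 0.
Proof. by rewrite -cn_eq0 cn_nat pnatr_eq0. Qed.

Lemma Cnat_neq0 n : (n.+1%:R : C) != 0.
Proof. by rewrite -cn_eq0 cn_nat pnatr_eq0. Qed.

Lemma sinq_mul a b : sinq (a - b) * sinq (a + b) = sinq a ^+ 2 - sinq b ^+ 2.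
Proof.
rewrite /sinq !mulrDl !opprD !mulNr !opprK !qeD !qeN; field.
by rewrite !qe_neq0.
Qed.

Lemma qe_sub a b : qe a - qe b = qe ((a + b) / 2%:R) * sinq (a - b).
Proof.
rewrite /sinq mulrBr -!qeD; congr (qe _ - qe _); field; exact: Ctwo_neq0.
Qed.

Lemma qe_sub1 a : qe a - 1 = qe (a / 2%:R) * sinq a.
Proof. by rewrite -{1}qe0 qe_sub addr0 subr0. Qed.

Lemma sinq_real (r : R) : sinq (RtoC r) = RtoC (2%:R * sin (PI * r)) * Ci.
Proof.
rewrite /sinq -(rmorph_nat RtoC) -fmorph_div -rmorphN !qe_real.
have -> : 2 * PI * (r / 2%:R) = PI * r by field.
have -> : 2 * PI * - (r / 2%:R) = - (PI * r) by field.
rewrite cos_neg sin_neg; apply: C_eqP; rewrite /Complex.Re /Complex.Im /=; rE; ring.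
Qed.

Lemma cn_Ci : Cmod Ci = 1.
Proof. by rewrite /Cmod /= !Rmult_0_l Rplus_0_l !Rmult_1_l sqrt_1. Qed.

Lemma PI_ge3 : (3%:R : R) <= PI.
Proof.
apply/RleP; have := PI2_3_2; rewrite -INRE /=; Lra.lra.
Qed.

Lemma sin_PI_ge (r : R) : 0 <= r -> r <= 1 / 2%:R -> r <= sin (PI * r).
Proof.
move=> r0 r1; have p3 := PI_ge3.
have p4 : (PI : R) <= 4%:R by apply/RleP; have := PI_4; rewrite -INRE /=; Lra.lra.
have x0 : 0 <= PI * r by rewrite mulr_ge0 //; lra.
have x2 : PI * r <= 2%:R by have := ler_pM (le_trans (ler0n R 3) p3) r0 p4 r1; lra.
have x4 : Rle (PI * r) (IZR 4) by have := elimT RleP x2; rewrite -INRE /=; Lra.lra.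
(* For [x = PI * r <= 2], [sin x >= x - x ^ 3 / 6 >= x / 3], and [PI >= 3] gives [x / 3 >= r]. *)
have [h _] := pre_sin_bound (PI * r) 0 (elimT RleP x0) x4.
have e : sin_approx (PI * r) 1 = PI * r - (PI * r) ^+ 3 / 6%:R.
  rewrite /sin_approx /sum_f_R0 /sin_term /=; rE.
  have -> : IZR (-1) = -1 :> R by [].
  by field.
move/RleP: h; rewrite e; apply: le_trans; set x := PI * r in x0 x2 *.
have x3 : 3%:R * r <= x by rewrite /x ler_wpM2r.
have : x ^+ 3 / 6%:R <= 4%:R * x / 6%:R.
  rewrite ler_pM2r ?invr_gt0 // exprS mulrC ler_wpM2r //.
  by have := ler_pM x0 x0 x2 x2; rewrite -expr2; lra.
by move: (x ^+ 3 / 6%:R) => y; lra.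
Qed.

Lemma cn_Sf_real (r : R) : 0 <= r -> r <= 1 / 2%:R -> 2%:R * r <= Cmod (sinq (RtoC r)).
Proof.
move=> r0 r1; rewrite sinq_real cnM cn_Ci mulr1 cnR normrM ger0_norm //.
rewrite ler_pM2l //; apply: le_trans (sin_PI_ge r0 r1) _; exact: ler_norm.
Qed.

Lemma sinq_real_neq0 (r : R) : 0 < r -> r < 1 -> sinq (RtoC r) != 0.
Proof.
move=> r0 r1; rewrite sinq_real mulf_neq0 //; last by rewrite -cn_eq0 cn_Ci oner_eq0.
rewrite fmorph_eq0 mulf_neq0 // gt_eqF //; apply/RltP; apply: sin_gt_0; apply/RltP.
  by rewrite mulr_gt0 //; apply/RltP; exact: PI_RGT_0.
by rewrite -ltr_pdivlMl ?mulVf ?gt_eqF //; apply/RltP; exact: PI_RGT_0.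
Qed.

(** A smaller order [m] would make the sine vanish at [m / (n + 1)], strictly between 0 and 1. *)
Lemma qe_prim n : n.+1.-primitive_root (qe (n.+1%:R^-1)).
Proof.
set w := qe _.
have w1 : w ^+ n.+1 = 1 by rewrite -qeX mulfV ?Cnat_neq0 // qe1.
have [m pm dm] := prim_order_exists (ltn0Sn n) w1.
have := dvdn_leq (ltn0Sn n) dm; rewrite leq_eqVlt => /orP[/eqP<-//|mn].
have m0 := prim_order_gt0 pm.
have e : w ^+ m = qe (RtoC (m%:R / n.+1%:R)).
  by rewrite -qeX rmorphM fmorphV !rmorph_nat.
have := prim_expr_order pm; rewrite e => /eqP; rewrite -subr_eq0 qe_sub1 mulf_eq0 (negPf (qe_neq0 _)) /=.
rewrite (negPf (sinq_real_neq0 _ _)) //; first by rewrite divr_gt0 // ltr0n.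
by rewrite ltr_pdivrMr // mul1r ltr_nat.
Qed.

Lemma prod_pair (f : nat -> C) k :
  \prod_(1 <= i < k.*2.+1) f i = \prod_(0 <= j < k) (f j.+1 * f (k.*2 - j)%N).
Proof.
rewrite (big_cat_nat (n := k.+1)) //=; last by rewrite ltnS -addnn leq_addr.
rewrite big_split /= big_add1 /=; congr (_ * _).
rewrite big_nat_rev /= -{1}[k.+1]add0n big_addn.
have -> : (k.*2.+1 - k.+1 = k)%N by rewrite -addnn subSS addnK.
by apply: eq_big_nat => i /andP[_ ik]; congr f; lia.
Qed.

(** [N] is odd, so the nontrivial roots of unity fall into pairs of exponents [i] and [N - i]; each
    pair gives a difference of squared sines. *)
Lemma prod_roots (v : C) k (N := k.*2.+1) :
  \prod_(1 <= i < N) (qe v - qe (N%:R^-1) ^+ i) =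
  \prod_(0 <= j < k) (qe v * (sinq v ^+ 2 - sinq (RtoC (j.+1%:R / N%:R)) ^+ 2)).
Proof.
rewrite prod_pair; apply: eq_big_nat => j /andP[_ jk].
have N0 : (N%:R : C) != 0 by exact: Cnat_neq0.
rewrite -!qeX.
have -> : qe ((k.*2 - j)%N%:R * N%:R^-1) = qe (- (j.+1%:R / N%:R)).
  have -> : (k.*2 - j)%N%:R * N%:R^-1 = - (j.+1%:R / N%:R) + 1 :> C.
    have -> : (k.*2 - j)%N = (N - j.+1)%N by rewrite /N; lia.
    rewrite natrB ?/N; last by lia.
    by rewrite mulrBl mulfV // addrC.
  by rewrite qeD qe1 mulr1.
rewrite rmorphM fmorphV !rmorph_nat; set a := _ / _.
rewrite !qe_sub mulrACA opprK sinq_mul -qeD; congr (qe _ * _).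
by field; exact: Ctwo_neq0.
Qed.

(** This is the factorization of [X ^ N - 1] over the roots of unity, at [X = qe (u / N)]. The
    constant comes from the quotient by [X - 1], whose value at [X = 1] is [N]. *)
Lemma sinq_finite (u : C) k (N := k.*2.+1) :
  sinq u = N%:R * sinq (u / N%:R) *
    \prod_(0 <= j < k) (1 + - (sinq (u / N%:R) ^+ 2 / sinq (RtoC (j.+1%:R / N%:R)) ^+ 2)).
Proof.
have N0 : (N%:R : C) != 0 by exact: Cnat_neq0.
set v := u / N%:R; set s := fun j => sinq (RtoC (j.+1%:R / N%:R)).
have sn0 j : (j < k)%N -> s j != 0.
  move=> jk; apply: sinq_real_neq0; first by rewrite divr_gt0 // ltr0n.
  by rewrite ltr_pdivrMr ?ltr0n // mul1r ltr_nat /N; lia.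
have F := factor_Xn_sub_1 (qe_prim k.*2).
have F1 : \prod_(1 <= i < N) ('X - (qe (N%:R^-1) ^+ i)%:P) = \sum_(i < N) 'X^i :> {poly C}.
  have X1 : ('X - 1 : {poly C}) != 0 by rewrite -polyC1 polyXsubC_eq0.
  apply: (mulfI X1); rewrite -subrX1 -F [RHS]big_ltn // expr0 polyC1.
have E1 (x : C) : \prod_(1 <= i < N) (x - qe (N%:R^-1) ^+ i) = (\sum_(i < N) 'X^i : {poly C}).[x].
  rewrite -F1 horner_prod; apply: eq_bigr => i _; by rewrite hornerXsubC.
have P1 : \prod_(0 <= j < k) (- s j ^+ 2) = N%:R.
  have := prod_roots 0 k; rewrite /= -/N qe0 E1 horner_sum sinq0.
  rewrite (eq_bigr (fun=> 1)); last by move=> i _; rewrite hornerXn expr1n.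
  rewrite sumr_const card_ord => ->; apply: eq_bigr => j _.
  by rewrite mul1r expr0n sub0r.
have P2 : qe u - 1 = (qe v - 1) * \prod_(0 <= j < k) (qe v * (sinq v ^+ 2 - s j ^+ 2)).
  have := prod_roots v k; rewrite /= -/N E1 horner_sum /s => <-.
  rewrite (eq_bigr (fun i : 'I_N => qe v ^+ i)); last by move=> i _; rewrite hornerXn.
  rewrite -subrX1 -qeX; congr (qe _ - 1); rewrite /v; field.
  exact: N0.
have P3 : \prod_(0 <= j < k) (qe v * (sinq v ^+ 2 - s j ^+ 2)) =
   qe v ^+ k * (N%:R * \prod_(0 <= j < k) (1 + - (sinq v ^+ 2 / s j ^+ 2))).
  rewrite -P1 -[k in qe v ^+ k]subn0 -prodr_const_nat -!big_split /=.
  apply: eq_big_nat => j /andP[_ jk]; field; exact: sn0.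
have P4 : qe (u / 2%:R) = qe (v / 2%:R) * qe v ^+ k.
  have ek : (k%:R : C) = (N%:R - 1) / 2%:R.
    rewrite /N -natr1 addrK -muln2 natrM; field; exact: Ctwo_neq0.
  rewrite -qeX -qeD; congr qe; rewrite ek /v; field.
  by rewrite Ctwo_neq0 N0.
apply: (mulfI (qe_neq0 (u / 2%:R))); rewrite -qe_sub1 P2 P3 qe_sub1 P4.
rewrite /v /s; ring.
Qed.

Lemma cvC_sub u l (f : nat -> nat) : (forall n, (n <= f n)%N) -> cvC u l -> cvC (fun n => u (f n)) l.
Proof.
move=> hf h e e0; have [N H] := h e e0; exists N => n Nn; apply: H.
exact: leq_trans Nn (hf n).
Qed.

Lemma cvC_eqN u v l N : (forall n, (N <= n)%N -> u n = v n) -> cvC u l -> cvC v l.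
Proof.
move=> he h e e0; have [M H] := h e e0; exists (maxn N M) => n.
by rewrite geq_max => /andP[n1 n2]; rewrite -he //; exact: H.
Qed.

Lemma cvC_bounded u l : cvC u l -> exists2 B, 0 < B & forall n, Cmod (u n) <= B.
Proof.
move=> /cvC_bound[B B0 [N H]]; exists (B + \sum_(0 <= i < N) Cmod (u i)).
  by rewrite ltr_wpDr // sumr_ge0 // => i _; exact: cn_ge0.
move=> n; have s0 r : 0 <= \sum_(i <- r) Cmod (u i) by rewrite sumr_ge0 // => i _; exact: cn_ge0.
have [Nn|nN] := leqP N n; first by apply: le_trans (H n Nn) _; rewrite lerDl.
rewrite (big_cat_nat (n := n)) //= 1?ltnW // [X in _ + (_ + X)]big_ltn //=.
have := s0 (index_iota 0 n); have := s0 (index_iota n.+1 N).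
by set x := \sum_(_ <- _) _; set y := \sum_(_ <- _) _; lra.
Qed.

Lemma cvC_add u v a b : cvC u a -> cvC v b -> cvC (fun n => u n + v n) (a + b).
Proof.
move=> h1 h2 e e0; have e2 : 0 < e / 2%:R by rewrite divr_gt0.
have [N1 H1] := h1 _ e2; have [N2 H2] := h2 _ e2.
exists (maxn N1 N2) => n; rewrite geq_max => /andP[/H1 A1 /H2 A2].
have -> : u n + v n - (a + b) = (u n - a) + (v n - b) by ring.
by apply: le_trans (cnD _ _) _; lra.
Qed.

Lemma deriv_lim (f : R -> R) (l : R) : is_derive f 0 l ->
  forall e : R, 0 < e -> exists N, forall n, (N <= n)%N ->
   `|n.+1%:R * (f (n.+1%:R^-1) - f 0) - l| <= e.
Proof.
move=> /is_derive_Reals h e /RltP e0; have [d hd] := h e e0.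
have d0 : 0 < (d : R) by apply/RltP; case: d {hd}.
have [N hN] : exists N : nat, (d : R)^-1 < N%:R.
  by exists (Num.bound (d : R)^-1); apply: le_lt_trans (archi_boundP _); rewrite ?ler_norm // invr_ge0 ltW.
exists N => n Nn.
have p0 : 0 < n.+1%:R^-1 :> R by rewrite invr_gt0 ltr0n.
have pd : n.+1%:R^-1 < (d : R).
  rewrite invf_plt ?posrE ?ltr0n //; apply: lt_le_trans hN _.
  by rewrite ler_nat (leq_trans Nn).
have := hd n.+1%:R^-1 (elimN eqP (lt0r_neq0 p0)).
rewrite RabsE gtr0_norm // => /(_ (elimT RltP pd))/RltP; rewrite RabsE; rE; rewrite add0r invrK mulrC.
exact: ltW.
Qed.

(** The derivative at 0 of the real-variable function [t -> cexp (t w)], taken separately on real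
    and imaginary parts. *)
Lemma cexp_lim (w : C) : cvC (fun n => n.+1%:R * (cexp (w / n.+1%:R) - 1)) w.
Proof.
move=> e e0; have e2 : 0 < e / 2%:R by rewrite divr_gt0.
have d1 : is_derive (fun t : R => Re (cexp (RtoC t * w))) 0 (Re w).
  apply: (is_derive_ext (fun t : R => Rmult (exp (Rmult t (Re w))) (cos (Rmult t (Im w))))).
    by move=> t; rewrite /cexp Im_scale Re_scale.
  auto_derive => //; rE; rewrite !mul0r exp_0 cos_0 sin_0; rE; ring.
have d2 : is_derive (fun t : R => Im (cexp (RtoC t * w))) 0 (Im w).
  apply: (is_derive_ext (fun t : R => Rmult (exp (Rmult t (Re w))) (sin (Rmult t (Im w))))).
    by move=> t; rewrite /cexp Im_scale Re_scale.
  auto_derive => //; rE; rewrite !mul0r exp_0 cos_0 sin_0; rE; ring.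
have [N1 H1] := deriv_lim d1 e2; have [N2 H2] := deriv_lim d2 e2.
exists (maxn N1 N2) => n; rewrite geq_max => /andP[/H1 A1 /H2 A2].
have c0 : cexp (RtoC 0 * w) = 1 by rewrite mul0r -qe0 /qe mulr0.
rewrite c0 in A1 A2.
apply: le_trans (cn_le_ReIm _) _.
have -> : w / n.+1%:R = RtoC (n.+1%:R^-1) * w by rewrite fmorphV rmorph_nat mulrC.
rewrite -(rmorph_nat RtoC n.+1) ReD ImD ReN ImN Re_scale Im_scale ReD ImD ReN ImN.
by move: A1 A2; set x := `|_|; set y := `|_|; lra.
Qed.

Lemma sinq_lim (u : C) : cvC (fun n => n.+1%:R * sinq (u / n.+1%:R)) (c2pi * u).
Proof.
have h := cvC_add (cexp_lim (c2pi * (u / 2%:R)))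
  (cvC_mul (cvC_cst (-1)) (cexp_lim (c2pi * - (u / 2%:R)))).
have e : c2pi * (u / 2%:R) + -1 * (c2pi * - (u / 2%:R)) = c2pi * u.
  field; exact: Ctwo_neq0.
rewrite e in h; apply: cvC_eq h => n.
rewrite /sinq /qe -/c2pi.
have -> : c2pi * (u / n.+1%:R / 2%:R) = c2pi * (u / 2%:R) / n.+1%:R.
  by rewrite !mulrA mulrAC.
have -> : c2pi * - (u / n.+1%:R / 2%:R) = c2pi * - (u / 2%:R) / n.+1%:R.
  by rewrite !mulrN !mulNr !mulrA mulrAC.
ring.
Qed.

Lemma inv_sq_summ (c : R) : 0 <= c -> bounded_sums (fun n => c / n.+1%:R ^+ 2) (c * 2%:R).
Proof.
move=> c0; split=> [n|n]; first by rewrite divr_ge0 // exprn_ge0 // ler0n.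
rewrite -big_distrr /=; apply: ler_wpM2l => //.
suff h m : \sum_(0 <= i < m.+1) (i.+1%:R ^+ 2)^-1 <= 2%:R - m.+1%:R^-1 :> R.
  case: n => [|n]; first by rewrite big_geq.
  by apply: le_trans (h n) _; rewrite gerBl invr_ge0 ler0n.
elim: m => [|m IH]; first by rewrite big_nat1 expr1n invr1; lra.
rewrite big_nat_recr //=; apply: le_trans (lerD IH (lexx _)) _.
have x0 : 0 < m.+1%:R :> R by rewrite ltr0n.
rewrite -[m.+2%:R]natr1; move: (m.+1%:R) x0 => x x0.
have x1 : 0 < x + 1 by lra.
rewrite -subr_ge0.
have -> : 2%:R - (x + 1)^-1 - (2%:R - x^-1 + ((x + 1) ^+ 2)^-1) = (x * (x + 1) ^+ 2)^-1.
  by field; rewrite !gt_eqF.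
by rewrite invr_ge0 mulr_ge0 ?exprn_ge0 // ltW.
Qed.

(** The limit of [sinq_finite] over odd [N], by [tannery]. The domination rests on [cn_Sf_real],
    since [j + 1 <= k] keeps [(j + 1) / N] below 1/2. In the constant [c], the part [M ^ 2] serves
    the finite factors and [Cmod u ^ 2] their limits. *)
Lemma sine_product (u : C) :
  cvC (fun k => c2pi * u * \prod_(0 <= j < k) (1 + - (u ^+ 2 / j.+1%:R ^+ 2))) (sinq u).
Proof.
have [->|u0] := eqVneq u 0.
  by rewrite sinq0; apply: cvC_eq (cvC_cst 0) => k; rewrite mulr0 mul0r.
have c0 : c2pi != 0.
  rewrite -cn_eq0 cnM cn_Ci mulr1 cnR normr_eq0 gt_eqF // mulr_gt0 //.
  by apply/RltP; exact: PI_RGT_0.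
have cu0 : c2pi * u != 0 by rewrite mulf_neq0.
have le2 n : (n <= n.*2)%N by rewrite -addnn leq_addr.
have hD a := cvC_sub le2 (sinq_lim a).
pose t k j := - (sinq (u / k.*2.+1%:R) ^+ 2 / sinq (RtoC (j.+1%:R / k.*2.+1%:R)) ^+ 2).
pose t' j := - (u ^+ 2 / j.+1%:R ^+ 2).
have [M M0 hM] := cvC_bounded (hD u).
pose c := M ^+ 2 + Cmod u ^+ 2.
have c1 : 0 <= c by rewrite addr_ge0 // exprn_ge0 // ?cn_ge0 // ltW.
suff h : cvC (fun k => \prod_(0 <= j < k) (1 + t' j)) (sinq u / (c2pi * u)).
  have e : c2pi * u * (sinq u / (c2pi * u)) = sinq u by rewrite mulrC mulfVK.
  by have := cvC_mul (cvC_cst (c2pi * u)) h; rewrite e.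
apply: (tannery (t := t) (inv_sq_summ c1)).
- move=> n j jn; rewrite /t cnN cnM cnV !cnX ler_pdivlMr ?exprn_gt0 ?ltr0n //.
  set N : R := n.*2.+1%:R; have N0 : 0 < N by rewrite ltr0n.
  have hS : 2%:R * (j.+1%:R / N) <= Cmod (sinq (RtoC (j.+1%:R / N))).
    apply: cn_Sf_real; first by rewrite divr_ge0 ?ler0n // ltW.
    by rewrite ler_pdivrMr // mulrC mul1r ler_pdivlMr // -natrM ler_nat; lia.
  have hU : Cmod (sinq (u / n.*2.+1%:R)) <= M / N.
    by have := hM n; rewrite cnM cn_nat -/N mulrC ler_pdivlMr.
  move: hS hU; set s := Cmod _; set w := Cmod _ => hS hU.
  have j0 : 0 < j.+1%:R :> R by rewrite ltr0n.
  have s0 : 0 < s by apply: lt_le_trans hS; rewrite mulr_gt0 // divr_gt0.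
  have h1 : w * j.+1%:R <= M * s.
    apply: (@le_trans _ _ (M / N * j.+1%:R)); first by rewrite ler_pM2r.
    rewrite -mulrA ler_pM2l //; apply: le_trans hS; rewrite mulrC.
    by rewrite mulr_natl mulr2n lerDl divr_ge0 // ltW.
  have w0 : 0 <= w by exact: cn_ge0.
  have h2 : (w * j.+1%:R) ^+ 2 <= (M * s) ^+ 2.
    by rewrite !expr2; apply: ler_pM => //; rewrite mulr_ge0 // ltW.
  have -> : w ^+ 2 / s ^+ 2 * j.+1%:R ^+ 2 = (w * j.+1%:R) ^+ 2 / s ^+ 2 by rewrite exprMn mulrAC.
  rewrite ler_pdivrMr ?exprn_gt0 //; apply: le_trans h2 _.
  by rewrite exprMn ler_pM2r ?exprn_gt0 // /c lerDl exprn_ge0 // cn_ge0.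
- move=> j; rewrite cnN cnM cnV !cnX cn_nat ler_pM2r ?invr_gt0 ?exprn_gt0 ?ltr0n //.
  by rewrite /c lerDr exprn_ge0 // ltW.
- move=> j.
  have a0 : c2pi * j.+1%:R != 0 by rewrite mulf_neq0 // Cnat_neq0.
  have h := cvC_mul (cvC_cst (-1)) (cvC_mul (cvC_mul (hD u) (hD u))
     (cvC_inv (cvC_mul (hD j.+1%:R) (hD j.+1%:R)) (mulf_neq0 a0 a0))).
  have e : - (u ^+ 2 / j.+1%:R ^+ 2) = -1 * (c2pi * u * (c2pi * u) / (c2pi * j.+1%:R * (c2pi * j.+1%:R))).
    by move: (j.+1%:R) (Cnat_neq0 j) => a an; field; rewrite an c0.
  rewrite /t' e; apply: cvC_eq h => n; rewrite /t rmorphM fmorphV !rmorph_nat mulN1r; congr (- _).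
  set s := sinq (_ / _); set s' := sinq (_ / _); rewrite -!expr2 !exprMn invfM mulrACA mulfV ?mul1r //.
  by rewrite expf_neq0 // Cnat_neq0.
- have cp : 0 < Cmod (c2pi * u) by rewrite cn_gt0.
  (* From [N0] on, [N * sinq (u / N)] is closer to its limit than the modulus of that limit, hence
     nonzero, and can be divided out of [sinq_finite]. *)
  have [N0 HN0] := hD u _ (divr_gt0 cp (ltr0Sn R 1)).
  apply: (cvC_eqN (N := N0) _ (cvC_mul (cvC_cst (sinq u)) (cvC_inv (hD u) cu0))) => n /HN0 A.
  rewrite (sinq_finite u n) mulrC mulKf //.
  apply/eqP => z; move: A; rewrite z sub0r cnN => A.
  by lra.
Qed.

(** * Theta quotients *)

Definition prod_quot (ns ds : seq nat) (f : nat -> C) : C :=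
  (\prod_(s <- ns) f s) / \prod_(s <- ds) f s.

Lemma prod_quot_mul ns ds f g : prod_quot ns ds (fun s => f s * g s) = prod_quot ns ds f * prod_quot ns ds g.
Proof. by rewrite /prod_quot !big_split /= invfM mulrACA. Qed.

Lemma PI_gt0 : (0 : R) < PI.
Proof. by apply/RltP; exact: PI_RGT_0. Qed.

Lemma PI2_gt0 : (0 : R) < 2 * PI.
Proof. by apply: mulr_gt0; [exact: ltr0Sn | exact: PI_gt0]. Qed.

Lemma prod_seq_cst (T : Type) (r : seq T) (c : C) : \prod_(s <- r) c = c ^+ size r.
Proof. by elim: r => [|x r IH]; rewrite ?big_nil // big_cons IH exprS. Qed.

Lemma prod_quot_cst ns ds c : size ns = size ds -> c != 0 -> prod_quot ns ds (fun=> c) = 1.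
Proof.
by move=> e c0; rewrite /prod_quot !prod_seq_cst e divff // expf_neq0.
Qed.

Lemma eq_prod_quot ns ds f g : (forall s, s \in ns ++ ds -> f s = g s) -> prod_quot ns ds f = prod_quot ns ds g.
Proof.
move=> h; rewrite /prod_quot; congr (_ / _); rewrite big_seq [RHS]big_seq; apply: eq_bigr => s si;
  by rewrite h // mem_cat si ?orbT.
Qed.

(** Equal lengths make every factor independent of the multiplier [s] cancel: normalizing constants,
    powers of [c2pi] and [z], and exponentials all disappear this way. *)
Lemma prod_quot_scale ns ds c f : size ns = size ds -> c != 0 ->
  prod_quot ns ds (fun s => c * f s) = prod_quot ns ds f.
Proof. by move=> e c0; rewrite prod_quot_mul prod_quot_cst ?mul1r. Qed.

Lemma prod_quot_prod ns ds (r : seq nat) (f : nat -> nat -> C) :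
  prod_quot ns ds (fun s => \prod_(n <- r) f s n) = \prod_(n <- r) prod_quot ns ds (f^~ n).
Proof.
rewrite /prod_quot [in LHS]exchange_big [X in _ / X]exchange_big /=.
elim: r => [|n r IH]; first by rewrite !big_nil divr1.
by rewrite !big_cons invfM mulrACA IH.
Qed.

Lemma prod_seq_neq0 (T : eqType) (r : seq T) (f : T -> C) :
  (forall s, s \in r -> f s != 0) -> \prod_(s <- r) f s != 0.
Proof. by move=> h; rewrite prodf_seq_neq0; apply/allP => s /h. Qed.

Lemma prod_quot_cv ns ds (F : nat -> nat -> C) (G : nat -> C) :
  (forall s, s \in ns ++ ds -> cvC (F s) (G s)) -> (forall s, s \in ds -> G s != 0) ->
  cvC (fun n => prod_quot ns ds (F^~ n)) (prod_quot ns ds G).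
Proof.
move=> h h0; pose F' s := if s \in ns ++ ds then F s else fun=> G s.
have h' s : cvC (F' s) (G s) by rewrite /F'; case: ifP => [/h//|_]; exact: cvC_cst.
have := cvC_mul (cvC_prod ns h') (cvC_inv (cvC_prod ds h') (prod_seq_neq0 h0)).
by apply: cvC_eq => n; rewrite -/(prod_quot _ _ _); apply: eq_prod_quot => s si; rewrite /F' si.
Qed.

Definition theta (z tau : C) : C :=
  sinq z * (poch_inf (qe (z + tau)) (qe tau) * poch_inf (qe (tau - z)) (qe tau)).

Definition theta_quot (ns ds : seq nat) (z tau : C) : C :=
  prod_quot ns ds (fun s => theta (s%:R * z) tau).

Definition off_lattice (r : seq nat) (z tau : C) : Prop :=
  forall s, s \in r -> forall m n : int, s%:R * z != m%:~R * tau + n%:~R.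

Definition balanced (ns ds : seq nat) : Prop :=
  size ns = size ds /\ (\sum_(s <- ns) s ^ 2 = \sum_(s <- ds) s ^ 2)%N.

Lemma qe_eq1 (x : C) : qe x = 1 -> exists n : int, x = n%:~R.
Proof.
move=> h.
have im0 : Im x = 0.
  have := cn_qe x; rewrite h cn1 => e.
  have e1 : exp (- (2 * PI * Im x)) = exp 0 by rewrite -e expR0.
  have := exp_inv _ _ e1 => /eqP; rewrite oppr_eq0 mulf_eq0 => /orP[|/eqP//].
  by rewrite gt_eqF // PI2_gt0.
have ex : x = RtoC (Re x) by apply: C_eqP; rewrite ?Im_RtoC.
exists (Num.floor (Re x)).
have [r0 r1] := (floor_le (Re x), floorD1_gt (Re x)).
set m := Num.floor _ in r0 r1 *.
have e : x = RtoC (Re x - m%:~R) + m%:~R.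
  by rewrite rmorphB /= rmorph_int subrK -ex.
have [z|nz] := eqVneq (Re x - m%:~R) 0; first by rewrite e z add0r.
have : sinq (RtoC (Re x - m%:~R)) != 0.
  apply: sinq_real_neq0; last by move: r1; rewrite rmorphD /=; lra.
  by rewrite lt_def nz subr_ge0.
have : qe (RtoC (Re x - m%:~R)) = 1 by rewrite -h [in RHS]e qeD qe_int mulr1.
by move/eqP; rewrite -subr_eq0 qe_sub1 mulf_eq0 (negPf (qe_neq0 _)) /= => ->.
Qed.

Lemma cn_qe_lt1 (tau : C) : 0 < Im tau -> Cmod (qe tau) < 1.
Proof.
move=> t0; rewrite cn_qe -[ltRHS]expR0; apply/RltP; apply: exp_increasing; apply/RltP.
by rewrite oppr_lt0; apply: mulr_gt0 => //; exact: PI2_gt0.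
Qed.

Lemma theta_neq0 (z tau : C) : 0 < Im tau ->
  (forall m n : int, z != m%:~R * tau + n%:~R) -> theta z tau != 0.
Proof.
move=> t0 h.
have hq (x : C) : (forall n : int, x != n%:~R) -> qe x != 1.
  by move=> has_some_qexp; apply/eqP => /qe_eq1[n e]; have := has_some_qexp n; rewrite e eqxx.
have q1 := cn_qe_lt1 t0.
rewrite /theta !mulf_neq0 //.
- have : qe z != 1 by apply: hq => n; have := h 0 n; rewrite mul0r add0r.
  by rewrite -subr_eq0 qe_sub1 mulf_eq0 negb_or => /andP[].
- apply: (proj2 (poch_cv _ q1)) => i; rewrite -qeX -qeD; apply: hq => n.
  have := h (- (i.+1%:Z)) n; apply: contra => /eqP e; apply/eqP; rewrite -e mulrNz -pmulrn -natr1; ring.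
- apply: (proj2 (poch_cv _ q1)) => i; rewrite -qeX -qeD; apply: hq => n.
  have := h (i.+1%:Z) (- n); apply: contra => /eqP e; apply/eqP; rewrite mulrNz -e -pmulrn -natr1; ring.
Qed.

Lemma theta_cv (z tau : C) : 0 < Im tau ->
  cvC (fun M => sinq z * \prod_(0 <= m < M) ((1 - qe (z + tau) * qe tau ^+ m) * (1 - qe (tau - z) * qe tau ^+ m)))
      (theta z tau).
Proof.
move=> t0; have q1 := cn_qe_lt1 t0.
have h := cvC_mul (cvC_cst (sinq z)) (cvC_mul (proj1 (poch_cv (qe (z + tau)) q1)) (proj1 (poch_cv (qe (tau - z)) q1))).
apply: cvC_eq h => M; congr (_ * _); rewrite !poch_partialE -big_split /=.
by apply: eq_bigr => i _.
Qed.

(** Matches the sines of the rows [m] and [- m] of the lattice, for [t = m tau], with the two theta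
    factors of index [m]. The factor [- qe (- t)] is free of [a], so it cancels in quotients. *)
Lemma sinq_row (a t : C) :
  sinq (a - t) * sinq (a + t) = - qe (- t) * ((1 - qe (a + t)) * (1 - qe (t - a))).
Proof.
have sq x : sinq x ^+ 2 = qe x - 2%:R + qe (- x).
  have -> : qe x = qe (x / 2%:R) ^+ 2 by rewrite -qeX; congr qe; field; exact: Ctwo_neq0.
  by rewrite /sinq !qeN; have -> : qe x = qe (x / 2%:R) ^+ 2;
   [rewrite -qeX; congr qe; field; exact: Ctwo_neq0 | field; exact: qe_neq0].
rewrite sinq_mul !sq !qeD !qeN; field; by rewrite !qe_neq0.
Qed.

(** * Inversion *)

Definition lattice_factor (ns ds : seq nat) (z w : C) : C := prod_quot ns ds (fun s => (s%:R * z) ^+ 2 - w ^+ 2).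

(* The factors of the product over the lattice points [m tau + n] up to sign:
   the points [+- m tau +- n] contribute together. *)
Definition quad_factor (ns ds : seq nat) (z tau : C) (m n : nat) : C :=
  if m == 0%N then (if n == 0%N then 1 else lattice_factor ns ds z n%:R)
  else if n == 0%N then lattice_factor ns ds z (m%:R * tau)
  else lattice_factor ns ds z (m%:R * tau + n%:R) * lattice_factor ns ds z (m%:R * tau - n%:R).

Lemma lattice_factorN ns ds z w : lattice_factor ns ds z (- w) = lattice_factor ns ds z w.
Proof. by rewrite /lattice_factor sqrrN. Qed.

Lemma lattice_factor_scale ns ds z w c : size ns = size ds -> c != 0 -> lattice_factor ns ds (z * c) (w * c) = lattice_factor ns ds z w.
Proof.
move=> e c0; rewrite /lattice_factor -[RHS](prod_quot_scale _ e (expf_neq0 2 c0)); apply: eq_prod_quot => s _; ring.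
Qed.

(** Multiplication by [tau] maps the lattice of [- tau^-1] to that of [tau] and exchanges the
    coordinates; [lattice_factor] is homogeneous of degree 0 because the lists have equal length.
    Thus the columns for [tau] are the rows for [- tau^-1]. *)
Lemma quad_factor_swap ns ds z tau m n : size ns = size ds -> tau != 0 ->
  quad_factor ns ds (z / tau) (- tau^-1) m n = quad_factor ns ds z tau n m.
Proof.
move=> e t0; have t1 : tau^-1 != 0 by rewrite invr_eq0.
rewrite /quad_factor; case: m => [|m]; case: n => [|n] //=.
- by rewrite -[n.+1%:R in LHS](mulfK t0) lattice_factor_scale.
- by rewrite mulrN lattice_factorN lattice_factor_scale.
- have -> : m.+1%:R * - tau^-1 + n.+1%:R = (n.+1%:R * tau - m.+1%:R) / tau.
    by rewrite mulrBl mulfK // mulrN addrC.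
  have -> : m.+1%:R * - tau^-1 - n.+1%:R = - (n.+1%:R * tau + m.+1%:R) / tau.
    by rewrite mulNr mulrDl mulfK // mulrN opprD addrC.
  by rewrite !lattice_factor_scale // lattice_factorN mulrC.
Qed.

Lemma cvC_unshift u l : cvC (fun n => u n.+1) l -> cvC u l.
Proof. by move=> h e e0; have [N H] := h e e0; exists N.+1 => -[|n] //; exact: H. Qed.

Lemma c2pi_neq0 : c2pi != 0.
Proof. by rewrite -cn_eq0 cnM cn_Ci mulr1 cnR normr_eq0 gt_eqF // PI2_gt0. Qed.

Lemma prod_quot_neq0 ns ds f : (forall s, s \in ns ++ ds -> f s != 0) -> prod_quot ns ds f != 0.
Proof.
move=> h; rewrite /prod_quot mulf_neq0 ?invr_eq0 // prod_seq_neq0 // => s si;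
 by rewrite h // mem_cat si ?orbT.
Qed.

Section Inversion.
Variables (ns ds : seq nat).
Hypothesis bal : balanced ns ds.

(** The origin is left out of the lattice product, so Euler's product gives [sinq x / (c2pi * x)]
    instead of [sinq x]. *)
Lemma quad_factor_row0 z tau : off_lattice (ns ++ ds) z tau ->
  cvC (fun N => \prod_(0 <= n < N) quad_factor ns ds z tau 0 n) (prod_quot ns ds (fun s => sinq (s%:R * z) / (c2pi * (s%:R * z)))).
Proof.
move=> off; apply: cvC_unshift.
have a0 s : s \in ns ++ ds -> s%:R * z != 0.
  by move=> si; have := off s si 0 0; rewrite mul0r add0r.
pose F s N := \prod_(0 <= j < N) (1 + - ((s%:R * z) ^+ 2 / j.+1%:R ^+ 2)).
have hF s : s \in ns ++ ds -> cvC (F s) (sinq (s%:R * z) / (c2pi * (s%:R * z))).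
  move=> si; have cz : c2pi * (s%:R * z) != 0 by rewrite mulf_neq0 ?c2pi_neq0 ?a0.
  rewrite mulrC.
  apply: cvC_eq (cvC_mul (cvC_cst (c2pi * (s%:R * z))^-1) (sine_product (s%:R * z))) => n.
  by rewrite mulKf.
have hG s : s \in ds -> sinq (s%:R * z) / (c2pi * (s%:R * z)) != 0.
  move=> si; have si' : s \in ns ++ ds by rewrite mem_cat si orbT.
  rewrite mulf_neq0 //; last by rewrite invr_eq0 mulf_neq0 ?c2pi_neq0 ?a0.
  apply/eqP => h; have : qe (s%:R * z) - 1 = 0 by rewrite qe_sub1 h mulr0.
  move/eqP; rewrite subr_eq0 => /eqP/qe_eq1[n e].
  by have := off s si' 0 n; rewrite mul0r add0r e eqxx.
apply: cvC_eq (prod_quot_cv hF hG) => N.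
rewrite big_nat_recl //= mul1r /lattice_factor -prod_quot_prod.
rewrite -[in LHS](prod_quot_scale (c := \prod_(0 <= j < N) - (j.+1%:R ^+ 2)) _ (proj1 bal)); last first.
  by apply: prod_seq_neq0 => j _; rewrite oppr_eq0 expf_neq0 // Cnat_neq0.
apply: eq_prod_quot => s _; rewrite /F -big_split /=; apply: eq_bigr => j _.
by move: (j.+1%:R) (Cnat_neq0 j) => x x0; field.
Qed.

Lemma quad_factor_row z tau m : off_lattice (ns ++ ds) z tau ->
  cvC (fun N => \prod_(0 <= n < N) quad_factor ns ds z tau m.+1 n)
   (prod_quot ns ds (fun s => sinq (s%:R * z - m.+1%:R * tau) * sinq (s%:R * z + m.+1%:R * tau))).
Proof.
move=> off; apply: cvC_unshift; set t := m.+1%:R * tau.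
pose P (u : C) N := c2pi * u * \prod_(0 <= j < N) (1 + - (u ^+ 2 / j.+1%:R ^+ 2)).
have hF s : s \in ns ++ ds -> cvC (fun N => P (s%:R * z - t) N * P (s%:R * z + t) N)
    (sinq (s%:R * z - t) * sinq (s%:R * z + t)).
  by move=> _; apply: cvC_mul; exact: sine_product.
have hG s : s \in ds -> sinq (s%:R * z - t) * sinq (s%:R * z + t) != 0.
  move=> si; have si' : s \in ns ++ ds by rewrite mem_cat si orbT.
  apply/negP; rewrite mulf_eq0 => /orP[] /eqP h.
    have : qe (s%:R * z - t) - 1 = 0 by rewrite qe_sub1 h mulr0.
    move/eqP; rewrite subr_eq0 => /eqP/qe_eq1[n e].
    by have := off s si' m.+1%:Z n; rewrite -e -pmulrn addrC subrK eqxx.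
  have : qe (s%:R * z + t) - 1 = 0 by rewrite qe_sub1 h mulr0.
  move/eqP; rewrite subr_eq0 => /eqP/qe_eq1[n e].
  by have := off s si' (- m.+1%:Z) n; rewrite -e mulrNz -pmulrn mulNr addrC addrK eqxx.
apply: cvC_eq (prod_quot_cv hF hG) => N.
rewrite big_nat_recl //= /quad_factor /= -/t /lattice_factor.
under eq_bigr do rewrite -prod_quot_mul.
rewrite -prod_quot_prod -prod_quot_mul.
have c0 := c2pi_neq0.
rewrite -[in RHS](prod_quot_scale (c := c2pi ^+ 2 * \prod_(0 <= j < N) (j.+1%:R ^+ 2)^-1 ^+ 2) _ (proj1 bal)); last first.
  rewrite mulf_neq0 ?expf_neq0 //; apply: prod_seq_neq0 => j _.
  by rewrite expf_neq0 // invr_eq0 expf_neq0 // Cnat_neq0.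
apply: eq_prod_quot => s _; rewrite /P mulrACA -big_split /=.
rewrite [RHS]mulrACA -big_split /=; congr (_ * _); first by ring.
apply: eq_bigr => j _; by move: (j.+1%:R) (Cnat_neq0 j) => x x0; field.
Qed.

Definition quad_factor_rows z tau m : C :=
  if m is m'.+1 then prod_quot ns ds (fun s => sinq (s%:R * z - m%:R * tau) * sinq (s%:R * z + m%:R * tau))
  else prod_quot ns ds (fun s => sinq (s%:R * z) / (c2pi * (s%:R * z))).

(** The constant built from the [1 / s] is the trace of the omitted origin. It depends neither on
    [z] nor on [tau], and cancels when rows and columns are compared. *)
Lemma quad_factor_rows_cv (z tau : C) : 0 < Im tau -> z != 0 -> off_lattice (ns ++ ds) z tau ->
  cvC (fun M => \prod_(0 <= m < M) quad_factor_rows z tau m) (theta_quot ns ds z tau * prod_quot ns ds (fun s => (s%:R)^-1)).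
Proof.
move=> t0 z0 off; apply: cvC_unshift.
have hF s : s \in ns ++ ds -> _ := fun _ => theta_cv (s%:R * z) t0.
have hG s : s \in ds -> theta (s%:R * z) tau != 0.
  by move=> si; apply: theta_neq0 => // m n; apply: off; rewrite mem_cat si orbT.
apply: cvC_eq (cvC_mul (prod_quot_cv hF hG) (cvC_cst (prod_quot ns ds (fun s => (s%:R)^-1)))) => M.
rewrite big_nat_recl //= -prod_quot_prod.
have c0 : (c2pi * z)^-1 != 0 by rewrite invr_eq0 mulf_neq0 ?c2pi_neq0.
rewrite -(prod_quot_scale (fun s => s%:R^-1) (proj1 bal) c0) -!prod_quot_mul.
rewrite -[in RHS](prod_quot_scale (c := \prod_(0 <= m < M) - qe (m.+1%:R * tau)) _ (proj1 bal)); last first.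
  by apply: prod_seq_neq0 => j _; rewrite oppr_eq0 qe_neq0.
apply: eq_prod_quot => s _.
set p := \prod_(0 <= m < M) ((1 - _) * (1 - _)).
have -> : \prod_(0 <= m < M) (sinq (s%:R * z - m.+1%:R * tau) * sinq (s%:R * z + m.+1%:R * tau))
   = \prod_(0 <= m < M) (- qe (- (m.+1%:R * tau))) * p.
  rewrite -big_split /=; apply: eq_bigr => m _; rewrite sinq_row -!qeX -!qeD.
  by congr (_ * ((1 - qe _) * (1 - qe _))); rewrite -natr1; ring.
have e : \prod_(0 <= m < M) - qe (m.+1%:R * tau) * \prod_(0 <= m < M) (- qe (- (m.+1%:R * tau))) = 1.
  rewrite -big_split big1 //= => m _.
  by rewrite mulrNN qeN mulfV // qe_neq0.
rewrite [RHS]mulrCA [X in _ = _ * X]mulrA e mul1r.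
rewrite invfM (invfM c2pi) (invfM s%:R); ring.
Qed.
End Inversion.

(** * Absolute convergence of the lattice product *)

Lemma prod_quad (r : seq nat) : exists2 B : R, 0 <= B & forall X : C, Cmod X <= 1 ->
  Cmod (\prod_(s <- r) (1 - (s ^ 2)%:R * X) - (1 - (\sum_(s <- r) s ^ 2)%N%:R * X)) <= B * Cmod X ^+ 2.
Proof.
elim: r => [|i r [B B0 IH]].
  exists 0 => // X _; rewrite !big_nil mul0r subr0 subrr cn0 mul0r; exact: lexx.
set S := (\sum_(s <- r) s ^ 2)%N in IH.
exists ((i ^ 2)%:R * S%:R + B * (1 + (i ^ 2)%:R)) => [|X X1].
  by rewrite addr_ge0 // mulr_ge0 ?ler0n // addr_ge0 ?ler0n.
rewrite !big_cons -/S natrD; set a : C := (i ^ 2)%:R; set P := \prod_(s <- r) _ in IH *.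
have -> : (1 - a * X) * P - (1 - (a + S%:R) * X) =
   a * S%:R * X ^+ 2 + (P - (1 - S%:R * X)) * (1 - a * X) by ring.
apply: le_trans (cnD _ _) _; rewrite [X in _ <= X]mulrDl; apply: lerD.
  by rewrite cnM cnX cnM !cn_nat; exact: lexx.
rewrite cnM -mulrA [X in _ <= B * X]mulrC mulrA; apply: ler_pM; rewrite ?cn_ge0 //; first exact: IH.
apply: le_trans (cnB_le _ _) _; rewrite cn1 lerD2l cnM cn_nat.
by rewrite ler_piMr // ler0n.
Qed.

(** With [X = (z / w) ^ 2], numerator and denominator are both [1 - S X + O(X ^ 2)] for the same
    [S], the common sum of squares. The threshold [d] keeps the modulus of the denominator at least
    1/2. *)
Lemma lattice_factor_bound ns ds : balanced ns ds -> exists C0 d : R, [/\ 0 <= C0, 0 < d & forall z w : C, w != 0 ->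
  Cmod (z / w) ^+ 2 <= d -> Cmod (lattice_factor ns ds z w - 1) <= C0 * Cmod (z / w) ^+ 4].
Proof.
move=> [e1 e2]; have [B1 B10 H1] := prod_quad ns; have [B2 B20 H2] := prod_quad ds.
rewrite -e2 in H2; set S := (\sum_(s <- ns) s ^ 2)%N in H1 H2.
have D0 : 0 < 2%:R * (S%:R + B2) + 1 :> R by rewrite ltr_wpDl // mulr_ge0 // addr_ge0 ?ler0n.
exists (2%:R * (B1 + B2)), (2%:R * (S%:R + B2) + 1)^-1; split.
- by rewrite mulr_ge0 // addr_ge0.
- by rewrite invr_gt0.
move=> z w w0; set X := (z / w) ^+ 2.
have cX : Cmod (z / w) ^+ 2 = Cmod X by rewrite cnX.
have -> : Cmod (z / w) ^+ 4 = Cmod X ^+ 2 by rewrite -cX -exprM.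
rewrite cX => hX; have X0 := cn_ge0 X.
have hX2 : (2%:R * (S%:R + B2) + 1) * Cmod X <= 1 by rewrite -ler_pdivlMl // mulr1.
have S0 : 0 <= S%:R :> R by exact: ler0n.
have X1 : Cmod X <= 1 by nra.
have -> : lattice_factor ns ds z w = prod_quot ns ds (fun s => 1 - (s ^ 2)%:R * X).
  rewrite /lattice_factor -[RHS](prod_quot_scale (c := - w ^+ 2) _ e1) ?oppr_eq0 ?expf_neq0 //.
  by apply: eq_prod_quot => s _; rewrite /X natrX; field.
have A1 := H1 X X1; have A2 := H2 X X1.
rewrite /prod_quot; set P := \prod_(s <- ns) _ in A1 *; set Q := \prod_(s <- ds) _ in A2 *.
have cS : Cmod (S%:R * X) = S%:R * Cmod X by rewrite cnM cn_nat.
have Q1 : 1 / 2%:R <= Cmod Q.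
  have -> : Q = 1 - (S%:R * X - (Q - (1 - S%:R * X))) by ring.
  have := cnB_ge 1 (S%:R * X - (Q - (1 - S%:R * X))).
  have := cnB_le (S%:R * X) (Q - (1 - S%:R * X)); rewrite cS cn1.
  have : B2 * Cmod X ^+ 2 <= B2 * Cmod X by rewrite ler_wpM2l // expr2 ler_piMr.
  move: A2; set x1 := Cmod (Q - _); set x2 := Cmod (_ - _); set x3 := Cmod (1 - _).
  by move: (B2 * Cmod X ^+ 2) => y; move: hX2; rewrite !mulrDl mulrDr; lra.
have Q0 : Q != 0 by rewrite -cn_gt0; apply: lt_le_trans Q1; rewrite divr_gt0.
have -> : P / Q - 1 = (P - Q) / Q by field.
rewrite cnM cnV ler_pdivrMr ?cn_gt0 //.
have -> : P - Q = (P - (1 - S%:R * X)) - (Q - (1 - S%:R * X)) by ring.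
apply: le_trans (cnB_le _ _) _; apply: le_trans (lerD A1 A2) _.
have Y0 : 0 <= (B1 + B2) * Cmod X ^+ 2 by rewrite mulr_ge0 ?addr_ge0 ?exprn_ge0.
rewrite -mulrDl; move: Y0; rewrite -[2%:R * _ * _]mulrA; move: (_ * Cmod X ^+ 2) => Y Y0.
by rewrite mulrAC ler_peMl //; lra.
Qed.

Lemma lattice_bound (tau : C) : 0 < Im tau -> exists2 K : R, 0 < K &
  forall a b : R, a ^+ 2 + b ^+ 2 <= K * Cmod (RtoC a * tau + RtoC b) ^+ 2.
Proof.
set y := Im tau => y0; pose k := 1 + Cmod tau / y.
have k0 : 0 < k by rewrite ltr_wpDr // divr_ge0 ?cn_ge0 // ltW.
exists (y^-1 ^+ 2 + k ^+ 2) => [|a b]; first by rewrite addr_gt0 // exprn_gt0 // invr_gt0.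
set w := RtoC a * tau + RtoC b; set W := Cmod w.
have W0 : 0 <= W by exact: cn_ge0.
have h1 : `|a| <= W / y.
  rewrite ler_pdivlMr //; apply: le_trans (cn_Im w).
  by rewrite /w ImD Im_scale Im_RtoC addr0 normrM (gtr0_norm y0).
have h2 : `|b| <= k * W.
  rewrite -cnR; have -> : RtoC b = w - RtoC a * tau by rewrite /w; ring.
  apply: le_trans (cnB_le _ _) _; rewrite cnM cnR /k mulrDl mul1r lerD2l.
  by rewrite mulrC -mulrA [_^-1 * _]mulrC ler_wpM2l ?cn_ge0.
rewrite -[a ^+ 2]real_normK ?num_real // -[b ^+ 2]real_normK ?num_real // mulrDl; apply: lerD.
  by rewrite -exprMn mulrC; rewrite !expr2; apply: ler_pM.
by rewrite -exprMn !expr2; apply: ler_pM.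
Qed.

(** Turns decay of order 4 in the lattice point into a product of a function of [m] and a function
    of [n], the form that [double_prod] asks for. *)
Lemma succ_mul_sq_le (m n : nat) : (0 < m ^ 2 + n ^ 2)%N ->
  (m.+1 ^ 2 * n.+1 ^ 2 <= 16 * (m ^ 2 + n ^ 2) ^ 2)%N.
Proof.
move=> h; have h1 : (m.+1 * n.+1 <= 4 * (m ^ 2 + n ^ 2))%N.
  have hm : (m <= m * m)%N by case: m {h} => // m; rewrite leq_pmulr.
  have hn : (n <= n * n)%N by case: n {h} => // n; rewrite leq_pmulr.
  have hmn : (2 * (m * n) <= m ^ 2 + n ^ 2)%N by rewrite nat_Cauchy.
  by move: h hmn; rewrite -!mulnn mulSn mulnS; lia.
by rewrite -expnMn (_ : 16 = 4 ^ 2)%N // -expnMn leq_exp2r.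
Qed.

Lemma quad_factor_bound ns ds z tau : balanced ns ds -> 0 < Im tau -> exists2 c : R, 0 <= c &
  forall m n, Cmod (quad_factor ns ds z tau m n - 1) <= c / (m.+1%:R ^+ 2 * n.+1%:R ^+ 2).
Proof.
move=> bal t0; have [C0 [d [C00 d0 H]]] := lattice_factor_bound bal.
have [K K0 hK] := lattice_bound t0.
pose p m n : R := (m.+1%:R ^+ 2 * n.+1%:R ^+ 2)^-1.
have p0 m n : 0 < p m n by rewrite invr_gt0 mulr_gt0 // exprn_gt0 // ltr0n.
have p1 m n : p m n <= 1.
  by rewrite invf_le1 ?mulr_gt0 ?exprn_gt0 ?ltr0n // -!natrX -natrM (ler_nat _ 1) muln_gt0 !expn_gt0.
pose z2 := Cmod z ^+ 2 * K.
have z20 : 0 <= z2 by rewrite mulr_ge0 ?exprn_ge0 ?cn_ge0 // ltW.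
(* Outside the square of side [N0] the lattice points are far enough for [lattice_factor_bound]; the
   finitely many pairs inside are absorbed by [C2]. *)
pose N0 := (Num.bound (z2 / d)).+1.
have hN0 : z2 / d <= N0%:R.
  apply: ltW; apply: lt_le_trans (archi_boundP _) _; first by rewrite divr_ge0 // ltW.
  by rewrite ler_nat leqnSn.
pose C1 := 16%:R * C0 * z2 ^+ 2.
have C10 : 0 <= C1 by rewrite mulr_ge0 ?exprn_ge0 // mulr_ge0.
have T1 m n (b : R) : (N0 <= m)%N || (N0 <= n)%N -> b ^+ 2 = n%:R ^+ 2 ->
   Cmod (lattice_factor ns ds z (m%:R * tau + RtoC b) - 1) <= C1 * p m n.
  move=> hmn hb; set w := m%:R * tau + RtoC b.
  have hk : m%:R ^+ 2 + n%:R ^+ 2 <= K * Cmod w ^+ 2.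
    by have := hK m%:R b; rewrite hb rmorph_nat.
  have s1 : N0%:R <= m%:R ^+ 2 + n%:R ^+ 2 :> R.
    rewrite -!natrX -natrD ler_nat; case/orP: hmn => h; nia.
  set s := m%:R ^+ 2 + n%:R ^+ 2 in hk s1.
  have s0 : 0 < s by apply: lt_le_trans s1; rewrite ltr0n.
  have W0 : 0 < Cmod w ^+ 2 by rewrite -(pmulr_rgt0 _ K0); apply: lt_le_trans hk.
  have w0 : w != 0 by rewrite -cn_eq0; apply: contraTneq W0 => ->; rewrite expr0n ltxx.
  have zw : Cmod (z / w) ^+ 2 <= z2 / s.
    rewrite cnM cnV exprMn exprVn ler_pdivlMr // mulrAC ler_pdivrMr // /z2 -[X in _ <= X]mulrA.
    by rewrite ler_wpM2l // exprn_ge0 // cn_ge0.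
  have zwd : z2 / s <= d.
    rewrite ler_pdivrMr // mulrC -ler_pdivrMr //; exact: le_trans hN0 s1.
  apply: le_trans (H z w w0 (le_trans zw zwd)) _.
  have -> : Cmod (z / w) ^+ 4 = (Cmod (z / w) ^+ 2) ^+ 2 by rewrite -exprM.
  have e1 : (Cmod (z / w) ^+ 2) ^+ 2 <= (z2 / s) ^+ 2.
    by rewrite [X in X <= _]expr2 [X in _ <= X]expr2; apply: ler_pM; rewrite ?exprn_ge0 ?cn_ge0.
  apply: le_trans (ler_wpM2l C00 e1) _.
  have e2 : (z2 / s) ^+ 2 <= 16%:R * z2 ^+ 2 * p m n.
    rewrite exprMn exprVn /p ler_pdivlMr; last by rewrite mulr_gt0 // exprn_gt0 // ltr0n.
    rewrite mulrAC ler_pdivrMr ?exprn_gt0 // [X in _ <= X * _]mulrC -[X in _ <= X]mulrA.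
    apply: ler_wpM2l; first exact: exprn_ge0.
    rewrite /s -!natrX -natrD -!natrX -!natrM ler_nat.
    by apply: succ_mul_sq_le; rewrite -(ltr_nat R) natrD !natrX.
  apply: le_trans (ler_wpM2l C00 e2) _.
  by rewrite /C1 mulrA mulrA [C0 * _]mulrC.
have U1 m n : (N0 <= m)%N || (N0 <= n)%N -> Cmod (quad_factor ns ds z tau m n - 1) <= (2%:R * C1 + C1 ^+ 2) * p m n.
  move=> hmn.
  have sub : C1 * p m n <= (2%:R * C1 + C1 ^+ 2) * p m n.
    rewrite ler_pM2r //; have := exprn_ge0 2 C10; lra.
  rewrite /quad_factor; case: m hmn sub => [|m] hmn sub /=.
    case: n hmn sub => [|n] hmn sub //=.
    apply: le_trans sub; have := T1 0 n.+1 n.+1%:R hmn erefl.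
    by rewrite mul0r add0r rmorph_nat.
  case: n hmn sub => [|n] hmn sub /=.
    apply: le_trans sub; have := T1 m.+1 0 0 hmn erefl.
    by rewrite rmorph0 addr0.
  have := T1 m.+1 n.+1 n.+1%:R hmn erefl; rewrite rmorph_nat => A1.
  have := T1 m.+1 n.+1 (- n.+1%:R) hmn (sqrrN _); rewrite rmorphN rmorph_nat => A2.
  move: A1 A2 (p0 m.+1 n.+1) (p1 m.+1 n.+1); move: (p m.+1 n.+1) => q A1 A2 q0 q1.
  set x := lattice_factor _ _ _ _ in A1 *; set y := lattice_factor _ _ _ _ in A2 *.
  have -> : x * y - 1 = (x - 1) + (y - 1) + (x - 1) * (y - 1) by ring.
  apply: le_trans (cnD _ _) _; rewrite cnM.
  have h1 : Cmod (x - 1) * Cmod (y - 1) <= (C1 * q) * (C1 * q) by apply: ler_pM; rewrite ?cn_ge0.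
  have h2 : (C1 * q) * (C1 * q) <= C1 ^+ 2 * q.
    rewrite mulrACA -expr2 ler_wpM2l ?exprn_ge0 // ler_piMr // ltW //.
  have := cnD (x - 1) (y - 1); rewrite mulrDl; lra.
pose C2 := \sum_(0 <= m < N0) \sum_(0 <= n < N0) Cmod (quad_factor ns ds z tau m n - 1) / p m n.
have C20 : 0 <= C2.
  by apply: sumr_ge0 => m _; apply: sumr_ge0 => n _; rewrite divr_ge0 ?cn_ge0 // ltW.
exists (2%:R * C1 + C1 ^+ 2 + C2) => [|m n].
  by rewrite addr_ge0 // addr_ge0 ?exprn_ge0 // mulr_ge0.
rewrite -/(p m n) mulrDl.
have [hmn|] := boolP ((N0 <= m)%N || (N0 <= n)%N).
  by apply: le_trans (U1 m n hmn) _; rewrite lerDl mulr_ge0 // ltW.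
rewrite negb_or -!ltnNge => /andP[hm hn].
suff h : Cmod (quad_factor ns ds z tau m n - 1) <= C2 * p m n.
  apply: le_trans h _; rewrite lerDr; apply: mulr_ge0; last exact: ltW.
  by apply: addr_ge0; [exact: mulr_ge0 | exact: exprn_ge0].
rewrite -ler_pdivrMr // /C2 !big_mkord.
rewrite (bigD1 (Ordinal hm)) //= big_mkord (bigD1 (Ordinal hn)) //= -addrA lerDl addr_ge0 //.
  by apply: sumr_ge0 => j _; rewrite divr_ge0 ?cn_ge0 // ltW.
apply: sumr_ge0 => i _; rewrite big_mkord; apply: sumr_ge0 => j _.
by rewrite divr_ge0 ?cn_ge0 // ltW.
Qed.

Lemma Im_inv (tau : C) : tau != 0 -> Im (- tau^-1) = Im tau / Cmod tau ^+ 2.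
Proof.
move=> t0; pose cj : C := (Re tau, - Im tau).
have e1 : cj * tau = RtoC (Cmod tau ^+ 2).
  have -> : Cmod tau ^+ 2 = Re tau ^+ 2 + Im tau ^+ 2.
    rewrite /Cmod RsqrtE !RpowE sqr_sqrtr //; apply: addr_ge0; exact: sqr_ge0.
  apply: C_eqP; rewrite /cj /Complex.Re /Complex.Im /=; rE; ring.
move: e1; set r := Cmod tau ^+ 2 => e1.
have r0 : RtoC r != 0 by rewrite fmorph_eq0 expf_neq0 // cn_eq0.
have e2 : - tau^-1 = RtoC r^-1 * - cj.
  by apply: (mulIf t0); rewrite mulNr mulVf // mulrN mulNr -mulrA e1 fmorphV mulVf.
by rewrite e2 Im_scale ImN mulrC; congr (_ * _); exact: opprK.
Qed.

Theorem theta_quot_inv ns ds (z tau : C) : balanced ns ds -> 0 < Im tau -> z != 0 ->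
  off_lattice (ns ++ ds) z tau -> theta_quot ns ds (z / tau) (- tau^-1) = theta_quot ns ds z tau.
Proof.
move=> bal t0 z0 off.
have tau0 : tau != 0 by apply: contraTneq t0 => ->; rewrite ltxx.
have t0' : 0 < Im (- tau^-1).
  by rewrite Im_inv // divr_gt0 // exprn_gt0 // cn_gt0.
have off' : off_lattice (ns ++ ds) (z / tau) (- tau^-1).
  move=> s si m n; have := off s si n (- m); apply: contra => /eqP e; apply/eqP.
  have -> : s%:R * z = (s%:R * (z / tau)) * tau by rewrite mulrA mulfVK.
  rewrite e mulrDl mulrNz mulrN mulNr mulfVK //; ring.
have z0' : z / tau != 0 by rewrite mulf_neq0 // invr_eq0.
have [c c0 hc] := quad_factor_bound z bal t0.
have hs := inv_sq_summ (addr_ge0 ler01 c0).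
(* [c <= (1 + c) ^ 2] allows one summable sequence to serve for both indices. *)
have hU m n : Cmod (quad_factor ns ds z tau m n - 1) <= (1 + c) / m.+1%:R ^+ 2 * ((1 + c) / n.+1%:R ^+ 2).
  apply: le_trans (hc m n) _; rewrite [X in _ <= X]mulrACA -invfM; apply: ler_wpM2r.
    by rewrite invr_ge0 mulr_ge0 // exprn_ge0 // ler0n.
  by nra.
have hR m : cvC (fun N => \prod_(0 <= n < N) quad_factor ns ds z tau m n) (quad_factor_rows ns ds z tau m).
  by case: m => [|m]; [exact: quad_factor_row0 | exact: quad_factor_row].
have hC n : cvC (fun M => \prod_(0 <= m < M) quad_factor ns ds z tau m n) (quad_factor_rows ns ds (z / tau) (- tau^-1) n).
  have h : cvC (fun M => \prod_(0 <= m < M) quad_factor ns ds (z / tau) (- tau^-1) n m) (quad_factor_rows ns ds (z / tau) (- tau^-1) n).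
    by case: n => [|n]; [exact: quad_factor_row0 | exact: quad_factor_row].
  by apply: cvC_eq h => M; apply: eq_bigr => m _; rewrite quad_factor_swap // (proj1 bal).
have := double_prod hs hU hR hC (quad_factor_rows_cv bal t0 z0 off) (quad_factor_rows_cv bal t0' z0' off').
move/(mulIf _) => -> //; apply: prod_quot_neq0 => s si; rewrite invr_eq0.
by apply/eqP => e; have := off s si 0 0; rewrite e !mul0r add0r eqxx.
Qed.

(** * Quasi-periodicity of theta *)

Lemma thetaN z tau : theta (- z) tau = - theta z tau.
Proof. by rewrite /theta sinqN opprK addrC [tau + z]addrC [tau - z]addrC mulNr; congr (- (_ * _)); rewrite mulrC. Qed.

Lemma theta_add1 z tau : theta (z + 1) tau = - theta z tau.
Proof.
have e : sinq (z + 1) = - sinq z.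
  have e1 : qe ((z + 1) / 2%:R) = - qe (z / 2%:R).
    by rewrite mulrDl qeD mul1r qe_half mulrN1.
  by rewrite /sinq !qeN e1 invrN opprB opprK addrC.
rewrite /theta e mulNr; congr (- (_ * (poch_inf _ _ * poch_inf _ _))).
  have -> : z + 1 + tau = (z + tau) + 1 by ring.
  by rewrite [LHS]qeD qe1 mulr1.
have -> : tau - (z + 1) = (tau - z) + - 1 by ring.
by rewrite [LHS]qeD qeN qe1 invr1 mulr1.
Qed.

Lemma theta_addn z tau n : theta (z + n%:R) tau = (-1) ^+ n * theta z tau.
Proof.
elim: n => [|n IH]; first by rewrite addr0 mul1r.
by rewrite -natr1 addrA theta_add1 IH exprS mulN1r mulNr.
Qed.

Lemma theta_tau1 z tau : theta z (tau + 1) = theta z tau.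
Proof.
rewrite /theta addrA [qe (tau + 1)]qeD [qe (z + tau + 1)]qeD addrAC [qe (tau - z + 1)]qeD.
by rewrite qe1 !mulr1.
Qed.

Lemma poch_inf_rec (a b : C) : Cmod b < 1 -> poch_inf a b = (1 - a) * poch_inf (a * b) b.
Proof.
move=> b1; apply: cvC_poch_inf; apply: cvC_unshift.
apply: cvC_eq (cvC_mul (cvC_cst (1 - a)) (proj1 (poch_cv (a * b) b1))) => n.
rewrite !poch_partialE big_nat_recl // expr0 mulr1; congr (_ * _).
by apply: eq_bigr => i _; rewrite exprS mulrA.
Qed.

Lemma theta_addtau z tau : 0 < Im tau ->
  theta (z + tau) tau = - qe (- (z + tau / 2%:R)) * theta z tau.
Proof.
move=> t0; have q1 := cn_qe_lt1 t0; rewrite /theta.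
have -> : tau - (z + tau) = - z by ring.
rewrite (poch_inf_rec (qe (z + tau)) q1) (poch_inf_rec (qe (- z)) q1) -!qeD.
have -> : - z + tau = tau - z by ring.
have h v : 1 - qe v = - (qe (v / 2%:R) * sinq v) by rewrite -qe_sub1 opprB.
rewrite !h sinqN.
have -> : qe (- (z + tau / 2%:R)) = qe (- z / 2%:R) * (qe ((z + tau) / 2%:R))^-1.
  by rewrite -qeN -qeD; congr qe; field; exact: Ctwo_neq0.
field; exact: qe_neq0.
Qed.

Lemma theta_addntau z tau n : 0 < Im tau ->
  theta (z + n%:R * tau) tau = (-1) ^+ n * qe (- (n%:R * z + n%:R ^+ 2 * tau / 2%:R)) * theta z tau.
Proof.
move=> t0; elim: n => [|n IH]; first by rewrite !mul0r !expr0n /= !mul0r !addr0 oppr0 qe0 !mul1r.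
have -> : z + n.+1%:R * tau = z + n%:R * tau + tau by rewrite -natr1; ring.
rewrite theta_addtau // IH [(-1) ^+ n.+1]exprS.
have -> : - (n.+1%:R * z + n.+1%:R ^+ 2 * tau / 2%:R) =
  - (z + n%:R * tau + tau / 2%:R) - (n%:R * z + n%:R ^+ 2 * tau / 2%:R).
  by rewrite -natr1; field; exact: Ctwo_neq0.
rewrite [in RHS]qeD; ring.
Qed.

(** * Torsion values and the action of SL2(Z) *)

Definition kappa (ns ds : seq nat) (N : nat) (b1 b2 : int) (tau : C) : C :=
  theta_quot ns ds ((b1%:~R * tau + b2%:~R) / N%:R) tau.

(** The arithmetic form of [off_lattice] at the point [(b1 tau + b2) / N], independent of [tau]. *)
Definition good (r : seq nat) (N : nat) (b1 b2 : int) : bool :=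
  all (fun s => ~~ ((N%:Z %| s%:Z * b1)%Z && (N%:Z %| s%:Z * b2)%Z)) r.

Lemma intC_inj (m n : int) : m%:~R = n%:~R :> C -> m = n.
Proof.
by rewrite -!(rmorph_int RtoC) => /(fmorph_inj RtoC) /intr_inj.
Qed.

Lemma Im_int (n : int) : Im (n%:~R : C) = 0.
Proof. by rewrite -(rmorph_int RtoC) Im_RtoC. Qed.

Lemma lattice_inj (tau : C) (m n m' n' : int) : 0 < Im tau ->
  m%:~R * tau + n%:~R = m'%:~R * tau + n'%:~R -> m = m' /\ n = n'.
Proof.
move=> t0 e.
have em : m = m'.
  have := congr1 Im e; rewrite !ImD !Im_int !addr0 -!(rmorph_int RtoC) !Im_scale.
  by move=> /(mulIf (lt0r_neq0 t0)) /intr_inj.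
by split=> //; move: e; rewrite em => /addrI /intC_inj.
Qed.

Lemma good_off r N b1 b2 tau : (0 < N)%N -> 0 < Im tau -> good r N b1 b2 ->
  off_lattice r ((b1%:~R * tau + b2%:~R) / N%:R) tau.
Proof.
move=> N0 t0 /allP g s si m n; apply/eqP => e.
have NC : (N%:R : C) != 0 by case: N N0 {g e} => // N _; exact: Cnat_neq0.
have e' : (s%:Z * b1)%:~R * tau + (s%:Z * b2)%:~R = (N%:Z * m)%:~R * tau + (N%:Z * n)%:~R :> C.
  rewrite !intrM -!pmulrn -!mulrA -!mulrDr -e; field; exact: NC.
have [e1 e2] := lattice_inj t0 e'.
by have := g s si; rewrite e1 e2 !dvdz_mulr.
Qed.

Section Kap.
Variables (ns ds : seq nat) (N : nat).
Hypotheses (bal : balanced ns ds) (N0 : (0 < N)%N) (ns0 : (0 < size ns)%N).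
Let NC : (N%:R : C) != 0.
Proof. by case: N N0 => // n _; exact: Cnat_neq0. Qed.

Lemma kappa_T b1 b2 tau : kappa ns ds N b1 b2 (tau + 1) = kappa ns ds N b1 (b1 + b2) tau.
Proof.
rewrite /kappa /theta_quot mulrDr mulr1 -addrA -intrD.
by apply: eq_prod_quot => s _; rewrite theta_tau1.
Qed.

Lemma kappa_S b1 b2 tau : 0 < Im tau -> good (ns ++ ds) N b1 b2 ->
  kappa ns ds N b1 b2 (- tau^-1) = kappa ns ds N b2 (- b1) tau.
Proof.
move=> t0 g; have tau0 : tau != 0 by apply: contraTneq t0 => ->; rewrite ltxx.
have g' : good (ns ++ ds) N b2 (- b1).
  by apply: sub_all g => s; rewrite mulrN rpredN andbC.
have off := good_off N0 t0 g'.
rewrite /kappa -(theta_quot_inv bal t0 _ off); last first.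
  apply/eqP => e; case: ns ns0 off => // s r _ /(_ s (mem_head _ _) 0 0).
  by rewrite e mulr0 mul0r add0r eqxx.
congr (theta_quot _ _ _ _); rewrite mulrNz; field; by rewrite NC tau0.
Qed.

Lemma kappaN b1 b2 tau : kappa ns ds N (- b1) (- b2) tau = kappa ns ds N b1 b2 tau.
Proof.
rewrite /kappa /theta_quot -[RHS](prod_quot_scale (c := -1) _ (proj1 bal)) ?oppr_eq0 ?oner_eq0 //.
apply: eq_prod_quot => s _; rewrite mulN1r -thetaN; congr theta.
by rewrite !mulrNz mulNr -opprD mulNr mulrN.
Qed.

Lemma kappa_addN b1 b2 tau : kappa ns ds N b1 (b2 + N%:Z) tau = kappa ns ds N b1 b2 tau.
Proof.
rewrite /kappa /theta_quot.
(* [s] and [s ^ 2] have the same parity, so the balance of squares also settles the signs. *)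
have sg : prod_quot ns ds (fun s => (-1) ^+ s) = 1.
  have h (r : seq nat) : \prod_(s <- r) (-1) ^+ s = (-1) ^+ (\sum_(s <- r) s ^ 2)%N :> C.
    elim: r => [|s r IH]; first by rewrite !big_nil.
    by rewrite !big_cons exprD IH -[in RHS]signr_odd oddX signr_odd.
  by rewrite /prod_quot !h (proj2 bal) divff // signr_eq0.
rewrite -[RHS]mul1r -[X in _ = X * _]sg -prod_quot_mul; apply: eq_prod_quot => s _.
rewrite -theta_addn; congr theta; rewrite intrD -pmulrn; field; exact: NC.
Qed.

Lemma kappa_modr b1 b2 c2 tau : (b2 = c2 %[mod N%:Z])%Z -> kappa ns ds N b1 b2 tau = kappa ns ds N b1 c2 tau.
Proof.
have h b (k : nat) : kappa ns ds N b1 (b + k%:Z * N%:Z) tau = kappa ns ds N b1 b tau.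
  elim: k => [|k IH]; first by rewrite mul0r addr0.
  by rewrite intS mulrDl mul1r [N%:Z + _]addrC addrA kappa_addN.
have hm b : kappa ns ds N b1 b tau = kappa ns ds N b1 (b %% N%:Z)%Z tau.
  rewrite {1}(divz_eq b N%:Z) addrC.
  case: (intP (b %/ N%:Z)%Z) => [|k|k]; first by rewrite mul0r addr0.
    exact: h.
  by rewrite -(h (_ + _) k.+1) addrAC -addrA mulNr subrr addr0.
by move=> e; rewrite hm e -hm.
Qed.

Lemma good_mod r b1 b2 c1 c2 : (b1 = c1 %[mod N%:Z])%Z -> (b2 = c2 %[mod N%:Z])%Z ->
  good r N b1 b2 = good r N c1 c2.
Proof.
move=> e1 e2; apply: eq_all => s.
have h (a b : int) : (a = b %[mod N%:Z])%Z -> (N%:Z %| s%:Z * a)%Z = (N%:Z %| s%:Z * b)%Z.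
  move=> e; have E : (s%:Z * a = s%:Z * b %[mod N%:Z])%Z by rewrite -modzMmr e modzMmr.
  by apply/dvdz_mod0P/dvdz_mod0P; rewrite E.
by rewrite (h _ _ e1) (h _ _ e2).
Qed.

(** The inversion carries a shift of [b1] to a shift of the second index, where [kappa_modr]
    applies; the exponential factors of [theta_addntau] are never met. *)
Lemma kappa_mod b1 b2 c1 c2 tau : 0 < Im tau -> good (ns ++ ds) N b1 b2 ->
  (b1 = c1 %[mod N%:Z])%Z -> (b2 = c2 %[mod N%:Z])%Z ->
  kappa ns ds N b1 b2 tau = kappa ns ds N c1 c2 tau.
Proof.
move=> t0 g e1 e2; rewrite (kappa_modr _ _ e2).
have tau0 : tau != 0 by apply: contraTneq t0 => ->; rewrite ltxx.
have g1 : good (ns ++ ds) N b1 c2 by rewrite -(good_mod _ (erefl _) e2).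
have g2 : good (ns ++ ds) N c1 c2 by rewrite -(good_mod _ e1 (erefl _)).
have t0' : 0 < Im (- tau^-1) by rewrite Im_inv // divr_gt0 // exprn_gt0 // cn_gt0.
have S' b : good (ns ++ ds) N b c2 -> kappa ns ds N b c2 tau = kappa ns ds N (- c2) b (- tau^-1).
  move=> g'; rewrite kappa_S //; first by rewrite opprK.
  by apply: sub_all g' => s; rewrite mulrN rpredN andbC.
rewrite !S' //; exact: kappa_modr.
Qed.
End Kap.

(** * Expansions with algebraic integer coefficients *)

Definition algint (z : C) : Prop := integralOver (intr : int -> C) z.

Lemma algint0 : algint 0. Proof. exact: integral0. Qed.
Lemma algint1 : algint 1. Proof. exact: integral1. Qed.
Lemma algintM x y : algint x -> algint y -> algint (x * y). Proof. exact: integral_mul. Qed.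
Lemma algintD x y : algint x -> algint y -> algint (x + y). Proof. exact: integral_add. Qed.
Lemma algintN x : algint x -> algint (- x). Proof. exact: integral_opp. Qed.
Lemma algintX x n : algint x -> algint (x ^+ n).
Proof. by move=> h; elim: n => [|n IH]; rewrite ?expr0 ?exprS; [exact: algint1|exact: algintM]. Qed.
Lemma algint_sum (I : Type) (r : seq I) (P : pred I) (f : I -> C) :
  (forall i, P i -> algint (f i)) -> algint (\sum_(i <- r | P i) f i).
Proof. by move=> h; apply: (big_ind algint) => //; [exact: algint0|exact: algintD]. Qed.
Lemma algint_prod (I : Type) (r : seq I) (P : pred I) (f : I -> C) :
  (forall i, P i -> algint (f i)) -> algint (\prod_(i <- r | P i) f i).
Proof. by move=> h; apply: (big_ind algint) => //; [exact: algint1|exact: algintM]. Qed.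

Lemma algint_root (x : C) (p : {poly C}) : p \is monic -> root p x -> (forall i, algint p`_i) -> algint x.
Proof. by move=> pm px h; apply: (integral_root_monic pm px); apply/integral_poly. Qed.

Lemma algint_unity (x : C) n : x ^+ n.+1 = 1 -> algint x.
Proof.
move=> h; apply: (@algint_root x ('X^(n.+1) - 1%:P)).
- exact: monicXnsubC.
- by rewrite rootE !hornerE h subrr.
- move=> i; rewrite coefB coefXn coefC; apply: algintD; last apply: algintN; by case: (_ == _); rewrite /=; [exact: algint1|exact: algint0].
Qed.

Lemma algint_qe_frac (m : int) n : algint (qe (m%:~R / n.+1%:R)).
Proof.
apply: (@algint_unity _ n); rewrite -qeX mulrCA mulfV ?Cnat_neq0 // mulr1; exact: qe_int.
Qed.

Definition qexp (M k : nat) (F : C -> C) (c : nat -> C) : Prop :=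
  forall (y1 y2 e : R) (K : nat), 0 < y1 -> 0 < e -> exists p : {poly C},
   (forall i, (i < K)%N -> p`_i = c i) /\
   forall tau, y1 <= Im tau -> Im tau <= y2 ->
     Cmod (qe (tau / M%:R) ^+ k * F tau - p.[qe (tau / M%:R)]) <= e.

(* [F] is [qe (tau / M) ^- k] times a power series in [qe (tau / M)] with algebraic integer
   coefficients and constant term [u]; the series is only accessed through locally uniform
   polynomial approximations having the right first coefficients. *)
Definition has_qexp (M k : nat) (F : C -> C) (u : C) : Prop :=
  exists c, [/\ forall i, algint (c i), c 0%N = u & qexp M k F c].

Lemma Im_divn (tau : C) M : Im (tau / M%:R) = Im tau / M%:R.
Proof. by rewrite mulrC -(rmorph_nat RtoC) -fmorphV Im_scale mulrC. Qed.

Lemma Im_muln (tau : C) M : Im (M%:R * tau) = M%:R * Im tau.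
Proof. by rewrite -(rmorph_nat RtoC) Im_scale. Qed.

Lemma cn_qe_le1 (tau : C) M : 0 < Im tau -> Cmod (qe (tau / M%:R)) <= 1.
Proof.
move=> t0; rewrite cn_qe -[leRHS]expR0; apply: exp_le.
by rewrite oppr_le0 Im_divn mulr_ge0 // ?divr_ge0 ?ler0n ?ltW // PI2_gt0.
Qed.

Lemma horner_bound (p : {poly C}) : exists2 B : R, 0 <= B & forall x, Cmod x <= 1 -> Cmod p.[x] <= B.
Proof.
exists (\sum_(i < size p) Cmod p`_i) => [|x x1]; first by apply: sumr_ge0 => i _; exact: cn_ge0.
rewrite horner_coef; apply: le_trans (cn_sum _ _ _) _; apply: ler_sum => i _.
by rewrite cnM cnX ler_piMr ?cn_ge0 // exprn_ile1 // cn_ge0.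
Qed.

Lemma qexp_bound M k F c (y1 y2 : R) : qexp M k F c -> 0 < y1 -> exists2 B : R, 0 <= B &
  forall tau, y1 <= Im tau -> Im tau <= y2 -> Cmod (qe (tau / M%:R) ^+ k * F tau) <= B.
Proof.
move=> h y0; have [p [_ hp]] := h y1 y2 1 0%N y0 ltr01.
have [B B0 hB] := horner_bound p; exists (B + 1) => [|tau t1 t2]; first by rewrite addr_ge0.
have x1 := cn_qe_le1 M (lt_le_trans y0 t1).
have := hp tau t1 t2; have := hB _ x1; set x := _ * F _; set y := _.[_] => A1 A2.
rewrite -(subrK y x) addrC; apply: le_trans (cnD _ _) _; exact: lerD.
Qed.

Lemma has_qexp_ext M k F G u : (forall tau, 0 < Im tau -> F tau = G tau) -> has_qexp M k F u -> has_qexp M k G u.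
Proof.
move=> e [c [c1 c2 h]]; exists c; split=> // y1 y2 x K y0 x0.
have [p [hp1 hp2]] := h y1 y2 x K y0 x0; exists p; split=> // tau t1 t2.
by rewrite -e ?hp2 //; apply: lt_le_trans t1.
Qed.

Lemma has_qexp_cst M u : algint u -> has_qexp M 0 (fun=> u) u.
Proof.
move=> hu; exists (fun i => if i == 0%N then u else 0); split=> //.
  by case=> //= _; exact: algint0.
move=> y1 y2 e K _ e0; exists u%:P; split=> [i _|tau _ _]; first by rewrite coefC.
by rewrite hornerC mul1r subrr cn0 ltW.
Qed.

Lemma has_qexp_add M k F G u v : has_qexp M k F u -> has_qexp M k G v -> has_qexp M k (fun t => F t + G t) (u + v).
Proof.
move=> [c [c1 c2 hc]] [d [d1 d2 hd]]; exists (fun i => c i + d i); split; rewrite ?c2 ?d2 //.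
  by move=> i; exact: algintD.
move=> y1 y2 e K y0 e0; have e2 : 0 < e / 2%:R by rewrite divr_gt0.
have [p [p1 p2]] := hc y1 y2 _ K y0 e2; have [q [q1 q2]] := hd y1 y2 _ K y0 e2.
exists (p + q); split=> [i iK|tau t1 t2]; first by rewrite coefD p1 ?q1.
have := p2 tau t1 t2; have := q2 tau t1 t2; rewrite hornerD => A1 A2.
set X := qe _ in A1 A2 *.
have -> : X ^+ k * (F tau + G tau) - (p.[X] + q.[X]) = (X ^+ k * F tau - p.[X]) + (X ^+ k * G tau - q.[X]) by ring.
by apply: le_trans (cnD _ _) _; lra.
Qed.

Lemma qexp_mul M k j F G c d : qexp M k F c -> qexp M j G d ->
  qexp M (k + j) (fun t => F t * G t) (fun i => \sum_(l < i.+1) c l * d (i - l)%N).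
Proof.
move=> hc hd y1 y2 e K y0 e0.
have [B B0 hB] := qexp_bound y2 hc y0; have [D D0 hD] := qexp_bound y2 hd y0.
(* With both errors at most [e' = e / (B + D + 1)] and at most 1, the error of the product is at
   most [e' D + B e' + e' = e]. *)
have m0 : 0 < Num.min 1 (e / (B + D + 1)) by rewrite lt_min ltr01 divr_gt0 // ltr_wpDl // addr_ge0.
have [p [p1 p2]] := hc y1 y2 _ K y0 m0; have [q [q1 q2]] := hd y1 y2 _ K y0 m0.
exists (p * q); split=> [i iK|tau t1 t2].
  rewrite coefM; apply: eq_bigr => l _; rewrite p1 ?q1 //; first by apply: leq_ltn_trans (leq_subr _ _) iK.
  by apply: leq_trans iK; rewrite ltn_ord.
have := p2 tau t1 t2; have := q2 tau t1 t2; have := hB tau t1 t2; have := hD tau t1 t2.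
rewrite hornerM exprD; set X := qe _; set a := X ^+ k * F tau; set b := X ^+ j * G tau.
set P := p.[X]; set Q := q.[X]; rewrite !le_min => A1 A2 /andP[A3 A3'] /andP[A4 A4'].
have -> : X ^+ k * X ^+ j * (F tau * G tau) = a * b by rewrite /a /b; ring.
have -> : a * b - P * Q = (a - P) * b + a * (b - Q) - (a - P) * (b - Q) by ring.
apply: le_trans (cnB_le _ _) _; apply: le_trans (lerD (cnD _ _) (lexx _)) _.
rewrite (cnM (a - P) b) (cnM a (b - Q)) (cnM (a - P) (b - Q)).
set e' := e / _ in A3' A4'.
have ee : e' * (B + D + 1) = e by rewrite /e' mulfVK // gt_eqF // ltr_wpDl // addr_ge0.
have h1 : Cmod (a - P) * Cmod b <= e' * D by apply: ler_pM; rewrite ?cn_ge0.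
have h2 : Cmod a * Cmod (b - Q) <= B * e' by apply: ler_pM; rewrite ?cn_ge0.
have h3 : Cmod (a - P) * Cmod (b - Q) <= e' * 1 by apply: ler_pM; rewrite ?cn_ge0.
rewrite -ee; move: h1 h2 h3; move: (Cmod (a - P) * Cmod b) (Cmod a * Cmod (b - Q)) (Cmod (a - P) * Cmod (b - Q)).
move=> x y z; rewrite !mulrDr !mulr1 [B * e']mulrC; lra.
Qed.

Lemma has_qexp_mul M k j F G u v : has_qexp M k F u -> has_qexp M j G v ->
  has_qexp M (k + j) (fun t => F t * G t) (u * v).
Proof.
move=> [c [c1 c2 hc]] [d [d1 d2 hd]]; exists (fun i => \sum_(l < i.+1) c l * d (i - l)%N); split.
- by move=> i; apply: algint_sum => l _; exact: algintM.
- by rewrite big_ord1 c2 d2.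
exact: qexp_mul.
Qed.

Lemma has_qexp_mulXV M k j F u : has_qexp M k F u -> has_qexp M (k + j) (fun t => qe (t / M%:R) ^- j * F t) u.
Proof.
move=> [c [c1 c2 hc]]; exists c; split=> // y1 y2 e K y0 e0.
have [p [p1 p2]] := hc y1 y2 e K y0 e0; exists p; split=> // tau t1 t2.
by rewrite exprD -mulrA mulVKf; [exact: p2 | rewrite expf_neq0 // qe_neq0].
Qed.

Lemma has_qexp_mulX M k j F u : has_qexp M k F u -> has_qexp M k (fun t => qe (t / M%:R) ^+ j * F t) (if j == 0%N then u else 0).
Proof.
move=> [c [c1 c2 hc]]; exists (fun i => if (j <= i)%N then c (i - j)%N else 0); split.
- by move=> i; case: ifP => // _; exact: algint0.
- by rewrite leqn0 sub0n c2.
move=> y1 y2 e K y0 e0.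
have [p [p1 p2]] := hc y1 y2 e K y0 e0; exists ('X^j * p); split=> [i iK|tau t1 t2].
  rewrite coefXnM ltnNge; case: leqP => //= ji; rewrite p1 //; exact: leq_ltn_trans (leq_subr _ _) iK.
rewrite hornerM hornerXn mulrCA -mulrBr cnM cnX; apply: le_trans (p2 tau t1 t2).
by rewrite ler_piMl ?cn_ge0 // exprn_ile1 ?cn_ge0 // cn_qe_le1 // (lt_le_trans y0 t1).
Qed.

Lemma has_qexp_weaken M k j F u : has_qexp M k F u -> has_qexp M (k + j) F (if j == 0%N then u else 0).
Proof.
move/(has_qexp_mulX j)/(has_qexp_mulXV j); apply: has_qexp_ext => tau _.
by rewrite mulKf // expf_neq0 // qe_neq0.
Qed.

(** Division by the parameter enlarges errors by at most [1 / r], where [r] is its least modulus on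
    the strip; this is where the upper bound [y2] in [qexp] is essential. *)
Lemma has_qexp_lower M k F : has_qexp M k.+1 F 0 -> exists u, has_qexp M k F u.
Proof.
move=> [c [c1 c2 hc]]; exists (c 1%N), (c \o S); split=> // [i|y1 y2 e K y0 e0]; first exact: c1.
pose r := exp (- (2 * PI * (y2 / M%:R))).
have r0 : 0 < r by exact: exp_gt0.
have [p [p1 p2]] := hc y1 y2 (e * r) K.+1 y0 (mulr_gt0 e0 r0).
exists (\poly_(i < (size p).-1) p`_i.+1); split=> [i iK|tau t1 t2].
  rewrite coef_poly; case: ltnP => [_|h]; first by rewrite p1.
  by rewrite -[RHS]p1 // nth_default //; case: (size p) h.
set X := qe _; have X0 : X != 0 by exact: qe_neq0.
have ep : p = (\poly_(i < (size p).-1) p`_i.+1) * 'X.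
  apply/polyP => i; rewrite coefMX; case: i => [|i] /=; first by rewrite p1.
  rewrite coef_poly; case: ltnP => // h; rewrite nth_default //; by case: (size p) h.
have := p2 tau t1 t2; rewrite -/X {1}ep hornerM hornerX exprS.
set q := _.[X]; have -> : X * X ^+ k * F tau - q * X = X * (X ^+ k * F tau - q) by ring.
have rX : r <= Cmod X.
  rewrite cn_qe; apply: exp_le; rewrite lerN2 ler_pM2l ?PI2_gt0 // Im_divn.
  by rewrite ler_wpM2r // invr_ge0 ler0n.
rewrite cnM => h; rewrite -(ler_pM2r r0); apply: le_trans h.
by rewrite mulrC ler_wpM2r // cn_ge0.
Qed.

Definition poly_dil (z : C) (p : {poly C}) : {poly C} := \poly_(i < size p) (z ^+ i * p`_i).

Lemma coef_poly_dil z p i : (poly_dil z p)`_i = z ^+ i * p`_i.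
Proof. by rewrite coef_poly; case: ltnP => // h; rewrite [p`_i]nth_default ?mulr0. Qed.

Lemma horner_poly_dil z p x : (poly_dil z p).[x] = p.[z * x].
Proof.
rewrite horner_poly horner_coef; apply: eq_bigr => i _.
by rewrite exprMn mulrA [z ^+ i * _]mulrC.
Qed.

(** The old parameter at [(a t + b) / d] is the root of unity [z] times the [a]-th power of the new
    one: exponents are multiplied by [a], coefficients by powers of [z]. *)
Lemma has_qexp_subst M k F u (a b d : nat) : (0 < M)%N -> (0 < a)%N -> (0 < d)%N -> has_qexp M k F u ->
  has_qexp (d * M) (a * k) (fun t => F ((a%:R * t + b%:R) / d%:R)) (qe (b%:R / (d * M)%:R) ^- k * u).
Proof.
move=> M0 a0 d0 [c [c1 c2 hc]].
set z := qe _; have z0 : z != 0 by exact: qe_neq0.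
have dM0 : (0 < d * M)%N by rewrite muln_gt0 d0.
have AIz : algint z by rewrite /z -(prednK dM0); exact: (algint_qe_frac b%:Z).
have AIzV : algint (z ^- k).
  rewrite -exprVn; apply: algintX; rewrite /z -qeN -mulNr -(prednK dM0).
  by have := algint_qe_frac (- b%:Z) (d * M).-1; rewrite mulrNz -pmulrn.
exists (fun i => if (a %| i)%N then z ^- k * (z ^+ (i %/ a) * c (i %/ a)%N) else 0); split.
- by move=> i; case: ifP => _; [apply: algintM => //; apply: algintM => //; exact: algintX | exact: algint0].
- by rewrite dvdn0 div0n mul1r c2.
move=> y1 y2 e K y0 e0.
have ad : 0 < a%:R / d%:R :> R by rewrite divr_gt0 // ltr0n.
have ek : 0 < e / Cmod (z ^- k) by rewrite divr_gt0 // cn_gt0 invr_eq0 expf_neq0.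
have [p [p1 p2]] := hc (a%:R / d%:R * y1) (a%:R / d%:R * y2) _ K (mulr_gt0 ad y0) ek.
exists (z ^- k *: (poly_dil z p \Po 'X^a)); split=> [i iK|tau t1 t2].
  rewrite coefZ coef_comp_poly_Xn //; case: ifP => _; last by rewrite mulr0.
  by rewrite coef_poly_dil p1 //; exact: leq_ltn_trans (leq_div _ _) iK.
have dC : (d%:R : C) != 0 by case: d d0 {z z0 dM0 AIz AIzV ad p1 p2 ek} => // n _; exact: Cnat_neq0.
have MC : (M%:R : C) != 0 by case: M M0 {hc z z0 dM0 AIz AIzV ad p1 p2 ek} => // n _; exact: Cnat_neq0.
set t' := (_ + _) / d%:R.
have im' : Im t' = a%:R / d%:R * Im tau.
  rewrite /t' Im_divn ImD Im_muln -[b%:R](rmorph_nat RtoC) Im_RtoC addr0; ring.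
have := p2 t'; rewrite im' !ler_pM2l // => /(_ t1 t2).
set X := qe (tau / _).
have -> : qe (t' / M%:R) = z * X ^+ a.
  rewrite /z /X -qeX -qeD; congr qe; rewrite /t' natrM; field; by rewrite dC MC.
rewrite hornerZ horner_comp hornerXn horner_poly_dil => A.
have -> : X ^+ (a * k) * F t' - z ^- k * p.[z * X ^+ a] = z ^- k * ((z * X ^+ a) ^+ k * F t' - p.[z * X ^+ a]).
  rewrite mulrBr mulrA exprMn mulrA mulVf ?mul1r ?exprM //; exact: expf_neq0.
by rewrite cnM mulrC -ler_pdivlMr // cn_gt0 invr_eq0 expf_neq0.
Qed.

(** * Invariant functions *)

Definition modinv (F : C -> C) : Prop :=
  (forall tau, 0 < Im tau -> F (tau + 1) = F tau) /\
  (forall tau, 0 < Im tau -> F (- tau^-1) = F tau).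

Lemma Im_inv_gt0 (tau : C) : 0 < Im tau -> 0 < Im (- tau^-1).
Proof.
move=> t0; have tau0 : tau != 0 by apply: contraTneq t0 => ->; rewrite ltxx.
by rewrite Im_inv // divr_gt0 // exprn_gt0 // cn_gt0.
Qed.

Lemma modinv_addz F tau (n : int) : modinv F -> 0 < Im tau -> F (tau + n%:~R) = F tau.
Proof.
move=> [hT _]; have h (k : nat) t : 0 < Im t -> F (t + k%:R) = F t.
  elim: k t => [|k IH] t t0; first by rewrite addr0.
  rewrite -natr1 addrA hT ?IH // ImD -(rmorph_nat RtoC) Im_RtoC addr0 //.
move=> t0; case: (intP n) => [|k|k]; first by rewrite addr0.
  by rewrite -pmulrn h.
rewrite -{2}[tau](subrK k.+1%:R) h; first by rewrite mulrNz -pmulrn.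
by rewrite ImD ImN -(rmorph_nat RtoC) Im_RtoC oppr0 addr0.
Qed.

(* After a translation, [Im tau < 1/2] forces |tau|^2 < 1/2, so that [-1/tau] has at least twice
   the imaginary part. *)
Lemma to_half_plane (tau : C) : 0 < Im tau -> exists2 tau' : C, 1 / 2%:R <= Im tau' &
  forall F, modinv F -> F tau' = F tau.
Proof.
move=> t0; have [n hn] : exists n : nat, 1 / 2%:R <= 2%:R ^+ n * Im tau.
  have [n hn] : exists n : nat, (Im tau)^-1 < n%:R.
    by exists (Num.bound (Im tau)^-1); apply: archi_boundP; rewrite invr_ge0 ltW.
  exists n; apply: (@le_trans _ _ (n%:R * Im tau)).
    by move: hn; rewrite -(ltr_pM2r t0) mulVf ?gt_eqF // => h; apply: ltW; apply: lt_trans h; lra.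
  by rewrite ler_pM2r // -natrX ler_nat ltnW // ltn_expl.
elim: n tau t0 hn => [|n IH] tau t0 hn; first by exists tau => //; move: hn; rewrite expr0; lra.
have [h|h] := lerP (1 / 2%:R) (Im tau); first by exists tau.
pose k := Num.floor (Re tau + 1 / 2%:R).
pose t := tau + (- k)%:~R.
have it : Im t = Im tau by rewrite /t ImD Im_int addr0.
have ret : `|Re t| <= 1 / 2%:R.
  have -> : Re t = Re tau - k%:~R by rewrite /t ReD -(rmorph_int RtoC) mulrNz /=.
  have := floor_le (Re tau + 1 / 2%:R); have := floorD1_gt (Re tau + 1 / 2%:R); rewrite -/k intrD.
  by rewrite ler_norml => A B; apply/andP; split; lra.
have t0' : 0 < Im t by rewrite it.
have tn0 : t != 0 by apply: contraTneq t0' => ->; rewrite ltxx.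
have c2 : Cmod t ^+ 2 <= 1 / 2%:R.
  have -> : Cmod t ^+ 2 = Re t ^+ 2 + Im t ^+ 2.
    rewrite /Cmod RsqrtE !RpowE sqr_sqrtr //; apply: addr_ge0; exact: sqr_ge0.
  rewrite it -[Re t ^+ 2]real_normK ?num_real //.
  have := normr_ge0 (Re t); nra.
have c0 : 0 < Cmod t ^+ 2 by rewrite exprn_gt0 // cn_gt0.
have [|tau' A B] := IH (- t^-1) (Im_inv_gt0 t0').
  rewrite Im_inv // it mulrA ler_pdivlMr //.
  by move: hn c2; rewrite exprS -mulrA; move: (2%:R ^+ n * Im tau) (Cmod t ^+ 2) => x w; lra.
by exists tau' => // F iF; rewrite B // (proj2 iF) // /t modinv_addz.
Qed.

Lemma sum_unity (M i : nat) : (0 < M)%N ->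
  \sum_(j < M) qe (M%:R^-1) ^+ (i * j) = if (M %| i)%N then M%:R else 0.
Proof.
case: M => // M _; have pr := qe_prim M; set w := qe _ in pr *.
have w1 := prim_expr_order pr.
under eq_bigr do rewrite exprM.
case: ifP => [/dvdnP[k ->]|d].
  rewrite (eq_bigr (fun=> 1)); first by rewrite sumr_const card_ord.
  by move=> j _; rewrite mulnC exprM w1 !expr1n.
have wi : w ^+ i - 1 != 0 by rewrite subr_eq0 -(prim_order_dvd pr) d.
by apply: (mulfI wi); rewrite -subrX1 mulr0 -exprM mulnC exprM w1 expr1n subrr.
Qed.

Lemma sum_roots (p : {poly C}) (X : C) M : (0 < M)%N ->
  \sum_(j < M) p.[qe (M%:R^-1) ^+ j * X] = M%:R * (\poly_(i < size p) p`_(M * i)).[X ^+ M].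
Proof.
move=> M0; have sz : (size p <= size p * M)%N by rewrite leq_pmulr.
rewrite (eq_bigr (fun j : 'I_M => \sum_(i < size p * M) p`_i * X ^+ i * qe (M%:R^-1) ^+ (i * j))); last first.
  move=> j _; rewrite (horner_coef_wide _ sz); apply: eq_bigr => i _.
  by rewrite exprMn -exprM [(j * i)%N]mulnC; ring.
rewrite exchange_big /=.
rewrite (eq_bigr (fun i : 'I_(size p * M) => p`_i * X ^+ i * (if (M %| i)%N then M%:R else 0))); last first.
  by move=> i _; rewrite -big_distrr /= sum_unity.
rewrite -(big_mkord xpredT (fun i => p`_i * X ^+ i * (if (M %| i)%N then M%:R else 0))) big_nat_mul.
rewrite horner_poly big_distrr /= big_mkord; apply: eq_bigr => a _.
rewrite big_ltn ?mulSn; last by rewrite -{1}[(a * M)%N]add0n ltn_add2r.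
rewrite dvdn_mull // big_nat_cond big1 ?addr0.
  by rewrite -exprM [(a * M)%N]mulnC; ring.
move=> i /andP[/andP[i1 i2] _]; rewrite ifN ?mulr0 //.
by apply/negP => /dvdnP[q e]; move: i1 i2; rewrite e ltn_mul2r addnC -mulSnr ltn_mul2r; lia.
Qed.

(** Replacing [tau] by [tau + j] rotates the parameter by an [M]-th root of unity. The average over
    [j < M] fixes [F] and keeps exactly the exponents divisible by [M]; the pole order is a multiple
    of [M] so that the normalizing power is not affected by the rotation. *)
Lemma has_qexp_average M k F u : (0 < M)%N -> (forall tau, 0 < Im tau -> F (tau + 1) = F tau) ->
  has_qexp M (M * k) F u -> has_qexp 1 k F u.
Proof.
move=> M0 hT [c [c1 c2 hc]]; exists (fun i => c (M * i)%N); split=> //; first by rewrite muln0.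
move=> y1 y2 e K y0 e0; have [p [p1 p2]] := hc y1 y2 e (M * K)%N y0 e0.
have MC : (M%:R : C) != 0 by case: M M0 {hc p1 p2} => // n _; exact: Cnat_neq0.
have MR : 0 < M%:R :> R by rewrite ltr0n.
exists (\poly_(i < size p) p`_(M * i)); split=> [i iK|tau t1 t2].
  rewrite coef_poly; case: ltnP => h; first by rewrite p1 // ltn_pmul2l.
  by rewrite -p1 ?ltn_pmul2l // nth_default // (leq_trans h) // leq_pmull.
rewrite divr1; set X := qe (tau / M%:R).
have -> : qe tau = X ^+ M by rewrite /X -qeX mulrCA mulfV // mulr1.
set q := _.[_]; rewrite -(ler_pM2l MR) -[M%:R in leLHS](cn_nat M) -cnM mulrBr -sum_roots // -exprM.
have hTn (j : nat) t : 0 < Im t -> F (t + j%:R) = F t.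
  elim: j t => [|j IH] t t0; first by rewrite addr0.
  rewrite -natr1 addrA hT ?IH // ImD -(rmorph_nat RtoC) Im_RtoC addr0 //.
have -> : M%:R * (X ^+ (M * k) * F tau) = \sum_(j < M) (X ^+ (M * k) * F tau).
  by rewrite sumr_const card_ord mulr_natl.
rewrite -sumrB; apply: le_trans (cn_sum _ _ _) _.
have -> : M%:R * e = \sum_(j < M) e by rewrite sumr_const card_ord mulr_natl.
apply: ler_sum => j _.
have imj : Im (tau + j%:R) = Im tau by rewrite ImD -(rmorph_nat RtoC) Im_RtoC addr0.
have := p2 (tau + j%:R); rewrite imj => /(_ t1 t2).
rewrite hTn ?(lt_le_trans y0 t1) //.
have -> : qe ((tau + j%:R) / M%:R) = qe (M%:R^-1) ^+ j * X.
  by rewrite -qeX -qeD; congr qe; rewrite mulrDl addrC.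
rewrite exprMn -exprM mulnCA exprM.
by have -> : qe M%:R^-1 ^+ M = 1; [rewrite -qeX mulfV // qe1 | rewrite expr1n mul1r].
Qed.

(** Cauchy's estimate with a mean over roots of unity. Their order is [size p], so that no two
    coefficients of [p] are confused by the mean. *)
Lemma coef_bound (p : {poly C}) (t : C) (B : R) n :
  (forall tau, Im tau = Im t -> Cmod p.[qe tau] <= B) -> Cmod p`_n * Cmod (qe t) ^+ n <= B.
Proof.
move=> h; have B0 : 0 <= B by apply: le_trans (h t erefl); exact: cn_ge0.
have [pn|np] := leqP (size p) n; first by rewrite nth_default // cn0 mul0r.
set L := size p in np; have L0 : (0 < L)%N by exact: leq_ltn_trans np.
have LR : 0 < L%:R :> R by rewrite ltr0n.
set w := qe (L%:R^-1).
have e : \sum_(j < L) p.[w ^+ j * qe t] * w ^+ ((L - n) * j) = L%:R * (p`_n * qe t ^+ n).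
  rewrite (eq_bigr (fun j : 'I_L => \sum_(i < L) p`_i * qe t ^+ i * w ^+ ((i + (L - n)) * j))); last first.
    move=> j _; rewrite horner_coef big_distrl; apply: eq_bigr => i _.
    by rewrite /= exprMn mulnDl exprD -exprM [(j * i)%N]mulnC; ring.
  rewrite exchange_big /= (bigD1 (Ordinal np)) //= -big_distrr /= sum_unity //.
  rewrite subnKC 1?ltnW // dvdnn big1 ?addr0; first by rewrite mulrC.
  move=> i ne; rewrite -big_distrr /= sum_unity // ifN ?mulr0 //.
  apply: contra ne => d; apply/eqP/val_inj => /=.
  have iL := ltn_ord i; case/dvdnP: d => q eq.
  have : (q * L < 2 * L)%N by rewrite -eq; lia.
  rewrite ltn_mul2r L0 /= => q2.
  case: q eq q2 => [|[|//]] eq _; move: eq iL np; move: (i : nat) => l; rewrite ?mul0n ?mul1n; lia.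
rewrite -cnX -cnM -(ler_pM2l LR) -[L%:R in leLHS]cn_nat -cnM -e.
apply: le_trans (cn_sum _ _ _) _.
have -> : L%:R * B = \sum_(j < L) B by rewrite sumr_const card_ord mulr_natl.
apply: ler_sum => j _.
rewrite cnM [X in _ * X]cnX.
have -> : Cmod w = 1 by rewrite cn_qe -(rmorph_nat RtoC) -fmorphV Im_RtoC mulr0 oppr0 expR0.
rewrite expr1n mulr1 /w -qeX -qeD; apply: h.
by rewrite ImD -(rmorph_nat RtoC) -(rmorph_nat RtoC L) -fmorphV -rmorphM Im_RtoC add0r.
Qed.

Lemma exp_neg_le (y : R) : 1 / 2%:R <= y -> exp (- (2 * PI * y)) <= exp (- (2 * PI * (1 / 10%:R))) / 3%:R.
Proof.
move=> y2; have p3 := PI_ge3.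
have h : 3%:R <= exp (2 * PI * (y - 1 / 10%:R)).
  apply: le_trans (exp_ge1x _); have : 3%:R * (y - 1 / 10%:R) <= PI * (y - 1 / 10%:R).
    by rewrite ler_pM2r //; lra.
  by rewrite -[2 * PI * _]mulrA; move: (PI * _) => z; lra.
rewrite ler_pdivlMr //; apply: le_trans (ler_wpM2l (ltW (exp_gt0 _)) h) _.
rewrite -expD; apply: exp_le; lra.
Qed.

Lemma geom_third n : \sum_(i < n) (3%:R^-1 : R) ^+ i.+1 <= 1 / 2%:R.
Proof.
have -> : \sum_(i < n) (3%:R^-1 : R) ^+ i.+1 = 1 / 2%:R * (1 - 3%:R^-1 ^+ n).
  elim: n => [|n IH]; first by rewrite big_ord0 subrr mulr0.
  by rewrite big_ord_recr /= IH exprS; field.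
have : 0 <= (3%:R^-1 : R) ^+ n by rewrite exprn_ge0 // invr_ge0.
by move: (_ ^+ n) => x; lra.
Qed.

Theorem liouville F : modinv F -> has_qexp 1 0 F 0 -> forall tau, 0 < Im tau -> F tau = 0.
Proof.
move=> iF [c [c1 c2 hc]].
(* From height 1/10 to height 1/2 the parameter shrinks at least by a factor 3, and the sum of
   [3 ^ - i] over [i >= 1] is 1/2. A bound on the single line [Im tau = y1] is enough, since it
   controls the coefficients and every point is equivalent to one of height at least 1/2. *)
pose y1 : R := 1 / 10%:R; have y0 : 0 < y1 by rewrite /y1; lra.
have step (B : R) : (forall tau, Im tau = y1 -> Cmod (F tau) <= B) ->
    forall tau, 0 < Im tau -> Cmod (F tau) <= B / 2%:R.
  move=> hB tau /to_half_plane[t ht e]; rewrite -(e F iF).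
  apply/ler_addgt0Pl => d d0; have d2 : 0 < d / 2%:R by rewrite divr_gt0.
  have [p [p1 p2]] := hc y1 (Im t) _ 1%N y0 d2.
  have yt : y1 <= Im t by rewrite /y1; lra.
  pose s : C := (0, y1).
  have ims : Im s = y1 by [].
  have co n : Cmod p`_n * Cmod (qe s) ^+ n <= B + d / 2%:R.
    apply: coef_bound => tau' it; rewrite ims in it.
    have := p2 tau'; rewrite it lexx => /(_ isT yt); rewrite divr1 mul1r => A.
    have -> : p.[qe tau'] = F tau' - (F tau' - p.[qe tau']) by ring.
    by apply: le_trans (cnB_le _ _) _; apply: lerD => //; exact: hB.
  have qs : Cmod (qe t) <= Cmod (qe s) / 3%:R by rewrite !cn_qe ims; exact: exp_neg_le.
  have s0 : 0 < Cmod (qe s) by rewrite cn_gt0 qe_neq0.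
  have Bd : 0 <= B + d / 2%:R by have := co 0%N; apply: le_trans; rewrite mulr1 cn_ge0.
  have pt : Cmod p.[qe t] <= (B + d / 2%:R) * (1 / 2%:R).
    have p0 : p`_0 = 0 by rewrite p1.
    rewrite (@horner_coef_wide _ (size p).+1) // big_ord_recl p0 mul0r add0r.
    apply: le_trans (cn_sum _ _ _) _; apply: le_trans (ler_wpM2l Bd (geom_third (size p))).
    rewrite big_distrr; apply: ler_sum => i _ /=.
    rewrite cnM cnX; apply: le_trans (_ : Cmod p`_i.+1 * (Cmod (qe s) / 3%:R) ^+ i.+1 <= _).
      by rewrite ler_wpM2l ?cn_ge0 // lerXn2r ?nnegrE ?cn_ge0 // divr_ge0 ?cn_ge0.
    rewrite exprMn mulrA ler_wpM2r ?co // exprn_ge0 // invr_ge0 //.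
  have := p2 t yt (lexx _); rewrite divr1 mul1r => A.
  have -> : F t = p.[qe t] + (F t - p.[qe t]) by ring.
  apply: le_trans (cnD _ _) _; lra.
have [B0 B00 hB0] := qexp_bound y1 hc y0.
have hB0' tau : Im tau = y1 -> Cmod (F tau) <= B0.
  by move=> it; have := hB0 tau; rewrite it mul1r; apply.
have bn n : forall tau, 0 < Im tau -> Cmod (F tau) <= B0 / 2%:R ^+ n.+1.
  elim: n => [|n IH]; first by rewrite expr1; exact: step.
  move=> tau t0; rewrite exprSr invfM mulrA; apply: step => // t it; apply: IH; by rewrite it.
move=> tau t0; apply/eqP; rewrite -cn_eq0 eq_le cn_ge0 andbT leNgt; apply/negP => f0.
pose n := Num.bound (B0 / Cmod (F tau)).
have := archi_boundP (divr_ge0 B00 (ltW f0)); rewrite -/n ltr_pdivrMr // => A.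
have := bn n tau t0; rewrite ler_pdivlMr ?exprn_gt0 // leNgt => /negP; apply.
apply: lt_le_trans A _; rewrite mulrC ler_pM2l // -natrX ler_nat.
by rewrite (leq_trans (ltnW (ltn_expl n (ltnSn 1)))) // leq_exp2l.
Qed.

(** * Expansions of infinite products *)

Lemma expr_small (r e : R) : 0 <= r -> r < 1 -> 0 < e -> exists J, r ^+ J <= e.
Proof.
move=> r0 r1 e0; have [N hN] := bounded_sums_tail (geom_summ ler01 r0 r1) e0.
by exists N; have := hN N N.+1 (leqnn N); rewrite big_nat1 mul1r.
Qed.

Lemma cn_qe_strip (y1 : R) M tau : y1 <= Im tau -> Cmod (qe (tau / M%:R)) <= exp (- (2 * PI * (y1 / M%:R))).
Proof.
move=> h; rewrite cn_qe; apply: exp_le; rewrite lerN2 ler_pM2l ?PI2_gt0 // Im_divn.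
by rewrite ler_wpM2r // invr_ge0 ler0n.
Qed.

Lemma strip_lt1 (y1 : R) M : (0 < M)%N -> 0 < y1 -> exp (- (2 * PI * (y1 / M%:R))) < 1.
Proof.
move=> M0 y0; rewrite -[ltRHS]expR0; apply/RltP; apply: exp_increasing; apply/RltP.
by rewrite oppr_lt0; apply: mulr_gt0; [exact: PI2_gt0 | rewrite divr_gt0 // ltr0n].
Qed.

Lemma qexp_ext M k F G c d : (forall tau, 0 < Im tau -> F tau = G tau) -> c =1 d ->
  qexp M k F c -> qexp M k G d.
Proof.
move=> e ed h y1 y2 x K y0 x0; have [p [p1 p2]] := h y1 y2 x K y0 x0.
exists p; split=> [i iK|tau t1 t2]; first by rewrite -ed p1.
by rewrite -e ?p2 //; apply: lt_le_trans t1.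
Qed.

Lemma qexp_poly M (p : {poly C}) : qexp M 0 (fun t => p.[qe (t / M%:R)]) (fun i => p`_i).
Proof.
by move=> y1 y2 e K _ e0; exists p; split=> // tau _ _; rewrite mul1r subrr cn0 ltW.
Qed.

Lemma qexp_geom M (al : C) m : (0 < M)%N -> (0 < m)%N -> Cmod al = 1 ->
  qexp M 0 (fun t => (1 - al * qe (t / M%:R) ^+ m)^-1) (fun i => if (m %| i)%N then al ^+ (i %/ m) else 0).
Proof.
move=> M0 m0 a1 y1 y2 e K y0 e0.
set r := exp (- (2 * PI * (y1 / M%:R))).
have r0 : 0 <= r by rewrite ltW // exp_gt0.
have r1 : r < 1 by exact: strip_lt1.
have d0 : 0 < 1 - r by rewrite subr_gt0.
have [J0 hJ0] := expr_small r0 r1 (mulr_gt0 e0 d0).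
pose J := maxn J0 K.
have hJ : r ^+ J <= e * (1 - r).
  apply: le_trans hJ0; apply: ler_wiXn2l => //; first exact: ltW.
  exact: leq_maxl.
exists ((\poly_(j < J) al ^+ j) \Po 'X^m); split=> [i iK|tau t1 t2].
  rewrite coef_comp_poly_Xn //; case: ifP => // _; rewrite coef_poly ifT //.
  by apply: leq_ltn_trans (leq_div i m) _; apply: leq_trans iK _; exact: leq_maxr.
have hX := cn_qe_strip M t1; set X := qe _ in hX *; rewrite -/r in hX.
rewrite mul1r horner_comp hornerXn horner_poly.
have X1 : Cmod X <= 1 by apply: le_trans hX (ltW r1).
set z := al * X ^+ m.
have cz : Cmod z <= r.
  rewrite cnM a1 mul1r cnX; apply: le_trans hX.
  by rewrite -{2}[Cmod X]expr1; apply: ler_wiXn2l => //; exact: cn_ge0.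
have hz : 1 - r <= Cmod (1 - z) by have := cnB_ge 1 z; rewrite cn1; lra.
have z1 : 1 - z != 0 by rewrite -cn_gt0; apply: lt_le_trans hz.
have -> : (1 - z)^-1 - \sum_(i < J) al ^+ i * (X ^+ m) ^+ i = z ^+ J / (1 - z).
  rewrite (eq_bigr (fun i : 'I_J => z ^+ i)); last by move=> i _; rewrite exprMn.
  apply: (mulIf z1); rewrite mulrBl mulVf // mulfVK // mulrC.
  by rewrite -[1 - z in X in _ - X]opprB mulNr -subrX1 opprB opprB addrC subrK.
rewrite cnM cnV ler_pdivrMr ?cn_gt0 // cnX; apply: le_trans (_ : r ^+ J <= _).
  by apply: lerXn2r; rewrite ?nnegrE ?cn_ge0.
by apply: le_trans hJ _; rewrite ler_pM2l.
Qed.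

(** Factor [n] has no terms of degree 1 to [n], so the coefficient [i] of the partial products is
    constant from stage [i] on; the diagonal [cc i i] gives the coefficients of the limit. *)
Lemma has_qexp_prod M (f : nat -> C -> C) (c : nat -> nat -> C) (G : C -> C) (b : R -> nat -> R) (B : R -> R) :
  (forall n, qexp M 0 (f n) (c n)) -> (forall n i, algint (c n i)) ->
  (forall n, c n 0%N = 1) -> (forall n i, (0 < i)%N -> (i <= n)%N -> c n i = 0) ->
  (forall y : R, 0 < y -> bounded_sums (b y) (B y)) ->
  (forall y n tau, 0 < y -> y <= Im tau -> Cmod (f n tau - 1) <= b y n) ->
  (forall tau, 0 < Im tau -> cvC (fun n => \prod_(0 <= i < n) f i tau) (G tau)) ->
  has_qexp M 0 G 1.
Proof.
move=> hf hA h0 hc hb ht hG.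
pose cc := fix cc n : nat -> C := if n is n'.+1 then fun i => \sum_(l < i.+1) cc n' l * c n' (i - l)%N
   else fun i => if i == 0%N then 1 else 0.
have ccA n i : algint (cc n i).
  elim: n i => [|n IH] i /=; first by case: ifP => _; [exact: algint1|exact: algint0].
  by apply: algint_sum => l _; apply: algintM.
have ccS n i : (i <= n)%N -> cc n.+1 i = cc n i.
  move=> i_n /=; rewrite big_ord_recr /= subnn h0 mulr1 big1 ?add0r // => l _.
  rewrite hc ?mulr0 // ?subn_gt0 //; exact: leq_trans (leq_subr _ _) i_n.
have ccE n i : (i <= n)%N -> cc n i = cc i i.
  elim: n => [|n IH]; first by rewrite leqn0 => /eqP->.
  rewrite leq_eqVlt => /orP[/eqP->//|h]; rewrite ccS // IH //.
have cc0 n : cc n 0%N = 1 by rewrite ccE.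
have P n : qexp M 0 (fun t => \prod_(0 <= i < n) f i t) (cc n).
  elim: n => [|n IH].
    apply: qexp_ext (qexp_poly M 1%:P) => [tau _|i]; first by rewrite hornerC big_geq.
    by rewrite coefC.
  by apply: qexp_ext (qexp_mul IH (hf n)) => [tau _|//]; rewrite big_nat_recr.
exists (fun i => cc i i); split=> // y1 y2 e K y0 e0.
have e2 : 0 < e / 2%:R by rewrite divr_gt0.
have [d d0 hd] := exp_small (B y1) e2.
have [N hN] := bounded_sums_tail (hb _ y0) d0.
pose n := maxn N K.
have [p [p1 p2]] := P n y1 y2 _ K y0 e2.
exists p; split=> [i iK|tau t1 t2].
  by rewrite p1 // ccE // (leq_trans (ltnW iK)) // leq_maxr.
have := p2 tau t1 t2; rewrite !mul1r; set Pn := \prod_(0 <= i < n) _ => A.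
have t0 := lt_le_trans y0 t1.
have A2 : Cmod (G tau - Pn) <= e / 2%:R.
  apply: (cvC_le (N := n) (hG tau t0)) => n' nn'.
  have E m : \prod_(0 <= i < m) f i tau = \prod_(0 <= i < m) (1 + (f i tau - 1)).
    by apply: eq_bigr => i _; rewrite addrCA subrr addr0.
  rewrite /Pn !E.
  apply: le_trans (prod1p_tail (hb _ y0) (fun i => ht y1 i tau y0 t1) nn') _.
  apply: hd; first by apply: sumr_ge0 => i _; exact: (proj1 (hb _ y0)).
  by apply: hN; exact: leq_maxl.
rewrite -(subrK Pn (G tau)) -addrA; apply: le_trans (cnD _ _) _; lra.
Qed.

(** The inverse needs an expansion of its own because theta values also stand in denominators. *)
Definition unit_qexp M (F : C -> C) : Prop :=
  has_qexp M 0 F 1 /\ has_qexp M 0 (fun t => (F t)^-1) 1.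

Lemma unit_qexp_mul M F G : unit_qexp M F -> unit_qexp M G -> unit_qexp M (fun t => F t * G t).
Proof.
move=> [F1 F2] [G1 G2]; split; first by have := has_qexp_mul F1 G1; rewrite mulr1.
by have := has_qexp_mul F2 G2; rewrite mulr1; apply: has_qexp_ext => tau _; rewrite invfM.
Qed.

Lemma unit_qexp_inv M F : unit_qexp M F -> unit_qexp M (fun t => (F t)^-1).
Proof. by move=> [F1 F2]; split=> //; apply: has_qexp_ext F1 => tau _; rewrite invrK. Qed.

Lemma unit_qexp1 M : unit_qexp M (fun=> 1).
Proof. by split; rewrite ?invr1; apply: has_qexp_ext (has_qexp_cst M algint1) => tau _; rewrite ?invr1. Qed.

Lemma unit_qexp_poch M (al : C) r N : (0 < M)%N -> (0 < r)%N -> (0 < N)%N -> Cmod al = 1 -> algint al ->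
  unit_qexp M (fun t => poch_inf (al * qe (t / M%:R) ^+ r) (qe (t / M%:R) ^+ N)).
Proof.
move=> M0 r0 N0 a1 aA.
pose ex n := (r + N * n)%N.
have ex0 n : (n < ex n)%N by rewrite /ex; nia.
pose rho (y : R) := exp (- (2 * PI * (y / M%:R))).
have rho0 y : 0 < rho y by exact: exp_gt0.
have rho1 y : 0 < y -> rho y < 1 by exact: strip_lt1.
have hz y n tau : 0 < y -> y <= Im tau -> Cmod (al * qe (tau / M%:R) ^+ ex n) <= rho y * rho y ^+ n.
  move=> y0 t1; have hX := cn_qe_strip M t1; rewrite -/(rho y) in hX.
  rewrite cnM a1 mul1r cnX -exprS; apply: le_trans (_ : rho y ^+ ex n <= _).
    by apply: lerXn2r; rewrite ?nnegrE ?cn_ge0 // ltW.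
  by apply: ler_wiXn2l => //; rewrite ltW // rho1.
have hq tau : 0 < Im tau -> Cmod (qe (tau / M%:R) ^+ N) < 1.
  move=> t0; rewrite cnX exprn_ilt1 ?cn_ge0 //; first by rewrite -lt0n.
  by apply: le_lt_trans (cn_qe_strip M (lexx (Im tau))) _; exact: rho1.
have hcv tau : 0 < Im tau -> cvC (fun n => \prod_(0 <= i < n) (1 - al * qe (tau / M%:R) ^+ ex i))
    (poch_inf (al * qe (tau / M%:R) ^+ r) (qe (tau / M%:R) ^+ N)).
  move=> t0; apply: cvC_eq (proj1 (poch_cv _ (hq tau t0))) => n.
  rewrite poch_partialE; apply: eq_bigr => i _; by rewrite -exprM -mulrA -exprD.
have hlt tau n : 0 < Im tau -> Cmod (al * qe (tau / M%:R) ^+ ex n) < 1.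
  move=> t0; apply: le_lt_trans (hz _ n _ t0 (lexx _)) _; rewrite -exprS.
  by rewrite exprn_ilt1 ?rho1 // ltW.
have h1 tau n : 0 < Im tau -> 1 - al * qe (tau / M%:R) ^+ ex n != 0.
  move=> t0; rewrite subr_eq0; apply: contraTneq (hlt tau n t0) => <-.
  by rewrite cn1 ltxx.
split.
- apply: (has_qexp_prod (f := fun n t => 1 - al * qe (t / M%:R) ^+ ex n)
    (c := fun n i => (1 - al *: 'X^(ex n) : {poly C})`_i)
    (b := fun y n => rho y * rho y ^+ n) (B := fun y => rho y / (1 - rho y))) => //.
  + move=> n; apply: qexp_ext (qexp_poly M (1 - al *: 'X^(ex n))) => // tau _.
    by rewrite !hornerE.
  + move=> n i; rewrite coefB coef1 coefZ coefXn; apply: algintD; first by case: (_ == _); [exact: algint1|exact: algint0].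
    by apply: algintN; apply: algintM => //; case: (_ == _); [exact: algint1|exact: algint0].
  + by move=> n; rewrite coefB coef1 coefZ coefXn /= ltn_eqF ?mulr0 ?subr0 // (leq_ltn_trans _ (ex0 n)).
  + move=> n i i0 i_n; rewrite coefB coef1 coefZ coefXn gtn_eqF // ltn_eqF ?mulr0 ?subr0 //.
    exact: leq_ltn_trans i_n (ex0 n).
  + by move=> y y0; apply: geom_summ; rewrite ?ltW ?rho1.
  + by move=> y n tau y0 t1; rewrite addrAC subrr add0r cnN hz.
- apply: (has_qexp_prod (f := fun n t => (1 - al * qe (t / M%:R) ^+ ex n)^-1)
    (c := fun n i => if (ex n %| i)%N then al ^+ (i %/ ex n) else 0)
    (b := fun y n => rho y / (1 - rho y) * rho y ^+ n) (B := fun y => rho y / (1 - rho y) / (1 - rho y))) => //.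
  + by move=> n; apply: qexp_geom => //; exact: leq_ltn_trans (ex0 n).
  + by move=> n i; case: ifP => _; [exact: algintX|exact: algint0].
  + by move=> n; rewrite dvdn0 div0n.
  + move=> n i i0 i_n; rewrite ifN //; apply/negP => /(dvdn_leq i0) h.
    by have := leq_trans (leq_trans (ex0 n) h) i_n; rewrite ltnn.
  + move=> y y0; apply: geom_summ; rewrite ?ltW ?rho1 //.
    by apply: divr_gt0 => //; rewrite subr_gt0 rho1.
  + move=> y n tau y0 t1; have t0 := lt_le_trans y0 t1.
    have A := hz y n tau y0 t1; have n0 := h1 tau n t0.
    set z := al * _ in A n0 *.
    have -> : (1 - z)^-1 - 1 = z / (1 - z) by field.
    have d0 : 0 < 1 - rho y by rewrite subr_gt0 rho1.
    have hz1 : 1 - rho y <= Cmod (1 - z).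
      have := cnB_ge 1 z; rewrite cn1; apply: le_trans; rewrite lerD2l lerN2.
      apply: le_trans A _; apply: ler_piMr; first exact: ltW.
      by apply: exprn_ile1; rewrite ltW // rho1.
    rewrite cnM cnV mulrAC; apply: ler_pM; rewrite ?invr_ge0 ?cn_ge0 //.
    by rewrite lef_pV2 // posrE ?cn_gt0.
  + move=> tau t0; have nz : poch_inf (al * qe (tau / M%:R) ^+ r) (qe (tau / M%:R) ^+ N) != 0.
      apply: (proj2 (poch_cv _ (hq tau t0))) => i.
      rewrite -exprM -mulrA -exprD; apply/eqP => e; have := h1 tau i t0; rewrite /ex e subrr eqxx //.
    apply: cvC_eq (cvC_inv (hcv tau t0) nz) => n.
    by rewrite prodfV.
Qed.

Definition algunit (x : C) : Prop := [/\ x != 0, algint x & algint x^-1].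

Lemma algunit_mul x y : algunit x -> algunit y -> algunit (x * y).
Proof. by move=> [x0 x1 x2] [y0 y1 y2]; split; rewrite ?mulf_neq0 ?invfM //; exact: algintM. Qed.

Lemma algunit_inv x : algunit x -> algunit x^-1.
Proof. by move=> [x0 x1 x2]; split; rewrite ?invr_eq0 ?invrK. Qed.

Lemma algunit1 : algunit 1.
Proof. by split; rewrite ?oner_eq0 ?invr1 //; exact: algint1. Qed.

Lemma algunitN x : algunit x -> algunit (- x).
Proof. by move=> [x0 x1 x2]; split; rewrite ?oppr_eq0 ?invrN //; exact: algintN. Qed.

Lemma algunit_sign n : algunit ((-1) ^+ n).
Proof. by elim: n => [|n IH]; rewrite ?expr0 ?exprS; [exact: algunit1 | apply: algunit_mul => //; apply: algunitN; exact: algunit1]. Qed.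

Lemma algunitX x n : algunit x -> algunit (x ^+ n).
Proof. by move=> h; elim: n => [|n IH]; rewrite ?expr0 ?exprS; [exact: algunit1 | exact: algunit_mul]. Qed.

Lemma algunit_qe (m : int) n : (0 < n)%N -> algunit (qe (m%:~R / n%:R)).
Proof.
case: n => // n _; split; [exact: qe_neq0|exact: algint_qe_frac|].
by rewrite -qeN -mulNr -mulrNz; exact: algint_qe_frac.
Qed.

(** * Expansions of theta quotients *)

(* The theta function at (b1 tau + b2) / N starts with qe (tau / 2N) to the power minus [texp N b1]. *)
Definition texp (N b : nat) : nat := (N * (b %/ N) ^ 2 + 2 * (b %/ N) * (b %% N) + b %% N)%N.

(* The factor 1 - w of theta at a torsion point, which is constant only when N divides b1; the other
   factors 1 - w q^m and 1 - q^m / w have constant term 1. *)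
Definition edge (N b1 : nat) (b2 : int) : C := if (N %| b1)%N then 1 - qe (b2%:~R / N%:R) else 1.

(** Quasi-periodicity lowers [b1] to its residue [r] modulo [N]. For [r > 0] the factor [1 - w] is
    merged into the infinite product as its first term; for [r = 0] it is constant and split off as
    [edge]. The half angle in [sinq] is the reason for the root of order [2 N] of [q]. *)
Lemma theta_exp (N b1 : nat) (b2 : int) : (0 < N)%N -> exists rho U,
  [/\ algunit rho, unit_qexp (2 * N) U & forall tau, 0 < Im tau ->
    theta ((b1%:R * tau + b2%:~R) / N%:R) tau =
    rho * edge N b1 b2 * qe (tau / (2 * N)%:R) ^- texp N b1 * U tau].
Proof.
move=> N0; set m := (b1 %/ N)%N; set r := (b1 %% N)%N.
have NC : (N%:R : C) != 0 by case: N N0 {m r} => // n _; exact: Cnat_neq0.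
have NN0 : (0 < 2 * N)%N by rewrite muln_gt0.
have rN : (r < N)%N by rewrite ltn_mod.
have hu := algunit_qe (- ((2 * m).+1%:Z * b2)) NN0.
have hz := algunit_qe b2 N0.
set ze := qe _ in hz; have [z0 z1 z2] := hz.
have cz : Cmod ze = 1.
  rewrite /ze cn_qe -(rmorph_int RtoC) -(rmorph_nat RtoC N) -fmorphV -rmorphM Im_RtoC.
  by rewrite mulr0 oppr0 expR0.
have cz' : Cmod ze^-1 = 1 by rewrite cnV cz invr1.
pose al := if r == 0%N then 2 * N else 2 * r.
exists (- ((-1) ^+ m * qe ((- ((2 * m).+1%:Z * b2))%:~R / (2 * N)%:R))).
exists (fun t => poch_inf (ze * qe (t / (2 * N)%:R) ^+ (if r == 0%N then 2 * N else 2 * r))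
                          (qe (t / (2 * N)%:R) ^+ (2 * N)) *
                 poch_inf (ze^-1 * qe (t / (2 * N)%:R) ^+ (2 * (N - r)))
                          (qe (t / (2 * N)%:R) ^+ (2 * N))).
split.
- by apply: algunitN; apply: algunit_mul => //; exact: algunit_sign.
- apply: unit_qexp_mul; apply: unit_qexp_poch => //; first by case: (r) => [|r'].
  by rewrite muln_gt0 /= subn_gt0.
move=> tau t0; have q1 := cn_qe_lt1 t0.
set X := qe (tau / (2 * N)%:R).
have X2N : X ^+ (2 * N) = qe tau.
  by rewrite -qeX mulrCA mulfV ?mulr1 // natrM mulf_neq0 // Ctwo_neq0.
pose z := (r%:R * tau + b2%:~R) / N%:R : C.
have -> : (b1%:R * tau + b2%:~R) / N%:R = z + m%:R * tau :> C.
  have eb : (b1%:R : C) = m%:R * N%:R + r%:R by rewrite -natrM -natrD -divn_eq.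
  rewrite /z eb; field; exact: NC.
rewrite theta_addntau //.
have qz : qe z = ze * X ^+ (2 * r).
  rewrite /ze /X -qeX -qeD; congr qe; rewrite /z !natrM; field.
  by rewrite NC Ctwo_neq0.
have qtz : qe (tau - z) = ze^-1 * X ^+ (2 * (N - r)).
  rewrite qeD qeN qz -X2N mulnBr -{1}(subnK (_ : 2 * r <= 2 * N)%N) ?leq_mul2l 1?ltnW // exprD.
  by rewrite invfM mulrCA mulfK // expf_neq0 // qe_neq0.
have h1 : theta z tau = - qe (- (z / 2%:R)) * (edge N b1 b2 *
   (poch_inf (ze * X ^+ (if r == 0%N then 2 * N else 2 * r)) (qe tau) * poch_inf (qe (tau - z)) (qe tau))).
  have s1 : sinq z = - qe (- (z / 2%:R)) * (1 - qe z).
    by rewrite -opprB mulrNN qe_sub1 qeN mulKf // qe_neq0.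
  rewrite /theta s1 -!mulrA; congr (_ * _); rewrite !mulrA; congr (_ * _).
  rewrite /edge /dvdn -/r; have [r0|r0] := eqVneq r 0%N.
    by rewrite qeD qz X2N r0 muln0 mulr1.
  by rewrite mul1r qeD -(poch_inf_rec _ q1) qz.
rewrite h1 qtz X2N.
have h2 : qe (- (m%:R * z + m%:R ^+ 2 * tau / 2%:R)) * qe (- (z / 2%:R)) =
   qe ((- ((2 * m).+1%:Z * b2))%:~R / (2 * N)%:R) * X ^- texp N b1.
  rewrite /X -qeX -qeN -!qeD; congr qe; rewrite /z /texp -/m -/r.
  rewrite mulrNz intrM -pmulrn -natr1 !natrD !natrM ?natrX; field.
  have NN : N%:R + N%:R != 0 :> C.
    have -> : N%:R + N%:R = 2%:R * N%:R :> C by ring.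
    by rewrite mulf_neq0 // Ctwo_neq0.
  by rewrite ?NN ?NC ?Ctwo_neq0.
transitivity (- ((-1) ^+ m) * (qe (- (m%:R * z + m%:R ^+ 2 * tau / 2%:R)) * qe (- (z / 2%:R))) * (edge N b1 b2 *
 (poch_inf (ze * X ^+ (if r == 0%N then 2 * N else 2 * r)) (qe tau) *
  poch_inf (ze^-1 * X ^+ (2 * (N - r))) (qe tau)))); first by ring.
rewrite h2; ring.
Qed.

Lemma theta_prod_exp (N b1 : nat) (b2 : int) (l : seq nat) : (0 < N)%N -> exists rho U,
  [/\ algunit rho, unit_qexp (2 * N) U & forall tau, 0 < Im tau ->
    \prod_(s <- l) theta (s%:R * ((b1%:R * tau + b2%:~R) / N%:R)) tau =
    rho * (\prod_(s <- l) edge N (s * b1) (s%:Z * b2)) *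
      qe (tau / (2 * N)%:R) ^- (\sum_(s <- l) texp N (s * b1)) * U tau].
Proof.
move=> N0; elim: l => [|s l [rho [U [h1 h2 h3]]]].
  exists 1, (fun=> 1); split; [exact: algunit1|exact: unit_qexp1|move=> tau _].
  by rewrite !big_nil expr0 invr1 !mulr1.
have [rho' [U' [g1 g2 g3]]] := theta_exp (s * b1) (s%:Z * b2) N0.
exists (rho' * rho), (fun t => U' t * U t); split; [exact: algunit_mul|exact: unit_qexp_mul|move=> tau t0].
rewrite !big_cons h3 // exprD invfM.
have -> : s%:R * ((b1%:R * tau + b2%:~R) / N%:R) = ((s * b1)%:R * tau + (s%:Z * b2)%:~R) / N%:R :> C.
  by rewrite natrM intrM -pmulrn; ring.
rewrite g3 //; ring.
Qed.

Lemma kappa_exp ns ds (N b1 : nat) (b2 : int) : (0 < N)%N -> exists rho U,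
  [/\ algunit rho, unit_qexp (2 * N) U & forall tau, 0 < Im tau ->
    kappa ns ds N b1%:Z b2 tau =
    rho * prod_quot ns ds (fun s => edge N (s * b1) (s%:Z * b2)) *
      (qe (tau / (2 * N)%:R) ^- (\sum_(s <- ns) texp N (s * b1)) *
       (qe (tau / (2 * N)%:R) ^+ (\sum_(s <- ds) texp N (s * b1)))) * U tau].
Proof.
move=> N0; have [r1 [U1 [h1 h2 h3]]] := theta_prod_exp b1 b2 ns N0.
have [r2 [U2 [g1 g2 g3]]] := theta_prod_exp b1 b2 ds N0.
exists (r1 / r2), (fun t => U1 t / U2 t); split.
- by apply: algunit_mul => //; exact: algunit_inv.
- by apply: unit_qexp_mul => //; exact: unit_qexp_inv.
by move=> tau t0; rewrite /kappa /theta_quot /prod_quot h3 // g3 // !invfM invrK; ring.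
Qed.

Lemma kappa_has_qexp ns ds (N b1 : nat) (b2 : int) : (0 < N)%N ->
  algint (prod_quot ns ds (fun s => edge N (s * b1) (s%:Z * b2))) ->
  exists rho, algunit rho /\
   forall k, (\sum_(s <- ns) texp N (s * b1) <= \sum_(s <- ds) texp N (s * b1) + k)%N ->
   has_qexp (2 * N) k (kappa ns ds N b1%:Z b2)
    (if (\sum_(s <- ns) texp N (s * b1) == \sum_(s <- ds) texp N (s * b1) + k)%N
     then rho * prod_quot ns ds (fun s => edge N (s * b1) (s%:Z * b2)) else 0).
Proof.
move=> N0; have [rho [U [h1 [h2 _] h3]]] := kappa_exp ns ds b1 b2 N0.
set E := prod_quot _ _ _ in h3 *; set A := (\sum_(s <- ns) _)%N in h3 *; set B := (\sum_(s <- ds) _)%N in h3 *.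
move=> AE; exists rho; split=> // k Ak.
have AR : algint (rho * E) by apply: algintM => //; case: h1.
have := has_qexp_mulXV k (has_qexp_mulX (B + k - A) (has_qexp_mul (has_qexp_cst (2 * N) AR) h2)).
rewrite mulr1 subn_eq0 add0n; have -> : (B + k <= A)%N = (A == B + k)%N by rewrite eqn_leq Ak.
apply: has_qexp_ext => tau t0; rewrite h3 //; set X := qe _.
have X0 n : X ^+ n != 0 by rewrite expf_neq0 // qe_neq0.
have e : X ^- A * X ^+ B = X ^- k * X ^+ (B + k - A).
  have d : X ^+ A * X ^+ (B + k - A) = X ^+ B * X ^+ k by rewrite -!exprD subnKC.
  by apply: (mulfI (X0 A)); rewrite mulrA mulfV // mul1r mulrCA d mulrCA mulVf ?mulr1.
by rewrite e; ring.
Qed.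

Lemma has_qexp_algint M k F u : has_qexp M k F u -> algint u.
Proof. by move=> [c [h <- _]]. Qed.

Lemma has_qexp_pow M k F u n : has_qexp M k F u -> has_qexp M (n * k) (fun t => F t ^+ n) (u ^+ n).
Proof.
move=> h; elim: n => [|n IH]; first by apply: has_qexp_ext (has_qexp_cst M algint1) => tau _; rewrite expr0.
by rewrite mulSn exprS; apply: has_qexp_ext (has_qexp_mul h IH) => tau _; rewrite exprS.
Qed.

Lemma has_qexp_scale M k F u c : algint c -> has_qexp M k F u -> has_qexp M k (fun t => c * F t) (c * u).
Proof. by move=> hc h; have := has_qexp_mul (has_qexp_cst M hc) h. Qed.

Lemma modinv_reduction h rho : modinv h -> has_qexp 1 1 h rho -> algunit rho ->
  forall k G u, modinv G -> has_qexp 1 k G u -> exists P : {poly C},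
   [/\ forall i, algint P`_i, (size P <= k.+1)%N, P`_k = u / rho ^+ k &
     forall tau, 0 < Im tau -> G tau = P.[h tau]].
Proof.
move=> [hT hS] hh [r0 r1 r2]; elim=> [|k IH] G u [gT gS] hG; have uA := has_qexp_algint hG.
  exists u%:P; split.
  - by move=> i; rewrite coefC; case: ifP => // _; exact: algint0.
  - exact: size_polyC_leq1.
  - by rewrite coefC expr0 divr1.
  move=> tau t0; rewrite hornerC; apply/eqP; rewrite -subr_eq0; apply/eqP.
  apply: (liouville (F := fun t => G t - u)) => //.
    by split=> t t0' /=; rewrite ?gT ?gS.
  by have := has_qexp_add hG (has_qexp_cst 1 (algintN uA)); rewrite subrr.
pose c := u / rho ^+ k.+1.
have cA : algint c by apply: algintM => //; rewrite -exprVn; exact: algintX.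
have [u' hG'] : exists u', has_qexp 1 k (fun t => G t + - c * h t ^+ k.+1) u'.
  apply: has_qexp_lower.
  have hp := has_qexp_pow k.+1 hh; rewrite muln1 in hp.
  have := has_qexp_add hG (has_qexp_scale (algintN cA) hp).
  by rewrite mulNr mulfVK ?subrr // expf_neq0.
have [|P [P1 P2 P3 P4]] := IH _ _ _ hG'.
  by split=> t t0 /=; rewrite ?gT ?gS ?hT ?hS.
exists (P + c *: 'X^(k.+1)); split.
- move=> i; rewrite coefD coefZ coefXn; apply: algintD => //; apply: algintM => //.
  by case: (_ == _); [exact: algint1|exact: algint0].
- rewrite (leq_trans (size_polyD _ _)) // geq_max (leq_trans P2) //=.
  by rewrite (leq_trans (size_scale_leq _ _)) // size_polyXn.
- by rewrite coefD coefZ coefXn eqxx mulr1 nth_default ?add0r.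
by move=> tau t0; rewrite hornerD hornerZ hornerXn -P4 // mulNr subrK.
Qed.

(** * Integer matrices of a given determinant *)

Definition m2 := (int * int * int * int)%type.
Definition m2mul (A B : m2) : m2 :=
  let '(a, b, c, d) := A in let '(a', b', c', d') := B in
  (a * a' + b * c', a * b' + b * d', c * a' + d * c', c * b' + d * d').
Definition m2det (A : m2) : int := let '(a, b, c, d) := A in a * d - b * c.
Definition m2adj (A : m2) : m2 := let '(a, b, c, d) := A in (d, - b, - c, a).
Definition mob (A : m2) (t : C) : C :=
  let '(a, b, c, d) := A in (a%:~R * t + b%:~R) / (c%:~R * t + d%:~R).

Lemma m2mulA A B D : m2mul A (m2mul B D) = m2mul (m2mul A B) D.
Proof.
move: A B D => [[[a b] c] d] [[[a' b'] c'] d'] [[[a'' b''] c''] d''] /=.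
by congr (_, _, _, _); ring.
Qed.

Lemma m2det_mul A B : m2det (m2mul A B) = m2det A * m2det B.
Proof. by move: A B => [[[a b] c] d] [[[a' b'] c'] d'] /=; ring. Qed.

Lemma m2det_adj A : m2det (m2adj A) = m2det A.
Proof. by move: A => [[[a b] c] d] /=; ring. Qed.

Lemma m2mul1 A : m2mul (1, 0, 0, 1) A = A.
Proof. by move: A => [[[a b] c] d] /=; congr (_, _, _, _); ring. Qed.

Lemma m2mulr1 A : m2mul A (1, 0, 0, 1) = A.
Proof. by move: A => [[[a b] c] d] /=; congr (_, _, _, _); ring. Qed.

Lemma m2adjK A : m2det A = 1 -> m2mul (m2adj A) A = (1, 0, 0, 1).
Proof. by move: A => [[[a b] c] d] /= e; congr (_, _, _, _); rewrite -?e; ring. Qed.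

Lemma m2adjKr A : m2det A = 1 -> m2mul A (m2adj A) = (1, 0, 0, 1).
Proof. by move: A => [[[a b] c] d] /= e; congr (_, _, _, _); rewrite -?e; ring. Qed.

Lemma mob_denom (c d : int) (t : C) : 0 < Im t -> ((c != 0) || (d != 0)) -> c%:~R * t + d%:~R != 0 :> C.
Proof.
move=> t0 h; apply/eqP => e.
have e' : c%:~R * t + d%:~R = 0%:~R * t + 0%:~R :> C by rewrite e mul0r add0r.
by have [c0 d0] := lattice_inj t0 e'; rewrite c0 d0 eqxx in h.
Qed.

Lemma m2det_denom (a b c d : int) : 0 < m2det (a, b, c, d) -> (c != 0) || (d != 0).
Proof.
by rewrite /=; case: eqP => [->|//]; case: eqP => [->|//]; rewrite !mulr0 subrr ltxx.
Qed.

Lemma Im_mob A t : 0 < m2det A -> 0 < Im t -> 0 < Im (mob A t).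
Proof.
move: A => [[[a b] c] d] dA t0; have n0 := mob_denom t0 (m2det_denom dA).
have rC (x : int) : x%:~R = RtoC x%:~R :> C by rewrite rmorph_int.
rewrite /mob; have [c0|c0] := eqVneq c 0.
  have {}dA : 0 < a * d by move: (dA : 0 < a * d - b * c); rewrite c0 mulr0 subr0.
  move: n0; rewrite c0 mulr0z mul0r add0r => d0.
  have d0' : d%:~R != 0 :> R by move: d0; rewrite rC fmorph_eq0.
  have -> : (a%:~R * t + b%:~R) / d%:~R = RtoC (a%:~R / d%:~R) * t + RtoC (b%:~R / d%:~R).
    rewrite !rmorphM !fmorphV /= -!rC; field; exact: d0.
  rewrite ImD Im_scale Im_RtoC addr0 mulr_gt0 //.
  have -> : a%:~R / d%:~R = (a * d)%:~R / d%:~R ^+ 2 :> R by rewrite intrM; field.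
  by rewrite divr_gt0 ?ltr0z // exprn_even_gt0.
have cC : c%:~R != 0 :> C by rewrite rC fmorph_eq0 intr_eq0.
pose s := t + RtoC (d%:~R / c%:~R).
have s0 : 0 < Im s by rewrite /s ImD Im_RtoC addr0.
have sn0 : s != 0 by apply: contraTneq s0 => ->; rewrite ltxx.
have e : (a%:~R * t + b%:~R) / (c%:~R * t + d%:~R) =
   RtoC ((a * d - b * c)%:~R / c%:~R ^+ 2) * - s^-1 + RtoC (a%:~R / c%:~R).
  have es : c%:~R * t + d%:~R = c%:~R * s.
    by rewrite /s rmorphM fmorphV /= -!rC; field.
  have -> : t = s - d%:~R / c%:~R by rewrite /s rmorphM fmorphV /= -!rC addrK.
  rewrite !rmorphM !fmorphV rmorphXn /= -!rC intrB !intrM; field.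
  by rewrite sn0 cC subrK mulf_neq0.
rewrite e ImD Im_RtoC addr0 Im_scale mulr_gt0 ?Im_inv_gt0 //.
by apply: divr_gt0; [rewrite ltr0z | rewrite exprn_even_gt0 //= intr_eq0].
Qed.

Lemma mobT (a b c d k : int) t : 0 < m2det (a, b, c, d) -> 0 < Im t ->
  mob (a + k * c, b + k * d, c, d) t = mob (a, b, c, d) t + k%:~R.
Proof.
move=> dA t0; have n0 := mob_denom t0 (m2det_denom dA).
by rewrite /mob !intrD !intrM; field.
Qed.

Lemma mobS (a b c d : int) t : 0 < m2det (a, b, c, d) -> 0 < Im t ->
  mob (- c, - d, a, b) t = - (mob (a, b, c, d) t)^-1.
Proof.
move=> dA t0; have n0 := mob_denom t0 (m2det_denom dA).
have n1 : a%:~R * t + b%:~R != 0 :> C.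
  apply: mob_denom => //; apply: contraTT dA; rewrite negb_or !negbK => /andP[/eqP-> /eqP->].
  by rewrite /= !mul0r subrr ltxx.
by rewrite /mob !intrN; field; rewrite n0 n1.
Qed.

Lemma mobN (a b c d : int) t : mob (- a, - b, - c, - d) t = mob (a, b, c, d) t.
Proof. by rewrite /mob !intrN !mulNr -!opprD invrN mulrNN. Qed.

(** The matrix identity is used to tell classes apart. The clause on invariant functions is
    accumulated along the moves T and S, so that a matrix [g] never has to be factored into
    generators. *)
Definition rowrel (A B : m2) : Prop :=
  (exists g, m2det g = 1 /\ A = m2mul g B) /\
  (forall F t, modinv F -> 0 < Im t -> F (mob A t) = F (mob B t)).

Lemma rowrel_trans A B D : rowrel A B -> rowrel B D -> rowrel A D.
Proof.
move=> [[g [g1 E1]] e1] [[g' [g1' E2]] e2]; split.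
  by exists (m2mul g g'); rewrite m2det_mul g1 g1' E1 E2 m2mulA.
by move=> F t iF t0; exact: etrans (e1 F t iF t0) (e2 F t iF t0).
Qed.

Lemma rowrel_T (a b c d k : int) : 0 < m2det (a, b, c, d) ->
  rowrel (a + k * c, b + k * d, c, d) (a, b, c, d).
Proof.
move=> dA; split; last by move=> F t iF t0; rewrite mobT // modinv_addz // Im_mob.
exists (1, k, 0, 1); split; first by rewrite /= mulr0 subr0 mul1r.
by rewrite /=; congr (_, _, _, _); ring.
Qed.

Lemma rowrel_S (a b c d : int) : 0 < m2det (a, b, c, d) ->
  rowrel (a, b, c, d) (- c, - d, a, b).
Proof.
move=> dA; split; last by move=> F t iF t0; rewrite mobS // (proj2 iF) // Im_mob.
exists (0, 1, -1, 0); split; first by rewrite /= mul0r mulrN1 sub0r opprK.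
by rewrite /=; congr (_, _, _, _); ring.
Qed.

(** Euclid's algorithm on the first column: a T-move reduces [x] modulo [z], an S-move exchanges the
    rows, until [z = 0]; a sign change and a last T-move then normalize the diagonal and reduce [y]
    modulo [w]. *)
Lemma hnf (m : nat) (A : m2) : m2det A = m%:Z -> (0 < m)%N ->
  exists a b d : nat, [/\ (a * d = m)%N, (b < d)%N & rowrel A (a%:Z, b%:Z, 0, d%:Z)].
Proof.
move=> dA m0; move: A dA => [[[x y] z] w].
have [n] := ubnP `|z|%N; elim: n x y z w => // n IH x y z w zn dA.
have dA0 : 0 < m2det (x, y, z, w) by rewrite dA ltz_nat.
have [z0|z0] := eqVneq z 0.
  move: dA dA0; rewrite {}z0 {zn} => dA dA0.
  wlog x0 : x y w dA dA0 / 0 < x.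
    move=> H; have [x0|x0] := ltrP 0 x; first exact: H.
    have xw : 0 < x * w by move: dA0; rewrite /= mulr0 subr0.
    have x0' : 0 < - x by rewrite oppr_gt0 lt_neqAle x0 andbT; apply: contraTneq xw => ->; rewrite mul0r ltxx.
    have [||a [b [d [e1 e2 e3]]]] := H (- x) (- y) (- w) _ _ x0'.
    - by move: dA; rewrite /= !mulr0 !subr0 mulrNN.
    - by move: dA0; rewrite /= !mulr0 !subr0 mulrNN.
    exists a, b, d; split=> //; apply: rowrel_trans e3; split.
      exists (-1, 0, 0, -1); split=> //=; congr (_, _, _, _); ring.
    by move=> F t _ _; rewrite -[in RHS](oppr0 int) mobN.
  have xw : x * w = m%:Z by move: dA; rewrite /= mulr0 subr0.
  have w0 : 0 < w by rewrite -(pmulr_rgt0 _ x0) xw ltz_nat.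
  exists `|x|%N, `|(y %% w)%Z|%N, `|w|%N.
  have r0 := modz_ge0 y (lt0r_neq0 w0).
  have ex : `|x|%N%:Z = x by rewrite gez0_abs // ltW.
  have ew : `|w|%N%:Z = w by rewrite gez0_abs // ltW.
  have er : `|(y %% w)%Z|%N%:Z = (y %% w)%Z by rewrite gez0_abs.
  split; rewrite ?ex ?ew ?er.
  - by apply/eqP; rewrite -eqz_nat PoszM ex ew xw.
  - by rewrite -ltz_nat er ew ltz_pmod.
  have := @rowrel_T x (y %% w)%Z 0 w (y %/ w)%Z; rewrite mulr0 addr0 addrC -divz_eq.
  by apply; rewrite /= mulr0 subr0 xw ltz_nat.
pose k := (x %/ z)%Z; pose r := (x %% z)%Z; pose y' := y - k * w.
have ex : x = r + k * z by rewrite addrC -divz_eq.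
have ey : y = y' + k * w by rewrite /y' subrK.
have dB : m2det (r, y', z, w) = m%:Z by rewrite -dA /= ex ey; ring.
have rn : (`|r| < n)%N.
  have := ltz_mod x z0; have := modz_ge0 x z0; rewrite -/r; lia.
have dB0 : 0 < m2det (r, y', z, w) by rewrite dB ltz_nat.
have dD : m2det (- z, - w, r, y') = m%:Z by rewrite -dB /=; ring.
have [a [b [d [e1 e2 e3]]]] := IH _ _ _ _ rn dD.
exists a, b, d; split=> //; apply: rowrel_trans e3.
apply: rowrel_trans (rowrel_S dB0); rewrite ex ey; exact: rowrel_T.
Qed.

Lemma hnf_uniq (a b d a' b' d' : nat) (g : m2) : (0 < a)%N -> (0 < a')%N -> (b < d)%N -> (b' < d')%N ->
  m2det g = 1 -> (a%:Z, b%:Z, 0, d%:Z) = m2mul g (a'%:Z, b'%:Z, 0, d'%:Z) -> b = b' /\ d = d'.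
Proof.
move=> a0 a0' bd bd'; move: g => [[[p q] r] s] /= dg [e1 e2 e3 e4].
rewrite !mulr0 !addr0 in e1 e3.
have r0 : r = 0 by move/esym/eqP: e3; rewrite mulf_eq0 => /orP[/eqP//|]; lia.
rewrite r0 mul0r add0r in e4; rewrite r0 mulr0 subr0 in dg.
have p0 : 0 < p by rewrite -(pmulr_lgt0 _ (_ : 0 < a'%:Z)) -?e1.
have s0 : 0 < s by rewrite -(pmulr_rgt0 _ p0) dg.
have p1 : p = 1 by clear -p0 s0 dg; nia.
have s1 : s = 1 by move: dg; rewrite p1 mul1r.
rewrite s1 mul1r in e4; rewrite p1 mul1r in e2.
have ed : d = d' by case: e4.
have q0 : q = 0 by rewrite -ed in e2; clear -e2 bd bd' ed; rewrite -ed in bd'; nia.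
by split=> //; move: e2; rewrite q0 mul0r addr0 => -[].
Qed.

Lemma mob_mul A B t : 0 < m2det A -> 0 < m2det B -> 0 < Im t -> mob (m2mul A B) t = mob A (mob B t).
Proof.
move=> dA dB t0; have tB := Im_mob dB t0.
have dAB : 0 < m2det (m2mul A B) by rewrite m2det_mul mulr_gt0.
move: A B dA dB tB dAB => [[[a b] c] d] [[[a' b'] c'] d'] dA dB tB dAB.
have n1 := mob_denom t0 (m2det_denom dB); have n2 := mob_denom tB (m2det_denom dA).
have n3 := mob_denom t0 (m2det_denom dAB).
move: n2 n3; rewrite /mob /= !intrD !intrM => n2 n3.
have -> : a%:~R * ((a'%:~R * t + b'%:~R) / (c'%:~R * t + d'%:~R)) + b%:~R =
  ((a%:~R * a'%:~R + b%:~R * c'%:~R) * t + (a%:~R * b'%:~R + b%:~R * d'%:~R)) / (c'%:~R * t + d'%:~R) :> C.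
  by field.
have -> : c%:~R * ((a'%:~R * t + b'%:~R) / (c'%:~R * t + d'%:~R)) + d%:~R =
  ((c%:~R * a'%:~R + d%:~R * c'%:~R) * t + (c%:~R * b'%:~R + d%:~R * d'%:~R)) / (c'%:~R * t + d'%:~R) :> C.
  by field.
by field; rewrite n1 n3.
Qed.

Section Hecke.
Variables (m : nat) (m0 : (0 < m)%N).

(** A pair [(d, b)]; the bound [m] is only there to make the type finite, and the entry [a] is
    recovered as [m / d]. *)
Definition hecke_idx : finType := ('I_m.+1 * 'I_m.+1)%type.
Definition hecke_ok (i : hecke_idx) : bool := (i.1 %| m)%N && (i.2 < i.1)%N.
Definition hecke_mat (i : hecke_idx) : m2 := ((m %/ i.1)%N%:Z, i.2%:Z, 0, i.1%:Z).

Lemma hecke_mat_det i : hecke_ok i -> m2det (hecke_mat i) = m%:Z.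
Proof. by move=> /andP[d _]; rewrite /hecke_mat /= mulr0 subr0 -PoszM divnK. Qed.

Lemma hnf_hecke A : m2det A = m%:Z -> exists2 i, hecke_ok i & rowrel A (hecke_mat i).
Proof.
move=> dA; have [a [b [d [e1 e2 e3]]]] := hnf dA m0.
have d0 : (0 < d)%N by exact: leq_ltn_trans e2.
have dm : (d < m.+1)%N.
  by rewrite ltnS -e1 leq_pmull //; case: (a) e1 => // e1; move: m0; rewrite -e1 mul0n.
have bm : (b < m.+1)%N by exact: ltn_trans e2 dm.
exists (Ordinal dm, Ordinal bm).
  by rewrite /hecke_ok /= e2 -e1 dvdn_mull.
by rewrite /hecke_mat /= -e1 mulnK // e1.
Qed.

(** Right multiplication by [g] permutes the classes. If two images coincide, the two
    representatives differ by a left factor of determinant 1, and [hnf_uniq] identifies them. *)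
Lemma hecke_perm g : m2det g = 1 -> exists sg : hecke_idx -> hecke_idx,
  [/\ forall i, hecke_ok i -> hecke_ok (sg i), forall i j, hecke_ok i -> hecke_ok j -> sg i = sg j -> i = j &
   forall F i t, hecke_ok i -> modinv F -> 0 < Im t -> F (mob (hecke_mat i) (mob g t)) = F (mob (hecke_mat (sg i)) t)].
Proof.
move=> dg; have g0 : 0 < m2det g by rewrite dg.
have ex i : exists j, hecke_ok i -> hecke_ok j /\ rowrel (m2mul (hecke_mat i) g) (hecke_mat j).
  case: (boolP (hecke_ok i)) => hi; last by exists i.
  have [|j hj rj] := @hnf_hecke (m2mul (hecke_mat i) g); last by exists j.
  by rewrite m2det_mul dg mulr1 hecke_mat_det.
have [sg hsg] := fin_all_exists ex.
exists sg; split=> [i /hsg[]//|i j hi hj e|F i t hi iF t0]; last first.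
  have [_ [_ <-]] := hsg i hi => //; rewrite mob_mul // hecke_mat_det // ltz_nat //.
have [_ [[ga [g1 e1]] _]] := hsg i hi; have [_ [[gb [g2 e2]] _]] := hsg j hj.
have e3 : hecke_mat i = m2mul (m2mul ga (m2adj gb)) (hecke_mat j).
  have h1 : hecke_mat (sg i) = m2mul (m2adj gb) (m2mul (hecke_mat j) g).
    by rewrite e2 m2mulA m2adjK // m2mul1 e.
  have h2 : hecke_mat i = m2mul (m2mul (hecke_mat i) g) (m2adj g) by rewrite -m2mulA m2adjKr // m2mulr1.
  rewrite h2 e1 h1 -!m2mulA; congr (m2mul ga _); congr (m2mul (m2adj gb) _).
  by rewrite m2adjKr // m2mulr1.
have dpos k : hecke_ok k -> (0 < m %/ k.1)%N.
  move=> /andP[kd kb]; rewrite divn_gt0; first exact: dvdn_leq.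
  exact: leq_ltn_trans kb.
have [_ bi] := andP hi; have [_ bj] := andP hj.
have [|eb ed] := hnf_uniq (dpos i hi) (dpos j hj) bi bj _ e3.
  by rewrite m2det_mul g1 m2det_adj g2 mulr1.
by move: eb ed {e e1 e2 e3 hi hj bi bj}; case: i j => [i1 i2] [j1 j2] /= eb ed; congr (_, _); apply: val_inj.
Qed.

Definition hecke_prod (F : C -> C) (tau : C) : C := \prod_(i : hecke_idx | hecke_ok i) (F tau - F (mob (hecke_mat i) tau)).

Lemma hecke_prod_inv g F t : m2det g = 1 -> modinv F -> 0 < Im t -> F (mob g t) = F t ->
  hecke_prod F (mob g t) = hecke_prod F t.
Proof.
move=> dg iF t0 Fg; have [sg [s1 s2 s3]] := hecke_perm dg.
rewrite /hecke_prod Fg (eq_bigr (fun i => F t - F (mob (hecke_mat (sg i)) t))); last first.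
  by move=> i hi; rewrite s3.
pose S := [set i | hecke_ok i].
have S1 : sg @: S = S.
  apply/eqP; rewrite eqEcard card_in_imset ?leqnn ?andbT.
    by apply/subsetP => j /imsetP[i]; rewrite !inE => hi ->; exact: s1.
  by move=> i j; rewrite !inE; exact: s2.
transitivity (\prod_(i in S) (F t - F (mob (hecke_mat (sg i)) t))).
  by apply: eq_bigl => i; rewrite inE.
rewrite -(big_imset (fun i => F t - F (mob (hecke_mat i) t))) /=; last first.
  by move=> i j; rewrite !inE; exact: s2.
by rewrite S1; apply: eq_bigl => i; rewrite inE.
Qed.

Lemma hecke_prod_modinv F : modinv F -> modinv (hecke_prod F).
Proof.
move=> iF; split=> t t0.
  have e : mob (1, 1, 0, 1) t = t + 1 by rewrite /mob mul1r mul0r add0r divr1.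
  by rewrite -e hecke_prod_inv // e (proj1 iF).
have e : mob (0, -1, 1, 0) t = - t^-1 by rewrite /mob mul0r add0r mul1r addr0 mulN1r.
by rewrite -e hecke_prod_inv // e (proj2 iF).
Qed.

Lemma hecke_prod_zero F A t : modinv F -> 0 < Im t -> m2det A = m%:Z -> mob A t = t -> hecke_prod F t = 0.
Proof.
move=> iF t0 dA e; have [i hi [_ rA]] := hnf_hecke dA.
by rewrite /hecke_prod (bigD1 i) //= -(rA F t iF t0) e subrr mul0r.
Qed.

(* As a d = m is not a square, the orders -1 of h and -a / d of h o A differ, so that the leading terms
   do not cancel. *)
Lemma hecke_prod_has_qexp h rho : (forall n, n ^ 2 <> m)%N -> has_qexp 1 1 h rho -> algunit rho ->
  exists k u, algunit u /\ has_qexp m (m * k) (hecke_prod h) u.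
Proof.
move=> nsq hh ru.
(* In the parameter [q ^ (1 / m)] the pole of [h] has order [m], and that of [h] composed with
   [(a, b, 0, d)] has order [m a / d = a ^ 2]. *)
pose ki (i : hecke_idx) := maxn m ((m %/ i.1) ^ 2).
have term i : hecke_ok i -> exists u, algunit u /\ has_qexp m (ki i) (fun t => h t - h (mob (hecke_mat i) t)) u.
  case: i => [[d dm] [b bm]]; rewrite /hecke_ok /ki /hecke_mat /= => /andP[dd bd].
  have d0 : (0 < d)%N by exact: leq_ltn_trans bd.
  pose a := (m %/ d)%N; have ad : (a * d = m)%N by rewrite /a divnK.
  have a0 : (0 < a)%N by rewrite /a divn_gt0 // dvdn_leq.
  rewrite -/a.
  have H1 : has_qexp m m h rho.
    have := has_qexp_subst 0 (ltn0Sn 0) m0 m0 hh.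
    rewrite mul0r qe0 expr1n invr1 mul1r !muln1; apply: has_qexp_ext => t _.
    rewrite addr0 mulrC mulKf //; by case: (m) m0 => // n _; exact: Cnat_neq0.
  have H2 : has_qexp d a (fun t => h ((a%:R * t + b%:R) / d%:R)) (qe (b%:R / d%:R) ^- 1 * rho).
    by have := has_qexp_subst b (ltn0Sn 0) a0 d0 hh; rewrite !muln1.
  have H3 := has_qexp_subst 0 d0 a0 a0 H2; rewrite mul0r qe0 expr1n invr1 mul1r in H3.
  have uu : algunit (qe (b%:R / d%:R) ^- 1 * rho).
    by apply: algunit_mul => //; apply: algunit_inv; exact: (algunit_qe b%:Z d0).
  have H4 : has_qexp m (a ^ 2) (fun t => - h (mob (a%:Z, b%:Z, 0, d%:Z) t)) (- (qe (b%:R / d%:R) ^- 1 * rho)).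
    rewrite -ad -mulnn -mulN1r; apply: has_qexp_ext (has_qexp_scale (algintN algint1) H3) => t _.
    rewrite mulN1r /mob mulr0z mul0r add0r addr0 -!pmulrn; congr (- h ((_ * _ + _) / _)).
    by rewrite mulrC mulKf //; case: (a) a0 => // n _; exact: Cnat_neq0.
  have [lt|gt|eq] := ltngtP m (a ^ 2); last by have := nsq a; rewrite eq.
    exists (- (qe (b%:R / d%:R) ^- 1 * rho)); split; first exact: algunitN.
    have := has_qexp_add (has_qexp_weaken (a ^ 2 - m) H1); rewrite subnKC ?(ltnW lt) // subn_eq0 leqNgt lt /=.
    by move=> H; have := H _ _ H4; rewrite add0r.
  exists rho; split=> //.
  have := has_qexp_weaken (m - a ^ 2) H4; rewrite subnKC ?(ltnW gt) // subn_eq0 leqNgt gt /= => H5.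
  by have := has_qexp_add H1 H5; rewrite addr0.
have hsum (r : seq hecke_idx) : exists u, algunit u /\
   has_qexp m (\sum_(i <- r | hecke_ok i) ki i) (fun t => \prod_(i <- r | hecke_ok i) (h t - h (mob (hecke_mat i) t))) u.
  elim: r => [|i r [u [uu hu]]].
    exists 1; split; first exact: algunit1.
    by rewrite big_nil; apply: has_qexp_ext (has_qexp_cst m algint1) => t _; rewrite big_nil.
  rewrite big_cons; case: (boolP (hecke_ok i)) => hi; last first.
    by exists u; split=> //; apply: has_qexp_ext hu => t _; rewrite big_cons (negPf hi).
  have [v [vv hv]] := term i hi; exists (v * u); split; first exact: algunit_mul.
  by apply: has_qexp_ext (has_qexp_mul hv hu) => t _; rewrite big_cons hi.
have [u [uu hu]] := hsum (index_enum hecke_idx).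
(* Each [d] comes with [d] values of [b], and [d * a ^ 2 = a * m]: the total order is a multiple of
   [m], as [has_qexp_average] requires. *)
have dv : (m %| \sum_(i : hecke_idx | hecke_ok i) ki i)%N.
  rewrite -(pair_big_dep (fun d : 'I_m.+1 => d %| m)%N (fun d b : 'I_m.+1 => b < d)%N
     (fun d b : 'I_m.+1 => maxn m ((m %/ d) ^ 2))) /=.
  apply: dvdn_sum => d dd.
  rewrite -(big_ord_widen _ (fun=> maxn m ((m %/ d) ^ 2)) (ltnW (ltn_ord d))) sum_nat_const card_ord.
  have [le|lt] := leqP ((m %/ d) ^ 2) m; first by rewrite dvdn_mull.
  by rewrite -mulnn mulnA [(d * _)%N]mulnC divnK // dvdn_mulr.
case/dvdnP: dv => k ek; exists k, u; split=> //; rewrite mulnC -ek.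
exact: hu.
Qed.
End Hecke.

Lemma cm_algint h rho (m : nat) A tau : modinv h -> has_qexp 1 1 h rho -> algunit rho -> 0 < Im tau ->
  m2det A = m%:Z -> (0 < m)%N -> (forall n, n ^ 2 <> m)%N -> mob A tau = tau -> algint (h tau).
Proof.
move=> ih hh ru t0 dA m0 nsq fA.
have iQ := hecke_prod_modinv m0 ih.
have [k [u [uu hu]]] := hecke_prod_has_qexp m0 nsq hh ru.
have hQ := has_qexp_average m0 (proj1 iQ) hu.
have [P [P1 P2 P3 P4]] := modinv_reduction ih hh ru iQ hQ.
have [c0 _ c2] : algunit P`_k by rewrite P3; apply: algunit_mul => //; apply: algunit_inv; exact: algunitX.
have sP : size P = k.+1.
  by apply/eqP; rewrite eqn_leq P2 ltnNge; apply: contra c0 => h'; rewrite nth_default.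
apply: (@algint_root _ ((P`_k)^-1 *: P)).
- by rewrite monicE lead_coefZ lead_coefE sP mulVf.
- by rewrite rootE hornerZ -P4 // (hecke_prod_zero m0 ih t0 dA fA) mulr0.
- by move=> i; rewrite coefZ; apply: algintM.
Qed.

Lemma algint_edge N b1 b2 : (0 < N)%N -> algint (edge N b1 b2).
Proof.
move=> N0; rewrite /edge; case: ifP => _; last exact: algint1.
by apply: algintD; [exact: algint1 | apply: algintN; case: (algunit_qe b2 N0)].
Qed.

Lemma algint_quot x n : algint x -> algint ((1 - x ^+ n) / (1 - x)).
Proof.
move=> ax; have [->|x1] := eqVneq x 1; first by rewrite subrr invr0 mulr0; exact: algint0.
have -> : (1 - x ^+ n) / (1 - x) = \sum_(i < n) x ^+ i.
  have h : 1 - x != 0 by rewrite subr_eq0 eq_sym.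
  by apply: (mulIf h); rewrite mulfVK // mulrC -[RHS]opprK -mulNr opprB -subrX1 opprB.
by apply: algint_sum => i _; exact: algintX.
Qed.

Lemma edge_root N b1 b2 s : (0 < N)%N -> (N %| b1)%N ->
  edge N (s * b1) (s%:Z * b2) = 1 - qe (b2%:~R / N%:R) ^+ s.
Proof.
by move=> N0 d; rewrite /edge dvdn_mull // -qeX intrM -pmulrn mulrA.
Qed.

Lemma edge_ndvd N b1 b2 : ~~ (N %| b1)%N -> edge N b1 b2 = 1.
Proof. by rewrite /edge => /negPf->. Qed.

(** * The invariant function with a simple pole *)

(* Up to roots of unity and powers of q, theta(3 z) is theta(z) at a 4-torsion point z, and theta(6 z),
   theta(9 z) are theta(4 z), theta(z) at a 10-torsion point: the quotients are powers of
   theta(2 z) / theta(z) and theta(4 z) / theta(z), the multipliers being adjusted to balance the squares. *)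
Definition ns4 : seq nat := [:: 2; 2; 2; 2; 2; 2; 2; 2].
Definition ds4 : seq nat := [:: 1; 1; 1; 1; 1; 3; 3; 3].
Definition ns10 : seq nat := [:: 4; 4; 4; 6].
Definition ds10 : seq nat := [:: 1; 1; 1; 9].

Lemma balanced4 : balanced ns4 ds4.
Proof. by split=> //; rewrite !big_cons !big_nil. Qed.
Lemma balanced10 : balanced ns10 ds10.
Proof. by split=> //; rewrite !big_cons !big_nil. Qed.

Definition kappa4 := kappa ns4 ds4 4.

Lemma kappa4_has_qexp (b1 : nat) (b2 : int) k : (0 < b1)%N -> (b1 < 4)%N ->
  (\sum_(s <- ns4) texp 4 (s * b1) <= \sum_(s <- ds4) texp 4 (s * b1) + k)%N ->
  exists rho, algunit rho /\ has_qexp 8 k (kappa4 b1 b2)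
   (if (\sum_(s <- ns4) texp 4 (s * b1) == \sum_(s <- ds4) texp 4 (s * b1) + k)%N
     then rho * edge 4 (2 * b1) (2%:Z * b2) ^+ 8 else 0).
Proof.
move=> b0 b4 hk.
have nd s : coprime 4 s -> edge 4 (s * b1) (s%:Z * b2) = 1.
  by move=> cs; apply: edge_ndvd; rewrite Gauss_dvdr // gtnNdvd.
have eE : prod_quot ns4 ds4 (fun s => edge 4 (s * b1) (s%:Z * b2)) = edge 4 (2 * b1) (2%:Z * b2) ^+ 8.
  by rewrite /prod_quot !big_cons !big_nil !(nd 1%N) ?(nd 3%N) //; set x := edge _ _ _; rewrite !mulr1 invr1; ring.
have [|rho [h1 h2]] := @kappa_has_qexp ns4 ds4 4 b1 b2 isT.
  by rewrite eE; apply: algintX; exact: algint_edge.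
exists rho; split=> //; have := h2 k hk; rewrite eE; exact.
Qed.

Lemma kappa4_lead (b2 : int) : exists2 rho, algunit rho & has_qexp 8 2 (kappa4 1 b2) rho.
Proof.
have [|rho [h1 h2]] := @kappa4_has_qexp 1 b2 2 isT isT; first by rewrite !big_cons !big_nil.
exists rho => //; move: h2; rewrite !big_cons !big_nil /=.
by rewrite edge_ndvd // expr1n mulr1.
Qed.

Lemma kappa4_two : exists u, has_qexp 8 0 (kappa4 2 1) u.
Proof.
have [|rho [h1 h2]] := @kappa4_has_qexp 2 1 0 isT isT; first by rewrite !big_cons !big_nil.
by eexists; exact: h2.
Qed.

Lemma kappa4_zero : exists u, has_qexp 8 0 (kappa4 0 1) u.
Proof.
have [|rho [h1 h2]] := @kappa_has_qexp ns4 ds4 4 0 1 isT; last first.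
  by eexists; apply: (h2 0%N); rewrite !big_cons !big_nil.
set z := qe (1%:~R / 4%:R : C).
have z4 : z ^+ 4 = 1 by rewrite /z -qeX mulrCA mulfV ?mulr1 ?qe1 //; exact: Cnat_neq0.
have [_ za _] : algunit z by exact: algunit_qe.
rewrite (eq_prod_quot (g := fun s => 1 - z ^+ s)); last by move=> s _; exact: edge_root.
(* As [z ^ 6 = z ^ 2], both kinds of denominators, [1 - z] and [1 - z ^ 3], divide [1 - z ^ 2]. *)
have -> : prod_quot ns4 ds4 (fun s => 1 - z ^+ s) = ((1 - z ^+ 2) / (1 - z)) ^+ 5 * ((1 - (z ^+ 3) ^+ 2) / (1 - z ^+ 3)) ^+ 3.
  rewrite -exprM (_ : 3 * 2 = 4 + 2)%N // exprD z4 mul1r /prod_quot !big_cons !big_nil expr1 !mulr1 !invfM.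
  by move: (1 - z ^+ 2) (1 - z)^-1 (1 - z ^+ 3)^-1 => a b c; ring.
by apply: algintM; apply: algintX; apply: algint_quot => //; exact: algintX.
Qed.

(** The six points of exact order 4, up to sign, are grouped in pairs by [b] modulo 2. T exchanges
    [y2] and [y3], S exchanges [y1] and [y2], so symmetric functions of the three are invariant. As
    [y2] and [y3] have poles of order 1/2 in [q] and [y1] has none, the second symmetric function
    has a simple pole, with a unit as leading coefficient. *)
Definition h4 (tau : C) : C :=
  let y1 := kappa4 0 1 tau * kappa4 2 1 tau in
  let y2 := kappa4 1 0 tau * kappa4 1 2 tau in
  let y3 := kappa4 1 1 tau * kappa4 1 3 tau in
  y1 * y2 + y3 * y1 + y2 * y3.

Lemma h4_modinv : modinv h4.
Proof.
have e21 t : 0 < Im t -> kappa4 2 3 t = kappa4 2 1 t.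
  by move=> t0; rewrite /kappa4 -(kappaN _ balanced4); apply: (kappa_mod balanced4).
have e10 t : 0 < Im t -> kappa4 1 4 t = kappa4 1 0 t by move=> t0; apply: (kappa_mod balanced4).
split=> t t0.
  have T b1 b2 : kappa4 b1 b2 (t + 1) = kappa4 b1 (b1 + b2) t by exact: kappa_T.
  rewrite /h4 !T.
  rewrite -[kappa4 0 (0 + 1) t]/(kappa4 0 1 t) -[kappa4 2 (2 + 1) t]/(kappa4 2 3 t) e21 //.
  rewrite -[kappa4 1 (1 + 0) t]/(kappa4 1 1 t) -[kappa4 1 (1 + 2) t]/(kappa4 1 3 t).
  rewrite -[kappa4 1 (1 + 1) t]/(kappa4 1 2 t) -[kappa4 1 (1 + 3) t]/(kappa4 1 4 t) e10 //.
  ring.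
have S b1 b2 : good (ns4 ++ ds4) 4 b1 b2 -> kappa4 b1 b2 (- t^-1) = kappa4 b2 (- b1) t by apply: (kappa_S balanced4).
rewrite /h4 !S //.
have a1 : kappa4 1 (- 0) t = kappa4 1 0 t by rewrite oppr0.
have a2 : kappa4 1 (- 2) t = kappa4 1 2 t by apply: (kappa_mod balanced4).
have a3 : kappa4 0 (- 1) t = kappa4 0 1 t by rewrite /kappa4 -(kappaN _ balanced4).
have a4 : kappa4 2 (- 1) t = kappa4 2 1 t by rewrite /kappa4 -(kappaN _ balanced4); apply: (kappa_mod balanced4).
have a5 : kappa4 1 (- 1) t = kappa4 1 3 t by apply: (kappa_mod balanced4).
have a6 : kappa4 3 (- 1) t = kappa4 1 1 t by rewrite /kappa4 -(kappaN _ balanced4); apply: (kappa_mod balanced4).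
rewrite a1 a2 a3 a4 a5 a6; ring.
Qed.

Lemma h4_has_qexp : exists2 rho, algunit rho & has_qexp 1 1 h4 rho.
Proof.
have [r0 u0 H0] := kappa4_lead 0; have [r1 u1 H1] := kappa4_lead 1.
have [r2 u2 H2] := kappa4_lead 2; have [r3 u3 H3] := kappa4_lead 3.
have [v1 V1] := kappa4_zero; have [v2 V2] := kappa4_two.
have Y1 := has_qexp_mul V1 V2; have Y2 := has_qexp_mul H0 H2; have Y3 := has_qexp_mul H1 H3.
(* In [q ^ (1 / 8)] the orders of [y1], [y2], [y3] are 0, 4, 4. Raised from order 4 to order 8, the
   products with [y1] add nothing to the leading coefficient. *)
have A := has_qexp_weaken 4 (has_qexp_mul Y1 Y2); have B := has_qexp_weaken 4 (has_qexp_mul Y3 Y1).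
have D := has_qexp_add (has_qexp_add A B) (has_qexp_mul Y2 Y3).
rewrite /= !add0r in D.
exists (r0 * r2 * (r1 * r3)); first by do !apply: algunit_mul.
by apply: (has_qexp_average (M := 8)) => //; exact: (proj1 h4_modinv).
Qed.

(** * Level 10 *)

(** For the coefficients of the product of the [X - kappa_b] any pole order will do: it only affects
    the degree of the polynomial in [h]. *)
Definition has_some_qexp M (F : C -> C) : Prop := exists k u, has_qexp M k F u.

Lemma has_some_qexp_cst M c : algint c -> has_some_qexp M (fun=> c).
Proof. by move=> h; exists 0%N, c; exact: has_qexp_cst. Qed.

Lemma has_some_qexp_mul M F G : has_some_qexp M F -> has_some_qexp M G -> has_some_qexp M (fun t => F t * G t).
Proof. by move=> [k [u h]] [j [v g]]; exists (k + j)%N, (u * v); exact: has_qexp_mul. Qed.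

Lemma has_some_qexp_add M F G : has_some_qexp M F -> has_some_qexp M G -> has_some_qexp M (fun t => F t + G t).
Proof.
move=> [k [u h]] [j [v g]]; exists (k + j)%N; eexists.
apply: has_qexp_add; first exact: (has_qexp_weaken j h).
by rewrite addnC; exact: (has_qexp_weaken k g).
Qed.

Lemma has_some_qexp_ext M F G : (forall tau, 0 < Im tau -> F tau = G tau) -> has_some_qexp M F -> has_some_qexp M G.
Proof. by move=> e [k [u h]]; exists k, u; exact: has_qexp_ext h. Qed.

Lemma has_some_qexp_coef_prod M (I : eqType) (r : seq I) (P : pred I) (F : I -> C -> C) :
  (forall i, P i -> has_some_qexp M (F i)) ->
  forall n, has_some_qexp M (fun t => (\prod_(i <- r | P i) ('X - (F i t)%:P))`_n).
Proof.
move=> hF; elim: r => [|i r IH] n.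
  apply: (has_some_qexp_ext (F := fun=> (n == 0%N)%:R)) => [t _|]; first by rewrite big_nil coef1.
  by apply: has_some_qexp_cst; case: (_ == _); [exact: algint1 | exact: algint0].
case: (boolP (P i)) => hi; last first.
  by apply: has_some_qexp_ext (IH n) => t _; rewrite big_cons (negPf hi).
apply: (has_some_qexp_ext (F := fun t => (if n == 0%N then 0 else (\prod_(j <- r | P j) ('X - (F j t)%:P))`_n.-1) +
   -1 * (F i t * (\prod_(j <- r | P j) ('X - (F j t)%:P))`_n))).
  by move=> t _; rewrite big_cons hi mulrBl coefB coefXM coefCM mulN1r.
apply: has_some_qexp_add.
  by case: (n == 0%N); [apply: has_some_qexp_cst; exact: algint0 | exact: IH].
by apply: has_some_qexp_mul; [apply: has_some_qexp_cst; apply: algintN; exact: algint1 | apply: has_some_qexp_mul; [exact: hF | exact: IH]].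
Qed.

Lemma has_some_qexp_value h rho G tau M : (0 < M)%N -> modinv h -> has_qexp 1 1 h rho -> algunit rho -> 0 < Im tau -> algint (h tau) ->
  modinv G -> has_some_qexp M G -> algint (G tau).
Proof.
move=> M0 ih hh ru t0 ah iG [k [u hG]].
have hG' : exists v, has_qexp M (M * k) G v.
  by eexists; rewrite -(subnKC (leq_pmull k M0)); exact: has_qexp_weaken hG.
have [v {}hG'] := hG'.
have [P [P1 _ _ P4]] := modinv_reduction ih hh ru iG (has_qexp_average M0 (proj1 iG) hG').
rewrite P4 //; apply: integral_horner ah; exact/integral_poly.
Qed.

Lemma good_T r N b1 b2 : good r N b1 (b1 + b2) = good r N b1 b2.
Proof.
apply: eq_all => s; rewrite mulrDr; congr (~~ _).
by case: (boolP (_ \in _)) => //= h; rewrite rpredDl.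
Qed.

Lemma good_S r N b1 b2 : good r N b2 (- b1) = good r N b1 b2.
Proof. by apply: eq_all => s; rewrite mulrN rpredN andbC. Qed.

Definition kappa10 (b : 'I_10 * 'I_10) : C -> C := kappa ns10 ds10 10 (b.1 : nat)%:Z (b.2 : nat)%:Z.
Definition ok10 (b : 'I_10 * 'I_10) : bool := good (ns10 ++ ds10) 10 (b.1 : nat)%:Z (b.2 : nat)%:Z.

(** The denominator must not spoil integrality. If 10 does not divide [b1], the multipliers 1 and 9,
    prime to 10, give [edge = 1] there. If it does, [z ^ 10 = 1] turns [1 - z ^ 6] into
    [1 - (z ^ 9) ^ 4], a multiple of [1 - z ^ 9]. *)
Lemma kappa10_has_some_qexp b : has_some_qexp 20 (kappa10 b).
Proof.
have [|rho [h1 h2]] := @kappa_has_qexp ns10 ds10 10 b.1 b.2 isT; last first.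
  exists (\sum_(s <- ns10) texp 10 (s * b.1))%N; eexists; exact: (h2 _ (leq_addl _ _)).
case: (boolP (10 %| b.1)%N) => d.
  set z := qe ((b.2 : nat)%:~R / 10%:R : C).
  have z10 : z ^+ 10 = 1 by rewrite /z -qeX mulrCA mulfV ?mulr1 ?qe_int //; exact: Cnat_neq0.
  have [_ za _] : algunit z by exact: algunit_qe.
  rewrite (eq_prod_quot (g := fun s => 1 - z ^+ s)); last by move=> s _; exact: edge_root.
  have -> : prod_quot ns10 ds10 (fun s => 1 - z ^+ s) = ((1 - z ^+ 4) / (1 - z)) ^+ 3 * ((1 - (z ^+ 9) ^+ 4) / (1 - z ^+ 9)).
    rewrite -exprM (_ : 9 * 4 = 10 * 3 + 6)%N // exprD exprM z10 expr1n mul1r /prod_quot !big_cons !big_nil expr1 !mulr1 !invfM.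
    by move: (1 - z ^+ 4) (1 - z ^+ 6) (1 - z)^-1 (1 - z ^+ 9)^-1 => a a' b' c; ring.
  by apply: algintM; [apply: algintX; exact: algint_quot | apply: algint_quot; exact: algintX].
have nd s : coprime 10 s -> edge 10 (s * b.1) (s%:Z * (b.2 : nat)%:Z) = 1.
  by move=> cs; apply: edge_ndvd; rewrite Gauss_dvdr.
rewrite /prod_quot [X in _ / X](_ : _ = 1); last first.
  by rewrite !big_cons big_nil !(nd 1%N) ?(nd 9%N) // !mulr1.
by rewrite divr1; apply: algint_prod => s _; exact: algint_edge.
Qed.

Lemma modz_ord10 (x : nat) : ((x %% 10)%N%:Z = x%:Z %[mod 10%:Z])%Z.
Proof. by rewrite -modz_nat modz_mod. Qed.

Definition shift10T (b : 'I_10 * 'I_10) : 'I_10 * 'I_10 := (b.1, b.1 + b.2).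
Definition shift10S (b : 'I_10 * 'I_10) : 'I_10 * 'I_10 := (b.2, - b.1).

Lemma shift10T_inj : injective shift10T.
Proof.
move=> [a b] [c d] /eqP; rewrite xpair_eqE /= => /andP[/eqP e1 /eqP].
by rewrite e1 => /addrI ->.
Qed.

Lemma shift10S_inj : injective shift10S.
Proof.
move=> [a b] [c d] /eqP; rewrite xpair_eqE /= => /andP[/eqP e1 /eqP /oppr_inj e2].
by rewrite e1 e2.
Qed.

Lemma shift10T_mod (b : 'I_10 * 'I_10) : (((shift10T b).2 : nat)%:Z = (b.1 : nat)%:Z + (b.2 : nat)%:Z %[mod 10%:Z])%Z.
Proof. exact: modz_ord10. Qed.

Lemma shift10S_mod (b : 'I_10 * 'I_10) : (((shift10S b).2 : nat)%:Z = - (b.1 : nat)%:Z %[mod 10%:Z])%Z.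
Proof.
have -> : ((shift10S b).2 : nat) = ((10 - b.1) %% 10)%N by [].
rewrite modz_ord10 -subzn; last by rewrite ltnW // ltn_ord.
by rewrite modzDl.
Qed.

Lemma ok10T b : ok10 (shift10T b) = ok10 b.
Proof. by rewrite /ok10 (good_mod _ (erefl _) (shift10T_mod b)) good_T. Qed.

Lemma ok10S b : ok10 (shift10S b) = ok10 b.
Proof. by rewrite /ok10 (good_mod _ (erefl _) (shift10S_mod b)) good_S. Qed.

Lemma kappa10T b t : 0 < Im t -> ok10 b -> kappa10 b (t + 1) = kappa10 (shift10T b) t.
Proof.
move=> t0 gb; rewrite /kappa10 kappa_T; apply: (kappa_mod balanced10) => //; first by rewrite good_T.
by rewrite shift10T_mod.
Qed.

Lemma kappa10S b t : 0 < Im t -> ok10 b -> kappa10 b (- t^-1) = kappa10 (shift10S b) t.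
Proof.
move=> t0 gb; rewrite /kappa10 (kappa_S balanced10) //; apply: (kappa_mod balanced10) => //; first by rewrite good_S.
by rewrite shift10S_mod.
Qed.

Lemma kappa10_coef_modinv n : modinv (fun t => (\prod_(b | ok10 b) ('X - (kappa10 b t)%:P))`_n).
Proof.
split=> t t0; congr ((polyseq _)`_n).
  rewrite (eq_bigr (fun b => 'X - (kappa10 (shift10T b) t)%:P)); last by move=> b ob; rewrite kappa10T.
  rewrite [RHS](reindex_inj shift10T_inj) /=; apply: eq_bigl => b; by rewrite ok10T.
rewrite (eq_bigr (fun b => 'X - (kappa10 (shift10S b) t)%:P)); last by move=> b ob; rewrite kappa10S.
rewrite [RHS](reindex_inj shift10S_inj) /=; apply: eq_bigl => b; by rewrite ok10S.
Qed.

Lemma kappa10_algint b tau : 0 < Im tau -> ok10 b -> algint (h4 tau) -> algint (kappa10 b tau).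
Proof.
move=> t0 ob ah; have [rho ur hr] := h4_has_qexp.
apply: (@algint_root _ (\prod_(b | ok10 b) ('X - (kappa10 b tau)%:P))).
- by apply: monic_prod => i _; exact: monicXsubC.
- by rewrite rootE horner_prod (bigD1 b) //= hornerXsubC subrr mul0r.
move=> n; apply: (has_some_qexp_value (M := 20) (G := fun t => (\prod_(b | ok10 b) ('X - (kappa10 b t)%:P))`_n) _ h4_modinv hr) => //.
  exact: kappa10_coef_modinv.
by apply: has_some_qexp_coef_prod => i _; exact: kappa10_has_some_qexp.
Qed.

Lemma qpowE (r : R) tau : qpow r tau = qe (RtoC r * tau).
Proof.
rewrite /qpow /qe -CmultE; congr cexp; rewrite !CmultE.
have -> : RtoC (Rmult (Rmult (IZR 2) PI) r) = RtoC (2%:R * PI) * RtoC r.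
  by rewrite -rmorphM; congr RtoC; rE; congr (_ * _ * _); rewrite -INRE.
ring.
Qed.

(** With period [10 tau], the theta value at [a tau] is the pair of products for the residues [a]
    and [10 - a] modulo 10, as in the definitions of [I] and [J]. *)
Lemma theta_mul (a : nat) tau : (a <= 10)%N -> 0 < Im tau ->
  theta (a%:R * tau) (10%:R * tau) = - qe (- (a%:R * tau / 2%:R)) *
   (poch_inf (qe (a%:R * tau)) (qe (10%:R * tau)) * poch_inf (qe ((10 - a)%:R * tau)) (qe (10%:R * tau))).
Proof.
move=> a10 t0; have t1 : 0 < Im (10%:R * tau) by rewrite Im_muln mulr_gt0 // ltr0n.
have q1 := cn_qe_lt1 t1.
have s1 : sinq (a%:R * tau) = - qe (- (a%:R * tau / 2%:R)) * (1 - qe (a%:R * tau)).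
  by rewrite -opprB mulrNN qe_sub1 qeN mulKf // qe_neq0.
rewrite /theta s1 [poch_inf (qe (a%:R * tau)) _](poch_inf_rec _ q1) -qeD natrB // [(10%:R - a%:R) * tau]mulrBl; ring.
Qed.

Lemma RtoC_IZR_nat (n : nat) : RtoC (IZR (Z.of_nat n)) = n%:R.
Proof. by rewrite -INR_IZR_INZ INRE rmorph_nat. Qed.

Lemma RtoC_divn (m n : nat) : RtoC (Rdiv (IZR (Z.of_nat m)) (IZR (Z.of_nat n))) = m%:R / n%:R.
Proof. by rewrite -!RtoC_IZR_nat RdivE; exact: (fmorph_div RtoC). Qed.

(** * Complex multiplication and conclusion *)

Definition pochprod (a b : nat) (tau : C) : C :=
  poch_inf (qe (a%:R * tau)) (qe (10%:R * tau)) * poch_inf (qe (b%:R * tau)) (qe (10%:R * tau)).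

Lemma qe_quarter (tau : C) n : qe (- (n%:R * (tau / 4%:R))) = qe (tau / 4%:R) ^- n.
Proof. by rewrite qeN qeX. Qed.

Lemma JfunE tau : Jfun tau = qe (tau / 4%:R) * pochprod 2 8 tau / pochprod 3 7 tau.
Proof.
rewrite /Jfun !qpowE CdivE !CmultE /pochprod.
rewrite (RtoC_IZR_nat 2) (RtoC_IZR_nat 3) (RtoC_IZR_nat 7) (RtoC_IZR_nat 8) (RtoC_IZR_nat 10).
have -> : RtoC (Rdiv (IZR 1) (IZR 4)) = 4%:R^-1.
  by apply: etrans (RtoC_divn 1 4) _; rewrite div1r.
by rewrite [4%:R^-1 * tau]mulrC.
Qed.

Lemma IfunE tau : Ifun tau = qe (tau / 4%:R) ^+ 3 * pochprod 1 9 tau / pochprod 4 6 tau.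
Proof.
rewrite /Ifun !qpowE CdivE !CmultE /pochprod.
rewrite (RtoC_IZR_nat 1) (RtoC_IZR_nat 4) (RtoC_IZR_nat 6) (RtoC_IZR_nat 9) (RtoC_IZR_nat 10).
have -> : RtoC (Rdiv (IZR 3) (IZR 4)) = 3%:R / 4%:R.
  exact: (RtoC_divn 3 4).
rewrite -qeX; congr (qe _ * _ / _); ring.
Qed.

(** Here [z = 3 tau]: the multipliers lead to [12 = 10 + 2], [18 = 20 - 2] and [27 = 30 - 3], so
    that only theta at [2 tau] and [3 tau] remains. All exponentials are counted as powers of
    [Q = q ^ (1 / 4)]. *)
Lemma Jfun_pow4 tau : 0 < Im tau -> Jfun tau ^+ 4 = kappa ns10 ds10 10 3 0 (10%:R * tau).
Proof.
move=> t0; have t1 : 0 < Im (10%:R * tau) by rewrite Im_muln mulr_gt0 // ltr0n.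
rewrite /kappa /theta_quot.
have C10 : (10%:R : C) != 0 by exact: Cnat_neq0.
have C2 := Ctwo_neq0; have C4 : (4%:R : C) != 0 by exact: Cnat_neq0.
have -> : (3%:~R * (10%:R * tau) + 0%:~R) / 10%:R = 3%:R * tau :> C.
  by rewrite mulr0z addr0 mulrCA mulrC mulKf // -pmulrn.
rewrite /prod_quot !big_cons !big_nil !mulr1 JfunE; set Q := qe (tau / 4%:R).
have Q0 : Q != 0 by exact: qe_neq0.
have th2 : theta (2%:R * tau) (10%:R * tau) = - Q ^- 4 * pochprod 2 8 tau.
  rewrite theta_mul // /Q -qe_quarter; congr (- qe _ * _); field; by rewrite C2 C4.
have th3 : theta (3%:R * tau) (10%:R * tau) = - Q ^- 6 * pochprod 3 7 tau.
  rewrite theta_mul // /Q -qe_quarter; congr (- qe _ * _); field; by rewrite C2 C4.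
have th12 : theta (4%:R * (3%:R * tau)) (10%:R * tau) = - Q ^- 28 * theta (2%:R * tau) (10%:R * tau).
  have -> : 4%:R * (3%:R * tau) = 2%:R * tau + 1%:R * (10%:R * tau) by ring.
  rewrite theta_addntau // /Q -qe_quarter expr1 mulN1r; congr (- qe _ * _); field; by rewrite C2 C4.
have th18 : theta (6%:R * (3%:R * tau)) (10%:R * tau) = - Q ^- 64 * theta (2%:R * tau) (10%:R * tau).
  have -> : 6%:R * (3%:R * tau) = - (2%:R * tau) + 2%:R * (10%:R * tau) by ring.
  rewrite theta_addntau // /Q -qe_quarter thetaN sqrrN expr1n mul1r mulrN mulNr; congr (- (qe _ * _)); field; by rewrite C2 C4.
have th27 : theta (9%:R * (3%:R * tau)) (10%:R * tau) = Q ^- 144 * theta (3%:R * tau) (10%:R * tau).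
  have -> : 9%:R * (3%:R * tau) = - (3%:R * tau) + 3%:R * (10%:R * tau) by ring.
  rewrite theta_addntau // /Q -qe_quarter thetaN -[in LHS]signr_odd expr1 mulN1r mulrNN; congr (qe _ * _); field; by rewrite C2 C4.
rewrite th12 th18 th27 !mul1r th2 th3 -/Q.
(* If the denominator were 0, both sides would be 0 by the convention [1 / 0 = 0]. *)
have [->|w0] := eqVneq (pochprod 3 7 tau) 0; first by rewrite !(invr0, mulr0, mul0r, expr0n).
by move: (pochprod 2 8 tau) (pochprod 3 7 tau) w0 => x y y0; field; rewrite Q0 y0 oppr_eq0 oner_eq0 /=.
Qed.

(** Here [z = tau], with [6 = 10 - 4] and [9 = 10 - 1]. *)
Lemma Ifun_pow4 tau : 0 < Im tau -> (Ifun tau)^-1 ^+ 4 = kappa ns10 ds10 10 1 0 (10%:R * tau).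
Proof.
move=> t0; have t1 : 0 < Im (10%:R * tau) by rewrite Im_muln mulr_gt0 // ltr0n.
rewrite /kappa /theta_quot.
have C10 : (10%:R : C) != 0 by exact: Cnat_neq0.
have C2 := Ctwo_neq0; have C4 : (4%:R : C) != 0 by exact: Cnat_neq0.
have -> : (1%:~R * (10%:R * tau) + 0%:~R) / 10%:R = tau :> C.
  by rewrite mulr0z addr0 mul1r mulrC mulKf.
rewrite /prod_quot !big_cons !big_nil !mulr1 IfunE; set Q := qe (tau / 4%:R).
have Q0 : Q != 0 by exact: qe_neq0.
have th4 : theta (4%:R * tau) (10%:R * tau) = - Q ^- 8 * pochprod 4 6 tau.
  rewrite theta_mul // /Q -qe_quarter; congr (- qe _ * _); field; by rewrite C2 C4.
have th1 : theta (1%:R * tau) (10%:R * tau) = - Q ^- 2 * pochprod 1 9 tau.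
  rewrite theta_mul // /Q -qe_quarter; congr (- qe _ * _); field; by rewrite C2 C4.
have th6 : theta (6%:R * tau) (10%:R * tau) = Q ^- 4 * theta (4%:R * tau) (10%:R * tau).
  have -> : 6%:R * tau = - (4%:R * tau) + 1%:R * (10%:R * tau) by ring.
  rewrite theta_addntau // /Q -qe_quarter thetaN expr1 mulN1r mulrNN; congr (qe _ * _); field; by rewrite C2 C4.
have th9 : theta (9%:R * tau) (10%:R * tau) = Q ^- 16 * theta (1%:R * tau) (10%:R * tau).
  have -> : 9%:R * tau = - (1%:R * tau) + 1%:R * (10%:R * tau) by ring.
  rewrite theta_addntau // /Q -qe_quarter thetaN expr1 mulN1r mulrNN; congr (qe _ * _); field; by rewrite C2 C4.
rewrite th6 th9 th4 th1.
have [->|w1] := eqVneq (pochprod 1 9 tau) 0; first by rewrite !(invr0, mulr0, mul0r, expr0n).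
have [->|w4] := eqVneq (pochprod 4 6 tau) 0; first by rewrite !(invr0, mulr0, mul0r, expr0n).
by move: (pochprod 1 9 tau) (pochprod 4 6 tau) w1 w4 => x y x0 y0; field; rewrite ?Q0 ?x0 ?y0 ?oppr_eq0 ?oner_eq0.
Qed.

(** * Algebraic integers in terms of integer coefficients *)

Lemma algint_root4 x : algint (x ^+ 4) -> algint x.
Proof.
move=> h; apply: (@algint_root x ('X^4 - (x ^+ 4)%:P)).
- exact: monicXnsubC.
- by rewrite rootE !hornerE subrr.
- move=> i; rewrite coefB coefXn coefC; apply: algintD; last apply: algintN.
    by case: (_ == _); [exact: algint1|exact: algint0].
  by case: (_ == _) => //; exact: algint0.
Qed.

Lemma sum_nE (f : nat -> C) n : sum_n f n = \sum_(i < n.+1) f i.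
Proof.
elim: n => [|n IH]; first by rewrite sum_O big_ord1.
by rewrite sum_Sn [RHS]big_ord_recr /= -IH.
Qed.

Lemma int_IZR (n : int) : exists c : Z, RtoC (IZR c) = n%:~R.
Proof.
case: n => n; first by exists (Z.of_nat n); rewrite RtoC_IZR_nat -pmulrn.
exists (Z.opp (Z.of_nat n.+1)); rewrite opp_IZR NegzE mulrNz -pmulrn -RtoC_IZR_nat.
exact: rmorphN.
Qed.

Lemma algint_algebraic z : algint z -> algebraic_integer z.
Proof.
move=> [p pm /rootP]; set q := map_poly _ p => rz.
have sq : size q = size p by rewrite size_map_poly_id0 // (monicP pm) oner_eq0.
have [c hc] := choice (fun i => int_IZR p`_i).
have sp0 : (0 < size p)%N by rewrite lt0n size_poly_eq0 monic_neq0.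
(* A monic polynomial with a root is not constant, whence the exponent [S n] in
   [algebraic_integer]. *)
have [n sn] : exists n, size p = n.+2.
  case es : (size p) => [|[|n]]; [by rewrite es in sp0 | | by exists n].
  exfalso; move: rz; have p1 : p = 1.
    have := monicP pm; rewrite lead_coefE es /= => e0.
    by rewrite (size1_polyC (eq_leq es)) e0.
  by rewrite /q p1 rmorph1 hornerC => /eqP; rewrite oner_eq0.
exists n, c; rewrite CplusE CpowE sum_nE; transitivity q.[z]; last exact: rz.
rewrite horner_coef sq sn [RHS]big_ord_recr /= addrC.
congr (_ + _).
  rewrite coef_map /=; have -> : p`_n.+1 = 1 by have := monicP pm; rewrite lead_coefE sn.
  by rewrite mul1r.
by apply: eq_bigr => i _; rewrite CmultE CpowE coef_map /= hc.
Qed.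

Lemma IZR_int (c : Z) : exists n : int, IZR c = n%:~R.
Proof.
case: c => [|p|p]; first by exists 0.
  by exists (Pos.to_nat p)%:Z; rewrite -pmulrn -INRE INR_IPR.
exists (- (Pos.to_nat p)%:Z); rewrite mulrNz -pmulrn -INRE INR_IPR //.
Qed.

Lemma cm_matrix D tau : (0 < D)%N -> in_imag_quad_field D tau -> 0 < Im tau -> exists (A : m2) (m : nat),
  [/\ m2det A = m%:Z, (0 < m)%N, forall n, (n ^ 2 <> m)%N & mob A (10%:R * tau) = 10%:R * tau].
Proof.
move=> D0 [p1 [q1 [p2 [q2 [hq1 [hq2 et]]]]]] t0.
have [P1 eP1] := IZR_int p1; have [Q1 eQ1] := IZR_int q1.
have [P2 eP2] := IZR_int p2; have [Q2 eQ2] := IZR_int q2.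
have Q10 : (Q1%:~R : R) != 0 by rewrite -eQ1; apply/eqP => h; apply: hq1; exact: eq_IZR_R0.
have Q20 : (Q2%:~R : R) != 0 by rewrite -eQ2; apply/eqP => h; apply: hq2; exact: eq_IZR_R0.
have CQ1 : (Q1%:~R : C) != 0 by rewrite -(rmorph_int RtoC) fmorph_eq0.
have CQ2 : (Q2%:~R : C) != 0 by rewrite -(rmorph_int RtoC) fmorph_eq0.
pose s := RtoC (Num.sqrt D%:R) * Ci.
have s2 : s ^+ 2 = - D%:R.
  have c2 : Ci ^+ 2 = -1 :> C.
    by rewrite expr2; apply: C_eqP; rewrite /Complex.Re /Complex.Im /=; rE; rewrite ?(mul0r, mulr0, mul1r, mulr1, sub0r, addr0, add0r, oppr0).
  by rewrite exprMn c2 -rmorphXn sqr_sqrtr ?ler0n // rmorph_nat mulrN1.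
have et' : tau = P1%:~R / Q1%:~R + P2%:~R / Q2%:~R * s.
  rewrite et CplusE CmultE eP1 eQ1 eP2 eQ2 INRE RsqrtE; rE.
  by rewrite /s !rmorphM !fmorphV /= !rmorph_int; ring.
(* Coefficients of a quadratic equation [a t ^ 2 + 2 be t + c = 0] for [t = 10 tau], cleared by
   [(Q1 Q2) ^ 2], with [de = a c - be ^ 2 > 0]. For every integer [l] the matrix
   [(l - be, - c, a, l + be)] fixes [t] and has determinant [l ^ 2 + de]; below, [l = de]. *)
pose a : int := Q1 ^+ 2 * Q2 ^+ 2.
pose be : int := - (10%:Z * P1 * Q1 * Q2 ^+ 2).
pose c : int := (10%:Z * P1) ^+ 2 * Q2 ^+ 2 + (10%:Z * P2) ^+ 2 * Q1 ^+ 2 * D%:Z.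
pose de : int := (10%:Z * P2) ^+ 2 * Q1 ^+ 4 * Q2 ^+ 2 * D%:Z.
have ede : a * c - be ^+ 2 = de by rewrite /a /be /c /de; ring.
have P20 : P2 != 0.
  apply: contraTneq t0 => h; rewrite et' h mulr0z !mul0r addr0.
  by rewrite -!(rmorph_int RtoC) -fmorphV -rmorphM Im_RtoC ltxx.
have de0 : 0 < de.
  have Q1n : Q1 != 0 by move: Q10; rewrite intr_eq0.
  have Q2n : Q2 != 0 by move: Q20; rewrite intr_eq0.
  have ev (x : int) k : x != 0 -> ~~ odd k -> 0 < x ^+ k.
    by move=> x0 ek; rewrite exprn_even_gt0 // x0 orbT.
  apply: mulr_gt0; last by rewrite ltz_nat.
  apply: mulr_gt0; last exact: ev.
  apply: mulr_gt0; last exact: ev.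
  by apply: ev => //; rewrite mulf_neq0.
have quad : a%:~R * (10%:R * tau) ^+ 2 + 2%:R * be%:~R * (10%:R * tau) + c%:~R = 0.
  have -> : c%:~R = (10%:R * P1%:~R) ^+ 2 * Q2%:~R ^+ 2 - (10%:R * P2%:~R) ^+ 2 * Q1%:~R ^+ 2 * s ^+ 2 :> C.
    by rewrite s2 /c intrD !intrM -!pmulrn; ring.
  by rewrite /a /be et' mulrNz !intrM -!pmulrn; field; rewrite CQ1 CQ2.
(* de^2 + de lies strictly between two consecutive squares *)
exists (de - be, - c, a, de + be), (`|de| ^ 2 + `|de|)%N.
have dn : `|de|%N%:Z = de by rewrite gez0_abs // ltW.
have dn0 : (0 < `|de|)%N by rewrite absz_gt0 gt_eqF.
split.
- rewrite /= PoszD -mulnn PoszM dn; move: ede; rewrite expr2 => <-; ring.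
- by rewrite addn_gt0 dn0 orbT.
- move=> n; move: dn0; clear; move: `|de|%N => d d0 e.
  have h1 : (d < n)%N by rewrite -ltn_sqr e -[X in (X < _)%N]addn0 ltn_add2l.
  have h2 : (n < d.+1)%N by rewrite -ltn_sqr e -!mulnn mulSn mulnS; lia.
  lia.
have t1 : 0 < Im (10%:R * tau) by rewrite Im_muln mulr_gt0 // ltr0n.
rewrite /mob; set t := 10%:R * tau in quad t1 *.
have a0 : a != 0 by rewrite /a mulf_neq0 // expf_neq0 -?(intr_eq0 R).
have n0 : a%:~R * t + (de + be)%:~R != 0 :> C by apply: mob_denom => //; rewrite a0.
apply: (mulIf n0); rewrite mulfVK // intrB mulrNz intrD.
apply/eqP; rewrite -subr_eq0 -oppr_eq0 -[X in _ == X]quad; apply/eqP; ring.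
Qed.

Theorem theorem5p5 (D : nat) (tau : C) :
  (0 < D)%coq_nat ->
  in_imag_quad_field D tau ->
  Rlt 0 (Im tau) ->
  algebraic_integer (Jfun tau) /\ algebraic_integer (/ Ifun tau)%C.
Proof.
move=> /ssrnat.ltP D0 hD /RltP t0.
have [A [m [dA m0 nsq fA]]] := cm_matrix D0 hD t0.
have t1 : 0 < Im (10%:R * tau) by rewrite Im_muln mulr_gt0 // ltr0n.
have [rho ur hr] := h4_has_qexp.
have ah := cm_algint h4_modinv hr ur t1 dA m0 nsq fA.
have K (b : nat) (hb : (b < 10)%N) : good (ns10 ++ ds10) 10 b 0 -> algint (kappa ns10 ds10 10 b 0 (10%:R * tau)).
  by move=> g; exact: (@kappa10_algint (Ordinal hb, ord0) _ t1 g ah).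
split; apply: algint_algebraic; apply: algint_root4.
  by rewrite Jfun_pow4 //; apply: (K 3%N).
by rewrite CinvE Ifun_pow4 //; apply: (K 1%N).
Qed.
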